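(* Let $d\ge1$, $k,n\in\mathbb N_0$ and $0\le l\le d-1$. Then \[ \mathrm dV_{n,k}^l\subseteq V_{n,k}^{l+1}, \] and for every sufficiently regular $l$-form $\omega=\sum_{|I|=l}u_I\,\mathrm dx_I$ on $\Omega$, \[ \mathrm d\,\mathcal I_n^l\omega=\mathcal I_n^{l+1}\,\mathrm d\omega. \] That is, the sparse-grid spaces form a discrete de Rham subcomplex and the sparse-grid interpolants form a commuting family.
   Context: $\Omega=(0,1)^d$, $[d]=\{1,\dots,d\}$, $\mathbb N_0=\{0,1,2,\dots\}$. For $I=\{i_1<\dots<i_l\}\subseteq[d]$ put $\mathrm dx_I=\mathrm dx_{i_1}\wedge\cdots\wedge\mathrm dx_{i_l}$. The (weak) exterior derivative of $\omega=\sum_{|I|=l}u_I\,\mathrm dx_I$ is $\mathrm d\omega=\sum_{|I|=l}\sum_{j\notin I}\partial_{x_j}u_I\,\mathrm dx_j\wedge\mathrm dx_I$. One-dimensional spaces. $\mathbb P_r(K)$: polynomials of degree at most $r$ on the interval $K$, $\mathbb P_{-1}(K)=\{0\}$. $\mathcal T_m$: uniform partition of $(0,1)$ into $2^m$ cells. $S_m^{k+1}=\{v\in C^0([0,1]):v|_K\in\mathbb P_{k+1}(K)\ \forall K\in\mathcal T_m\}$, $Q_m^k=\{q\in L^2(0,1):q|_K\in\mathbb P_k(K)\ \forall K\in\mathcal T_m\}$. $Z_0^k=Q_0^k$, and for $m\ge1$, $Z_m^k$ is the $L^2(0,1)$-orthogonal complement of $Q_{m-1}^k$ in $Q_m^k$.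 For $m\ge1$ one has $Z_m^k=\bigoplus_{K\in\mathcal T_{m-1}}Z_K^k$, where $Z_K^k$ consists of functions supported on $K$ that are polynomials of degree at most $k$ on each of the two halves of $K$ and are $L^2(K)$-orthogonal to $\mathbb P_k(K)$; let $\{\psi_{m,K,r}^k\}_{r=0}^k$ be an $L^2$-orthonormal basis of $Z_K^k$. For $K=[a_K,b_K]\in\mathcal T_{m-1}$ set $\theta_{m,K,r}^{k+1}(x)=\int_{a_K}^x\psi_{m,K,r}^k(s)\,\mathrm ds$ for $x\in K$ and $0$ for $x\notin K$. $Y_0^{k+1}=S_0^{k+1}$, and for $m\ge1$, $Y_m^{k+1}=\operatorname{span}\{\theta_{m,K,r}^{k+1}:K\in\mathcal T_{m-1},0\le r\le k\}$. Sparse spaces. $\mathcal M_n=\{\boldsymbol m\in\mathbb N_0^d:m_1+\dots+m_d\le n+d-1\}$ (the same index set for every form degree), $W_{\boldsymbol m}^{I,k}=\big(\bigotimes_{i\in I}Z_{m_i}^k(x_i)\big)\otimes\big(\bigotimes_{j\notin I}Y_{m_j}^{k+1}(x_j)\big)$, and $V_{n,k}^l=\bigoplus_{|I|=l}\bigoplus_{\boldsymbol m\in\mathcal M_n}W_{\boldsymbol m}^{I,k}\,\mathrm dx_I$. Interpolants. For $v\in H^1(0,1)$, $\Pi_m^0v\in S_m^{k+1}$ is the unique function that, on each $K\in\mathcal T_m$, agrees with $v$ at both endpoints of $K$ and satisfies $\int_K(\Pi_m^0v-v)w\,\mathrm dx=0$ for all $w\in\mathbb P_{k-1}(K)$. For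 $q\in L^2(0,1)$, $\Pi_m^1q$ is the $L^2(0,1)$-orthogonal projection of $q$ onto $Q_m^k$. Put $\Pi_{-1}^0=\Pi_{-1}^1=0$ and $\Delta_m^r=\Pi_m^r-\Pi_{m-1}^r$ for $r\in\{0,1\}$. $\Delta_{s,m}^r$ denotes $\Delta_m^r$ acting only in $x_s$. $H_{\boldsymbol m}^I=\big(\prod_{i\in I}\Delta_{i,m_i}^1\big)\big(\prod_{j\notin I}\Delta_{j,m_j}^0\big)$, $\mathcal I_n^Iu_I=\sum_{\boldsymbol m\in\mathcal M_n}H_{\boldsymbol m}^Iu_I$ and $\mathcal I_n^l\omega=\sum_{|I|=l}(\mathcal I_n^Iu_I)\,\mathrm dx_I$. *)

(* Defs.v *)
From HB Require Import structures.
From mathcomp Require Import all_boot all_order all_algebra.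
From mathcomp Require Import all_classical all_reals all_analysis.

Set Implicit Arguments.
Unset Strict Implicit.
Unset Printing Implicit Defensive.

Import Order.TTheory GRing.Theory Num.Theory.
Import numFieldNormedType.Exports.

Local Open Scope classical_set_scope.
Local Open Scope ring_scope.

Section Lebesgue.
Variable R : realType.

Definition consT n (p : R * n.-tuple R) : n.+1.-tuple R :=
  [the n.+1.-tuple R of p.1 :: p.2].

Lemma measurable_consT n : measurable_fun setT (@consT n).
Proof. by apply: measurable_cons; [exact: measurable_fst|exact: measurable_snd]. Qed.

Section Step.
Variables (n : nat) (m : {sigma_finite_measure set (n.-tuple R) -> \bar R}).

Definition lebesgue_step : set (n.+1.-tuple R) -> \bar R :=
  pushforward (@lebesgue_measure R \x m)%E (@consT n).

Let step_measure : {measure set (n.+1.-tuple R) -> \bar R} := 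
  measure_function_pushforward__canonical__measure_function_Measure
    (@lebesgue_measure R \x m)%E (@measurable_consT n).

HB.instance Definition _ := Measure.copy lebesgue_step step_measure.

Lemma step_sigma_finite : sigma_finite setT lebesgue_step.
Proof.
have /sigma_finiteP[F [TF ndF mF]] := @sigma_finiteT _ _ _ (@lebesgue_measure R).
have /sigma_finiteP[G [TG ndG mG]] := @sigma_finiteT _ _ _ m.
exists (fun i => [set t : n.+1.-tuple R | F i (thead t) /\ G i [tuple of behead t]]).
  apply/seteqP; split => // t _.
  have : setT (thead t) by []. rewrite TF => -[i _ Fi].
  have : setT [tuple of behead t] by []. rewrite TG => -[j _ Gj].
  exists (maxn i j) => //; split.
    by have /subsetPset := ndF _ _ (leq_maxl i j); exact.
  by have /subsetPset := ndG _ _ (leq_maxr i j); exact.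
move=> i; split.
  have -> : [set t : n.+1.-tuple R | F i (thead t) /\ G i [tuple of behead t]] =
    (@tnth n.+1 R ^~ ord0) @^-1` F i `&` (fun t : n.+1.-tuple R => [tuple of behead t]) @^-1` G i by [].
  apply: measurableI; rewrite -[X in measurable X]setTI.
    by apply: measurable_tnth => //; have [] := mF i.
  by apply: measurable_behead => //; have [] := mG i.
rewrite /lebesgue_step /pushforward.
have -> : @consT n @^-1` [set t : n.+1.-tuple R | F i (thead t) /\ G i [tuple of behead t]] =
  F i `*` G i.
  apply/seteqP; split => -[x y] /=; rewrite /consT /=.
    by move=> [? ?]; split => //=; rewrite (_ : y = [tuple of behead (x :: y)])//; exact/val_inj.
  by move=> [/= Fx Gy]; split => //; rewrite (_ : [tuple of _] = y)//; exact/val_inj.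
have [? ?] := mF i; have [? ?] := mG i.
by rewrite product_measure1E// lte_mul_pinfty// ge0_fin_numE.
Qed.

HB.instance Definition _ := Measure_isSigmaFinite.Build _ _ _ lebesgue_step step_sigma_finite.
End Step.

(* Lebesgue measure on R^n, carried by the product sigma-algebra of n.-tuple R:
   Dirac mass for n = 0, then the push-forward of (Lebesgue \x previous). *)
Fixpoint lebesgueT n : {sigma_finite_measure set (n.-tuple R) -> \bar R} :=
  match n with
  | 0 => \d_ ([tuple] : 0.-tuple R)
  | n.+1 => lebesgue_step (lebesgueT n)
  end.
End Lebesgue.

(* Square-integrable functions on D.  Elements of L^2 are represented by actual
   functions; equality of classes is written out as equality almost everywhere. *)
Definition L2 dd (T : measurableType dd) (R : realType) (mu : set T -> \bar R)
    (D : set T) (f : T -> R) : Prop :=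
  measurable_fun D f /\ (\int[mu]_(x in D) ((f x) ^+ 2)%:E < +oo)%E.

Definition span (T : Type) (R : realType) (B : set (T -> R)) : set (T -> R) :=
  [set f | exists N (c : 'I_N -> R) (g : 'I_N -> T -> R),
     (forall i, B (g i)) /\ f = fun x => \sum_i c i * g i x].

(* A polynomial p has degree at most r iff size p <= r.+1; hence "size p <= k"
   encodes degree at most k - 1, and forces p = 0 when k = 0. *)
Section OneDim.
Variable R : realType.
Implicit Types (k m i : nat) (f v q : R -> R).
Let mu := @lebesgue_measure R.

Definition open_itv : set R := `]0, 1[.
Definition closed_itv : set R := `[0, 1].

Definition grid m i : R := i%:R / 2 ^+ m.

(* T_m consists of the cells i < 2 ^ m *)
Definition cell m i : set R := `[grid m i, grid m i.+1].

Definition ae_poly_on k (K : set R) f : Prop :=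
  exists2 p : {poly R}, (size p <= k.+1)%N & {ae mu, forall x, K x -> f x = p.[x]}.

(* S_m^{k+1}; the superscript is shifted by one *)
Definition Sspace k m : set (R -> R) :=
  [set v | {within closed_itv, continuous v} /\
     forall i, (i < 2 ^ m)%N -> exists2 p : {poly R},
       (size p <= k.+2)%N & forall x, cell m i x -> v x = p.[x]].

Definition Qspace k m : set (R -> R) :=
  [set q | L2 mu open_itv q /\
     forall i, (i < 2 ^ m)%N -> ae_poly_on k (cell m i) q].

Definition Zspace k m : set (R -> R) :=
  if m is m'.+1 then
    [set q | Qspace k m q /\
       forall w, Qspace k m' w -> \int[mu]_(x in open_itv) (q x * w x) = 0]
  else Qspace k 0.

(* Z_K^k for the cell K = cell m i; its halves are cells of level m.+1, so the
   functions of this space belong to level m.+1. *)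
Definition Zcell k m i : set (R -> R) :=
  [set f | [/\ L2 mu open_itv f,
     {ae mu, forall x, open_itv x -> ~ cell m i x -> f x = 0},
     ae_poly_on k (cell m.+1 i.*2) f /\ ae_poly_on k (cell m.+1 i.*2.+1) f &
     forall p : {poly R}, (size p <= k.+1)%N ->
       \int[mu]_(x in cell m i) (f x * p.[x]) = 0]].

Definition orthonormal_basis k m i (psi : 'I_k.+1 -> R -> R) : Prop :=
  [/\ forall r, Zcell k m i (psi r),
      forall r s, \int[mu]_(x in open_itv) (psi r x * psi s x) = (r == s)%:R &
      forall f, Zcell k m i f -> exists c : 'I_k.+1 -> R,
        {ae mu, forall x, open_itv x -> f x = \sum_r c r * psi r x}].

Definition theta m i f : R -> R :=
  fun x => if x \in cell m i then \int[mu]_(s in `[grid m i, x]) f s else 0.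

(* Y_m^{k+1} built from the functions psi m i r of level m >= 1, attached to the
   cell i of level m.-1 *)
Definition Yspace k (psi : nat -> nat -> 'I_k.+1 -> R -> R) m : set (R -> R) :=
  if m is m'.+1 then
    span [set f | exists i (r : 'I_k.+1),
            (i < 2 ^ m')%N /\ f = theta m' i (psi m i r)]
  else Sspace k 0.

(* Pi^0_m.  The result is determined on [0, 1] only. *)
Definition Pi0 k m v : R -> R :=
  xget (fun=> 0) [set s | Sspace k m s /\
    forall i, (i < 2 ^ m)%N ->
      [/\ s (grid m i) = v (grid m i), s (grid m i.+1) = v (grid m i.+1) &
          forall w : {poly R}, (size w <= k)%N ->
            \int[mu]_(x in cell m i) ((s x - v x) * w.[x]) = 0]].

(* Pi^1_m.  The projection is an L^2 class; we take its unique right-continuous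
   representative on [0, 1[, so that the projections of the slices of a function
   of several variables are chosen coherently. *)
Definition Pi1 k m q : R -> R :=
  xget (fun=> 0) [set p | [/\ Qspace k m p,
    forall w, Qspace k m w -> \int[mu]_(x in open_itv) ((p x - q x) * w x) = 0 &
    forall x, 0 <= x < 1 -> p t @[t --> x^'+] --> p x]].

Definition increment (Pi : nat -> (R -> R) -> R -> R) m f : R -> R :=
  if m is m'.+1 then fun x => Pi m f x - Pi m' f x else Pi 0 f.

Definition Delta0 k := increment (Pi0 k).
Definition Delta1 k := increment (Pi1 k).

End OneDim.

Section Cube.
Variables (R : realType) (d : nat).
Implicit Types (x : 'rV[R]_d) (u g : 'rV[R]_d -> R) (I J : {set 'I_d}).

Definition open_cube : set 'rV[R]_d := [set x | forall i, 0 < x ord0 i < 1].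
Definition closed_cube : set 'rV[R]_d := [set x | forall i, 0 <= x ord0 i <= 1].

(* Topology and differentiation take place on 'rV[R]_d, measure theory on
   d.-tuple R; this is the identification between the two. *)
Definition to_rV (t : d.-tuple R) : 'rV[R]_d := \row_i tnth t i.

Definition cubeT : set (d.-tuple R) := to_rV @^-1` open_cube.

Definition L2cube u : Prop := L2 (lebesgueT R d) cubeT (u \o to_rV).

Definition eq_ae_cube u g : Prop :=
  {ae lebesgueT R d, forall t, cubeT t -> u (to_rV t) = g (to_rV t)}.

Definition partial (j : 'I_d) u : 'rV[R]_d -> R := 'D_(delta_mx ord0 j) u.

(* C_c^oo(Omega): all iterated partial derivatives exist and are continuous *)
Definition test_function (phi : 'rV[R]_d -> R) : Prop :=
  (forall s : seq 'I_d, let f := foldr partial phi s in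
     continuous f /\ forall j x, derivable f x (delta_mx ord0 j)) /\
  exists K : set 'rV[R]_d,
    [/\ compact K, K `<=` open_cube & forall x, ~ K x -> phi x = 0].

Definition weak_partial (j : 'I_d) u g : Prop :=
  forall phi, test_function phi ->
    \int[lebesgueT R d]_(t in cubeT) (u (to_rV t) * partial j phi (to_rV t)) =
    - \int[lebesgueT R d]_(t in cubeT) (g (to_rV t) * phi (to_rV t)).

(* An l-form is given by its coefficients u_I on dx_I; only the sets I with
   #|I| = l are relevant, the other coefficients are ignored. *)
Definition dform := {set 'I_d} -> 'rV[R]_d -> R.

(* coefficient of dx_J in dx_j /\ dx_I, for j \notin I: moving dx_j to its place
   crosses the dx_i with i < j *)
Definition wedge_coef (j : 'I_d) I J : R :=
  if J == j |: I then (-1) ^+ #|[set i in I | (i < j)%N]| else 0.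

(* \sum_(|I| = l) \sum_(j \notin I) D I j dx_j /\ dx_I *)
Definition ext_sum (l : nat) (D : {set 'I_d} -> 'I_d -> 'rV[R]_d -> R) : dform :=
  fun J x => \sum_(I : {set 'I_d} | #|I| == l) \sum_(j | j \notin I)
    D I j x * wedge_coef j I J.

(* eta is the weak exterior derivative of the l-form omega *)
Definition weak_ext_der (l : nat) (omega eta : dform) : Prop :=
  exists D : {set 'I_d} -> 'I_d -> 'rV[R]_d -> R,
    (forall I, #|I| = l -> L2cube (omega I) /\
       forall j, j \notin I ->
         L2cube (D I j) /\ weak_partial j (omega I) (D I j)) /\
    forall J, #|J| = l.+1 -> eq_ae_cube (eta J) (ext_sum l D J).

(* Regularity of an l-form omega: the coefficients u_I are continuous on the
   closed cube, and so are their classical derivatives D I j in the directions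
   j \notin I, extended continuously from the open cube.  Then ext_sum l D is
   the exterior derivative of omega. *)
Definition regular_form (l : nat) (omega : dform)
    (D : {set 'I_d} -> 'I_d -> 'rV[R]_d -> R) : Prop :=
  forall I, #|I| = l ->
    {within closed_cube, continuous (omega I)} /\
    forall j, j \notin I ->
      (forall x, open_cube x ->
         is_derive x (delta_mx ord0 j) (omega I) (D I j x)) /\
      {within closed_cube, continuous (D I j)}.

(* M_n; all entries of such a multi-index are smaller than n + d when d >= 1,
   which is what the type of m records *)
Definition sparse_index (n : nat) (m : {ffun 'I_d -> 'I_(n + d)}) : bool :=
  (\sum_i m i <= (n + d).-1)%N.

Definition Wspace k (psi : nat -> nat -> 'I_k.+1 -> R -> R) I (m : 'I_d -> nat) :
    set ('rV[R]_d -> R) :=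
  span [set f | exists h : 'I_d -> R -> R,
    [/\ forall i, i \in I -> Zspace k (m i) (h i),
        forall j, j \notin I -> Yspace psi (m j) (h j) &
        f = fun x => \prod_i h i (x ord0 i)]].

Definition Vspace k (psi : nat -> nat -> 'I_k.+1 -> R -> R) (n l : nat) : set dform :=
  [set omega | forall I, #|I| = l -> L2cube (omega I) /\
     exists w : {ffun 'I_d -> 'I_(n + d)} -> 'rV[R]_d -> R,
       (forall m, sparse_index m -> Wspace psi I (fun i => m i) (w m)) /\
       eq_ae_cube (omega I) (fun x => \sum_(m | sparse_index m) w m x)].

Definition update x (s : 'I_d) (t : R) : 'rV[R]_d :=
  \row_i (if i == s then t else x ord0 i).

(* the univariate operator A acting in the variable x_s only *)
Definition act_on (s : 'I_d) (A : (R -> R) -> R -> R) u : 'rV[R]_d -> R :=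
  fun x => A (fun t => u (update x s t)) (x ord0 s).

Definition Hop k (m : 'I_d -> nat) I u : 'rV[R]_d -> R :=
  foldr (fun i => act_on i (Delta1 k (m i)))
    (foldr (fun j => act_on j (Delta0 k (m j))) u (enum (~: I)))
    (enum I).

Definition interp (k n : nat) (omega : dform) : dform := fun I x =>
  \sum_(m : {ffun 'I_d -> 'I_(n + d)} | sparse_index m)
    Hop k (fun i => m i) I (omega I) x.

End Cube.

(* Main.v *)
Require Import Defs.
From mathcomp Require Import all_boot all_order all_algebra.
From mathcomp Require Import all_classical all_reals all_analysis.
From mathcomp Require Import measurable_realfun.
From mathcomp Require Import lra ring.

(* The interpolants are operators of finite rank: on each cell, Delta_m^0 f and
   Delta_m^1 f are combinations of fixed piecewise polynomials whose coefficients
   are bounded linear functionals of f, the L^2 projections being obtained by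
   inverting the Gram matrix of the monomials of the cell.  In one variable,
   (Pi_m^0 f)' = Pi_m^1 f' by integration by parts against P_k, hence Delta_m^0 f
   and Delta_m^1 f' are given by the same functionals and a weakly differentiable
   pair of function families.  Bounded functionals acting on different variables
   commute on C([0,1]^d), so the operator in the differentiated variable can be
   moved innermost in the tensor product H_m^I.  By Fubini, a partial derivative
   is weak as soon as it is weak on every slice in its variable; this also gives
   d V^l in V^(l+1), since Y_m' lies in Z_m. *)

Set Implicit Arguments.
Unset Strict Implicit.
Unset Printing Implicit Defensive.

Import Order.TTheory GRing.Theory Num.Theory.
Import numFieldNormedType.Exports.

Local Open Scope classical_set_scope.
Local Open Scope ring_scope.

(** * Square integrable functions *)

(** [Pi0] and [Pi1] are defined by choice, so their values are unknown until a candidate is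
    exhibited and shown to be unique; and as an operator in one variable is fed with slices,
    uniqueness must hold at points and not merely almost everywhere. For [Pi1] this rests on the
    right-continuous representative. The functionals include point values, so Fubini for Lebesgue
    measure does not make them commute; uniform approximation by finite sums of products does. The
    operator in [x_j] has to go innermost because [u] is differentiable in [x_j], whereas nothing of
    the kind is known about its image under the other operators: next to [u], the univariate
    identity applies to slices of [u] itself. These slices are differentiable only inside the cube
    and continuous up to its boundary, which is why clamping and density arguments recur. *)

Section SquareIntegrable.
Context dd (T : measurableType dd) (R : realType).
Variables (mu : {measure set T -> \bar R}) (D : set T).
Hypotheses (mD : measurable D) (fD : (mu D < +oo)%E).
Implicit Types f g : T -> R.

Lemma L2_sqr_integrable f : L2 mu D f -> mu.-integrable D (EFin \o (fun x => f x ^+ 2)).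
Proof.
move=> [mf If]; apply/integrableP; split.
  by apply/measurable_EFinP; exact: measurable_funX.
by under eq_integral do rewrite /= ger0_norm ?sqr_ge0//.
Qed.

Lemma sqr_integrable_L2 f : measurable_fun D f ->
  mu.-integrable D (EFin \o (fun x => f x ^+ 2)) -> L2 mu D f.
Proof.
move=> mf /integrableP[_ If]; split=> //.
by under eq_integral do rewrite -(ger0_norm (sqr_ge0 _)).
Qed.

Lemma L2M_integrable f g : L2 mu D f -> L2 mu D g ->
  mu.-integrable D (EFin \o (fun x => f x * g x)).
Proof.
move=> Lf Lg; have [mf _] := Lf; have [mg _] := Lg.
have := integrableD mD (L2_sqr_integrable Lf) (L2_sqr_integrable Lg).
apply: le_integrable => //.
  by apply/measurable_EFinP; exact: measurable_funM.
move=> x Dx /=; rewrite lee_fin normrM.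
rewrite [leRHS]ger0_norm ?addr_ge0 ?sqr_ge0//.
rewrite -(real_normK (num_real (f x))) -(real_normK (num_real (g x))).
have := sqr_ge0 (`|f x| - `|g x|).
have := mulr_ge0 (normr_ge0 (f x)) (normr_ge0 (g x)).
by set a := `|f x|; set b := `|g x|; nra.
Qed.

Lemma L2_ext f g : (forall x, D x -> f x = g x) -> L2 mu D f -> L2 mu D g.
Proof.
move=> fg [mf If]; split.
  by apply: eq_measurable_fun mf => x /set_mem; exact: fg.
rewrite (eq_integral (fun x => (f x ^+ 2)%:E))// => x /set_mem Dx.
by rewrite fg.
Qed.

Lemma L2_bounded f M : measurable_fun D f -> (forall x, D x -> `|f x| <= M) -> L2 mu D f.
Proof.
move=> mf fM; apply: sqr_integrable_L2 => //.
apply: measurable_bounded_integrable => //; first exact: measurable_funX.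
exists (M ^+ 2); split; first by rewrite num_real.
move=> N MN x Dx /=; rewrite normrX (le_trans _ (ltW MN))//.
by rewrite lerXn2r// ?nnegrE ?(le_trans _ (fM x Dx)) ?fM.
Qed.

Lemma L2_cst c : L2 mu D (fun=> c).
Proof. exact: (@L2_bounded _ `|c|). Qed.

Lemma L2Z c f : L2 mu D f -> L2 mu D (fun x => c * f x).
Proof.
move=> Lf; have [mf _] := Lf; apply: sqr_integrable_L2.
  exact: measurable_funM.
have := integrableZl mD (c ^+ 2) (L2_sqr_integrable Lf).
by apply: eq_integrable => // x _ /=; rewrite exprMn.
Qed.

Lemma L2D f g : L2 mu D f -> L2 mu D g -> L2 mu D (fun x => f x + g x).
Proof.
move=> Lf Lg; have [mf _] := Lf; have [mg _] := Lg; apply: sqr_integrable_L2.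
  exact: measurable_funD.
have := integrableZl mD 2 (integrableD mD (L2_sqr_integrable Lf) (L2_sqr_integrable Lg)).
apply: le_integrable => //.
  by apply/measurable_EFinP; apply: measurable_funX; exact: measurable_funD.
move=> x Dx /=; rewrite lee_fin [leLHS]ger0_norm ?sqr_ge0// [leRHS]ger0_norm.
  by have := sqr_ge0 (f x - g x); nra.
by rewrite mulr_ge0// addr_ge0// sqr_ge0.
Qed.

Lemma L2_sum I (s : seq I) (P : pred I) (f : I -> T -> R) :
  (forall i, P i -> L2 mu D (f i)) -> L2 mu D (fun x => \sum_(i <- s | P i) f i x).
Proof.
move=> Lf; elim: s => [|i s IH].
  by apply: L2_ext (L2_cst 0) => x _; rewrite big_nil.
have [Pi|nPi] := boolP (P i).
  by apply: L2_ext (L2D (Lf _ Pi) IH) => x _; rewrite big_cons Pi.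
by apply: L2_ext IH => x _; rewrite big_cons (negbTE nPi).
Qed.

Lemma L2_integrable f : L2 mu D f -> mu.-integrable D (EFin \o f).
Proof.
move=> Lf; apply: eq_integrable (L2M_integrable Lf (L2_cst 1)) => //.
by move=> x _ /=; rewrite mulr1.
Qed.

Lemma L2B f g : L2 mu D f -> L2 mu D g -> L2 mu D (fun x => f x - g x).
Proof.
by move=> Lf Lg; apply: L2_ext (L2D Lf (L2Z (-1) Lg)) => x _; rewrite mulN1r.
Qed.

Lemma integrable_sumR I (s : seq I) (P : pred I) (f : I -> T -> R) :
  (forall i, P i -> mu.-integrable D (EFin \o f i)) ->
  mu.-integrable D (EFin \o (fun x => \sum_(i <- s | P i) f i x)).
Proof.
move=> If; have -> : EFin \o (fun x => \sum_(i <- s | P i) f i x) =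
  fun x => (\sum_(i <- s | P i) (f i x)%:E)%E.
  by apply/funext => x /=; rewrite sumEFin.
exact: integrable_sum.
Qed.

Lemma Rintegral_sum I (s : seq I) (P : pred I) (f : I -> T -> R) :
  (forall i, P i -> mu.-integrable D (EFin \o f i)) ->
  \int[mu]_(x in D) (\sum_(i <- s | P i) f i x) =
  \sum_(i <- s | P i) \int[mu]_(x in D) f i x.
Proof.
move=> If; elim: s => [|i s IH].
  by rewrite big_nil; under eq_Rintegral do rewrite big_nil; rewrite Rintegral_cst// mul0r.
have [Pi|nPi] := boolP (P i).
  rewrite big_cons Pi -IH -RintegralD//; last 2 first.
    exact: If.
    exact: integrable_sumR.
  by under eq_Rintegral do rewrite big_cons Pi.
by rewrite big_cons (negbTE nPi) -IH; under eq_Rintegral do rewrite big_cons (negbTE nPi).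
Qed.

Lemma ae_eq_Rintegral f g : measurable_fun D f -> measurable_fun D g ->
  {ae mu, forall x, D x -> f x = g x} ->
  \int[mu]_(x in D) f x = \int[mu]_(x in D) g x.
Proof.
move=> mf mg fg; congr fine; apply: ae_eq_integral => //.
- exact/measurable_EFinP.
- exact/measurable_EFinP.
- by apply: filterS fg => x fg Dx /=; rewrite fg.
Qed.

End SquareIntegrable.

(** * Lebesgue measure on tuples *)

Section LebesgueTuple.
Variable R : realType.
Notation leb := (@lebesgue_measure R).

Definition tset n (t : n.-tuple R) (j : 'I_n) (s : R) : n.-tuple R :=
  [tuple if i == j then s else tnth t i | i < n].

Lemma tset_cons0 n x (y : n.-tuple R) s : tset [tuple of x :: y] ord0 s = [tuple of s :: y].
Proof.
apply: eq_from_tnth => i; rewrite tnth_mktuple.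
have [->|] := eqVneq i ord0; first by rewrite tnth0.
by case: (unliftP ord0 i) => [i' ->|->//] _; rewrite !tnthS.
Qed.

Lemma tset_consS n x (y : n.-tuple R) j s :
  tset [tuple of x :: y] (lift ord0 j) s = [tuple of x :: tset y j s].
Proof.
apply: eq_from_tnth => i; rewrite tnth_mktuple.
case: (unliftP ord0 i) => [i' ->|->]; last by rewrite !tnth0.
by rewrite !tnthS tnth_mktuple (inj_eq (@lift_inj _ ord0)).
Qed.

Lemma integral_lebesgueT_consT n (F : n.+1.-tuple R -> \bar R) :
  measurable_fun setT F ->
  (leb \x lebesgueT R n)%E.-integrable setT (F \o @consT R n) ->
  (\int[lebesgueT R n.+1]_t F t = \int[leb \x lebesgueT R n]_z F (consT z))%E.
Proof.
move=> mF iF.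
rewrite -[LHS]/(\int[pushforward (leb \x lebesgueT R n)%E (@consT R n)]_t F t)%E.
by apply: (integral_pushforward _ mF iF measurableT); exact: measurable_consT.
Qed.

Lemma ge0_integral_lebesgueT_consT n (F : n.+1.-tuple R -> \bar R) :
  measurable_fun setT F -> (forall t, 0 <= F t)%E ->
  (\int[lebesgueT R n.+1]_t F t = \int[leb \x lebesgueT R n]_z F (consT z))%E.
Proof.
move=> mF F0.
rewrite -[LHS]/(\int[pushforward (leb \x lebesgueT R n)%E (@consT R n)]_t F t)%E.
by apply: (ge0_integral_pushforward _ _ measurableT mF) => //; exact: measurable_consT.
Qed.

Lemma integrable_lebesgueT_consT n (F : n.+1.-tuple R -> \bar R) :
  (lebesgueT R n.+1).-integrable setT F ->
  (leb \x lebesgueT R n)%E.-integrable setT (F \o @consT R n).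
Proof.
move=> /integrableP[mF iF]; apply/integrableP; split.
  exact: measurableT_comp mF (@measurable_consT R n).
rewrite ge0_integral_lebesgueT_consT// in iF.
exact: measurableT_comp.
Qed.

(** Fubini in one coordinate of arbitrary position. The recursion peels off the head: if [j] is the
    head, it is integrated first and gives zero for every tail; otherwise the head is integrated
    last, and the induction hypothesis applies to almost every head, where the slice is
    integrable. *)
Lemma integral_slice0 n (j : 'I_n) (E : n.-tuple R -> R) :
  (lebesgueT R n).-integrable setT (EFin \o E) ->
  (forall t, \int[leb]_s (E (tset t j s))%:E = 0)%E ->
  (\int[lebesgueT R n]_t (E t)%:E = 0)%E.
Proof.
elim: n j E => [[]//|n IH] j E iE E0.
have mE := measurable_int _ iE.
have iE' := integrable_lebesgueT_consT iE.
rewrite integral_lebesgueT_consT//.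
case: (unliftP ord0 j) E0 => [j' ->|->] E0.
  rewrite -(integral12_prod_meas1 iE').
  rewrite (@ae_eq_integral _ _ _ leb setT (cst 0%E))//.
  - by rewrite integral0.
  - exact: (measurable_fubini_F iE').
  have := ae_integrable1 iE'; apply: filterS => x iEx _ /=.
  apply: (IH j' (fun y => E (consT (x, y)))); first exact: iEx.
  move=> t; rewrite -(E0 (consT (x, t))); apply: eq_integral => s _.
  by rewrite /consT /= tset_consS.
rewrite -(integral21_prod_meas1 iE').
rewrite (eq_integral (cst 0%E)) ?integral0// => y _.
(* The head [0] is a placeholder that [tset] overwrites. *)
rewrite /fubini_G /= -(E0 (consT (0, y))); apply: eq_integral => s _.
by rewrite /consT /= tset_cons0.
Qed.

Lemma measurable_tnth_comp n (i : 'I_n) (h : R -> R) : measurable_fun setT h ->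
  measurable_fun setT (fun t : n.-tuple R => h (tnth t i)).
Proof. by move=> mh; exact: measurableT_comp mh (measurable_tnth i). Qed.

Lemma measurable_prod_tnth n (g : 'I_n -> R -> R) : (forall i, measurable_fun setT (g i)) ->
  measurable_fun setT (fun t : n.-tuple R => \prod_i g i (tnth t i)).
Proof.
move=> mg; apply: measurable_prod => i _.
exact: measurable_tnth_comp.
Qed.

(** Tonelli factorizes the integral into univariate ones. This yields both the finite measure of the
    cube and the square integrability of tensor products. *)
Lemma integral_prod_tnth_lty n (g : 'I_n -> R -> R) :
  (forall i, measurable_fun setT (g i)) -> (forall i x, 0 <= g i x) ->
  (forall i, \int[leb]_x (g i x)%:E < +oo)%E ->
  (\int[lebesgueT R n]_t (\prod_i g i (tnth t i))%:E < +oo)%E.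
Proof.
elim: n g => [|n IH] g mg g0 ig.
  under eq_integral do rewrite big_ord0.
  by rewrite /= integral_dirac// diracT mul1e ltry.
have mp := measurable_prod_tnth mg.
rewrite ge0_integral_lebesgueT_consT; last 2 first.
- exact/measurable_EFinP.
- by move=> t; rewrite lee_fin prodr_ge0.
rewrite fubini_tonelli1; last 2 first.
- apply/measurable_EFinP.
  exact: (measurableT_comp (f := fun t : n.+1.-tuple R => \prod_i g i (tnth t i)) mp (@measurable_consT R n)).
- by move=> z; rewrite lee_fin prodr_ge0.
pose C := (\int[lebesgueT R n]_t (\prod_i g (lift ord0 i) (tnth t i))%:E)%E.
have mp' : measurable_fun setT (fun t : n.-tuple R => \prod_i g (lift ord0 i) (tnth t i)).
  by apply: (@measurable_prod_tnth n (fun i => g (lift ord0 i))) => i.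
have C0 : (0 <= C)%E by apply: integral_ge0 => t _; rewrite lee_fin prodr_ge0.
have CE x : (\int[lebesgueT R n]_y (\prod_i g i (tnth (consT (x, y)) i))%:E = (g ord0 x)%:E * C)%E.
  rewrite -ge0_integralZl//.
  - apply: eq_integral => y _; rewrite big_ord_recl -EFinM tnth0; congr (_ * _)%:E.
    by apply: eq_bigr => i _; rewrite tnthS.
  - exact/measurable_EFinP.
  - by move=> t _; rewrite lee_fin prodr_ge0.
  - by rewrite lee_fin.
rewrite [ltLHS](_ : _ = \int[leb]_x ((g ord0 x)%:E * C))%E; last by apply: eq_integral => x _; exact: CE.
rewrite ge0_integralZr//.
- apply: lte_mul_pinfty; [by apply: integral_ge0 => x _; rewrite lee_fin| |].
  + by rewrite ge0_fin_numE ?ig//; apply: integral_ge0 => x _; rewrite lee_fin.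
  + by apply: (IH (fun i => g (lift ord0 i))).
- by have /measurable_EFinP := mg ord0.
- by move=> x _; rewrite lee_fin.
Qed.

Lemma cubeTE n (t : n.-tuple R) : cubeT t <-> forall i, 0 < tnth t i < 1.
Proof. by split=> H i; have := H i; rewrite mxE. Qed.

Lemma measurable_cubeT n : measurable (@cubeT R n).
Proof.
have -> : @cubeT R n = \bigcap_(i in [set: 'I_n]) ((@tnth n R)^~ i @^-1` `]0, 1[%classic).
  apply/seteqP; split => t.
    by move=> /cubeTE H i _ /=; rewrite in_itv/= H.
  by move=> H; apply/cubeTE => i; have := H i I; rewrite /= in_itv.
apply: fin_bigcap_measurable => // i _; rewrite -[X in measurable X]setTI.
by apply: measurable_tnth => //; exact: measurable_itv.
Qed.

Lemma lebesgueT_cubeT_lty n : (lebesgueT R n (@cubeT R n) < +oo)%E.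
Proof.
have -> : lebesgueT R n (@cubeT R n) = (\int[lebesgueT R n]_t
   (\prod_i \1_(`]0, 1[%classic : set R) (tnth t i))%:E)%E.
  rewrite -[LHS]mul1e -integral_cst; last exact: measurable_cubeT.
  rewrite integral_mkcond; apply: eq_integral => t _; rewrite patchE.
  case: ifPn => [/set_mem /cubeTE H|/negP H].
    by rewrite big1// => i _; rewrite indicE mem_set//= in_itv/= H.
  have [i Hi] : exists i, ~~ (0 < tnth t i < 1).
    by apply/existsP; apply: contra_notT H; rewrite negb_exists => /forallP H; apply/mem_set/cubeTE => i; have := H i; rewrite negbK.
  rewrite (bigD1 i)//= indicE memNset ?mul0r//= in_itv/=.
  exact/negP.
apply: (@integral_prod_tnth_lty n (fun=> \1_(`]0, 1[%classic : set R))) => [i|i x|i].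
- exact: measurable_indic (measurable_itv _).
- by rewrite indicE.
- have mI : measurable (`]0, 1[%classic : set (g_sigma_algebraType R.-ocitv.-measurable)) by exact: measurable_itv.
  rewrite integral_indic ?setIT//=.
  by have := lebesgue_measure_itv (`]0, 1[ : interval R) => /= ->; rewrite lte_fin ltr01 -EFinB ltry.
Qed.

End LebesgueTuple.

(** * Weak partial derivatives and slices *)

Section WeakPartial.
Variables (R : realType) (d : nat).
Notation leb := (@lebesgue_measure R).
Implicit Types (x : 'rV[R]_d) (u g : 'rV[R]_d -> R).

(** Links the topology of ['rV[R]_d] to the product sigma-algebra on tuples: an open set is a
    countable union of boxes with rational centres and radii [1 / (n + 1)]. *)
Lemma open_to_rV_measurable (O : set 'rV[R]_d) : open O -> measurable (@to_rV R d @^-1` O).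
Proof.
move=> oO.
pose box (p : {ffun 'I_d -> rat} * nat) : set (d.-tuple R) :=
  \bigcap_(i in [set: 'I_d]) ((@tnth d R)^~ i @^-1`
    `](ratr (p.1 i) - p.2.+1%:R^-1), (ratr (p.1 i) + p.2.+1%:R^-1)[%classic).
have mbox p : measurable (box p).
  apply: fin_bigcap_measurable => // i _; rewrite -[X in measurable X]setTI.
  by apply: measurable_tnth => //; exact: measurable_itv.
(* Boxes not contained in [O] are replaced by the empty set, so that the union runs over the whole
   countable index type. *)
pose F p := if `[< box p `<=` @to_rV R d @^-1` O >] then box p else set0.
suff -> : @to_rV R d @^-1` O = \bigcup_p F p.
  apply: countable_bigcupT_measurable => // p.
  by rewrite /F; case: ifP => _; [exact: mbox|exact: measurable0].
apply/seteqP; split => [t Ot|t [p _]]; last first.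
  by rewrite /F; case: asboolP => // + ?; exact.
have /nbhs_ballP[e /= e0 tO] : nbhs (to_rV t) O by apply: open_nbhs_nbhs; split.
(* Half of [e]: the centre [q] lies within [1 / (n + 1)] of [t], and the box adds as much again. *)
have [n ne] : exists n : nat, n.+1%:R^-1 < e / 2.
  have e20 : 0 < e / 2 by rewrite divr_gt0.
  exists (Num.trunc (e / 2)^-1).
  rewrite invf_plt ?posrE ?ltr0n//.
  by have := truncnS_gt (e / 2)^-1.
have q_ (i : 'I_d) : exists q : rat, `|tnth t i - ratr q| < n.+1%:R^-1.
  have /rat_in_itvoo[q] : tnth t i - n.+1%:R^-1 < tnth t i + n.+1%:R^-1.
    by rewrite ltrBlDr -addrA ltrDl addr_gt0 ?invr_gt0 ?ltr0n.
  rewrite in_itv/= => /andP[q1 q2]; exists q; rewrite ltr_norml.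
  by move: q1 q2; set e' := n.+1%:R^-1 => q1 q2; apply/andP; split; lra.
have [q Hq] := choice q_.
exists ([ffun i => q i], n) => //; rewrite /F asboolT.
  move=> i _ /=; rewrite in_itv/= ffunE; have := Hq i; rewrite ltr_norml.
  by set e' := n.+1%:R^-1 => /andP[? ?]; apply/andP; split; lra.
move=> t' Ht'; apply: tO; split => // i j; rewrite !mxE /ball/=.
have := Ht' j I; rewrite /= in_itv/= ffunE; have := Hq j; rewrite !ltr_norml.
by move: ne; set e' := n.+1%:R^-1 => ne /andP[? ?] /andP[? ?]; apply/andP; split; lra.
Qed.

Lemma continuous_to_rV_measurable (f : 'rV[R]_d -> R) : continuous f ->
  measurable_fun setT (f \o @to_rV R d).
Proof.
move=> /continuousP cf; apply: (measurability _ (RGenOpens.measurableE R)).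
move=> _ [_ [a [b ->] <-]]; rewrite setTI comp_preimage.
by apply: open_to_rV_measurable; apply: cf; exact: interval_open.
Qed.

Lemma closed_cube_compact : compact (@closed_cube R d).
Proof.
have := @rV_compact R d (fun=> `[0, 1]%classic) (fun=> @segment_compact R 0 1).
congr compact; apply/seteqP; split => x H i; have := H i; by rewrite /= in_itv.
Qed.

Lemma open_cubeW x : @open_cube R d x -> closed_cube x.
Proof. by move=> H i; have /andP[/ltW -> /ltW ->] := H i. Qed.

Lemma continuous_bounded_cube (f : 'rV[R]_d -> R) : continuous f ->
  exists M, forall x, closed_cube x -> `|f x| <= M.
Proof.
move=> cf; have /compact_bounded[M [_ HM]] : compact (f @` @closed_cube R d).
  by apply: continuous_compact closed_cube_compact; exact: continuous_subspaceT.
exists (M + 1) => x Kx; apply: HM; first by rewrite ltrDl.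
by exists x.
Qed.

Lemma L2cube_continuous (f : 'rV[R]_d -> R) : continuous f -> L2cube f.
Proof.
move=> cf; have [M HM] := continuous_bounded_cube cf.
apply: (@L2_bounded _ _ _ _ _ _ _ _ M).
- exact: measurable_cubeT.
- exact: lebesgueT_cubeT_lty.
- by apply: measurable_funTS; exact: continuous_to_rV_measurable.
- by move=> t Ht; exact/HM/open_cubeW.
Qed.

Lemma updateE x j s : update x j s = update x j 0 + s *: delta_mx ord0 j.
Proof.
apply/rowP => i; rewrite !mxE eqxx/=; case: eqP => _; by rewrite ?add0r ?mulr1 ?mulr0 ?addr0.
Qed.

Lemma continuous_update x j : continuous (fun s => update x j s).
Proof.
move=> s; rewrite (_ : (fun s => _) = fun s => update x j 0 + s *: delta_mx ord0 j); last first.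
  by apply/funext => t; exact: updateE.
by apply: cvgD; [exact: cvg_cst|apply: cvgZr_tmp; exact: cvg_id].
Qed.

Lemma is_derive_slice (f : 'rV[R]_d -> R) x j s :
  derivable f (update x j s) (delta_mx ord0 j) ->
  is_derive s 1 (fun s => f (update x j s)) (partial j f (update x j s)).
Proof.
move=> df.
have E : (fun h : R => h^-1 *: (((fun s => f (update x j s)) \o shift s) (h *: (1 : R)) - f (update x j s))) =
  (fun h : R => h^-1 *: ((f \o shift (update x j s)) (h *: delta_mx ord0 j) - f (update x j s))).
  apply/funext => h /=; congr (_ *: (f _ - _)).
  apply/rowP => i; rewrite !mxE eqxx /=; case: eqP => _; last by rewrite mulr0 add0r.
  by rewrite mulr1; congr (_ + _); exact: mulr1.
apply: DeriveDef; first by rewrite /derivable E.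
by rewrite /derive E.
Qed.

(** [g] is the weak derivative of [h] on []0, 1[]. The test functions are C^1 and vanish at [0] and
    [1], instead of being smooth with compact support: slices of test functions of the cube are of
    this kind, and integration by parts asks for no more. *)
Definition wpair (h g : R -> R) := [/\ L2 leb (@open_itv R) h, L2 leb (@open_itv R) g &
  forall phi dphi : R -> R, continuous phi -> continuous dphi ->
    (forall y : R, is_derive y 1 phi (dphi y)) -> phi 0 = 0 -> phi 1 = 0 ->
    \int[leb]_(y in @open_itv R) (h y * dphi y + g y * phi y) = 0].

Lemma measurable_open_itv : (measurable (@open_itv R : set (measurableTypeR R))).
Proof. exact: measurable_itv. Qed.

Lemma open_itv_lty : (leb (@open_itv R) < +oo)%E.
Proof.
have := lebesgue_measure_itv (`]0, 1[ : interval R) => /= ->.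
by rewrite lte_fin ltr01 -EFinB ltry.
Qed.

Lemma L2_open_itv_continuous (f : R -> R) : {within `[0, 1], continuous f} ->
   L2 leb (@open_itv R) f.
Proof.
move=> cf; have /compact_bounded[M [_ HM]] : compact (f @` `[0, 1]%classic).
  by apply: continuous_compact (@segment_compact R 0 1).
apply: (@L2_bounded _ _ _ _ _ _ _ _ (M + 1)).
- exact: measurable_open_itv.
- exact: open_itv_lty.
- apply: measurable_funS (subspace_continuous_measurable_fun _ cf) => //=.
  exact: subset_itv_oo_cc.
- move=> x Hx; apply: HM; first by rewrite ltrDl.
  by exists x => //; exact: subset_itv_oo_cc Hx.
Qed.

Lemma wpair_integrable (h g phi dphi : R -> R) : wpair h g -> continuous phi -> continuous dphi ->
  leb.-integrable (@open_itv R) (EFin \o (fun y => h y * dphi y + g y * phi y)).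
Proof.
move=> [Lh Lg _] cp cd.
have mI := measurable_open_itv.
apply: (integrableD mI (f := EFin \o (fun y => h y * dphi y)) (g := EFin \o (fun y => g y * phi y))).
  apply: (L2M_integrable mI Lh); apply: L2_open_itv_continuous.
  exact: continuous_subspaceT.
apply: (L2M_integrable mI Lg); apply: L2_open_itv_continuous.
exact: continuous_subspaceT.
Qed.

(** Extended by zero, [u * partial j phi + g * phi] has zero integral along every line in direction
    [j], so [integral_slice0] annihilates its total integral. *)
Lemma weak_partial_slices j u g : L2cube u -> L2cube g ->
  (forall x, open_cube x ->
    wpair (fun s => u (update x j s)) (fun s => g (update x j s))) ->
  weak_partial j u g.
Proof.
move=> Lu Lg wp phi [ctest [K [cK KO phi0]]].
have [cphi dphi] := ctest [::].
have [cpart _] := ctest [:: j].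
have mC := @measurable_cubeT R d.
have Lphi := L2cube_continuous cphi.
have Lpart := L2cube_continuous cpart.
have i1 := L2M_integrable mC Lu Lpart.
have i2 := L2M_integrable mC Lg Lphi.
apply/eqP; rewrite -subr_eq0 opprK -RintegralD//; apply/eqP.
set E0 := fun t => u (to_rV t) * partial j phi (to_rV t) + g (to_rV t) * phi (to_rV t).
have iE0 : (lebesgueT R d).-integrable (@cubeT R d) (EFin \o E0) := integrableD mC i1 i2.
have iE : (lebesgueT R d).-integrable setT (EFin \o (E0 \_ (@cubeT R d))).
  rewrite -restrict_EFin; apply/integrable_restrict => //; by rewrite setTI.
rewrite Rintegral_mkcond /Rintegral (integral_slice0 (j := j) iE)//.
move=> t.
have [Ht|Ht] := pselect (forall i, i != j -> 0 < tnth t i < 1); last first.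
  apply: integral0_eq => s _; rewrite patchE memNset//.
  move=> /cubeTE H; apply: Ht => i ij; have := H i; by rewrite tnth_mktuple (negbTE ij).
(* Coordinate [j] of [t] may lie outside the unit interval; [2^-1] gives a base point of the same
   line inside the cube. *)
have Ot : open_cube (to_rV (tset t j 2^-1)).
  apply/cubeTE => i; rewrite tnth_mktuple; case: eqP => [_|/eqP /Ht//].
  by rewrite invr_gt0 ltr0n invf_lt1 ?ltr1n.
have wpt := wp _ Ot.
set x := to_rV _ in Ot wpt.
have tx s : to_rV (tset t j s) = update x j s.
  by apply/rowP => i; rewrite !mxE !tnth_mktuple; case: ifP.
have cs : continuous (fun s => phi (update x j s)).
  by move=> s; apply: continuous_comp; [exact: continuous_update|exact: cphi].
have cds : continuous (fun s => partial j phi (update x j s)).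
  by move=> s; apply: continuous_comp; [exact: continuous_update|exact: cpart].
(* The support of [phi] lies in the open cube, so the slice vanishes at both ends of the unit
   interval. *)
have ends s : ~ (0 < s < 1) -> phi (update x j s) = 0.
  by move=> Hs; apply: phi0 => /KO /(_ j); rewrite mxE eqxx.
have [_ _ /(_ _ _ cs cds)] := wpt.
have iS := wpair_integrable wpt cs cds.
move=> H; have {}H := H (fun s => is_derive_slice (dphi j (update x j s))) (ends _ _) (ends _ _).
transitivity (\int[leb]_(s in @open_itv R) ((u (update x j s) * partial j phi (update x j s)
   + g (update x j s) * phi (update x j s)))%:E)%E; last first.
  rewrite -[LHS]fineK; first by congr EFin; apply: H; rewrite ltxx ?andbF.
  exact: (integrable_fin_num measurable_open_itv iS).
rewrite [RHS]integral_mkcond; apply: eq_integral => s _; rewrite !patchE.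
have -> : (tset t j s \in @cubeT R d) = (s \in @open_itv R).
  apply/idP/idP => [/set_mem /cubeTE /(_ j)|/set_mem Hs].
    by rewrite tnth_mktuple eqxx => Hs; apply/mem_set; rewrite /open_itv /= in_itv.
  apply/mem_set; rewrite /cubeT /= tx => i; rewrite mxE; case: eqP => _; last exact: Ot.
  by move: Hs; rewrite /open_itv/= in_itv.
by case: ifP => // _; rewrite /E0 tx.
Qed.

Lemma L2cube_prod (h : 'I_d -> R -> R) : (forall i, L2 leb (@open_itv R) (h i)) ->
  L2cube (fun x : 'rV[R]_d => \prod_i h i (x ord0 i)).
Proof.
move=> Lh; have mC := @measurable_cubeT R d.
have mI := measurable_open_itv.
(* Extension by zero makes each factor measurable and square integrable on the whole line, as
   [integral_prod_tnth_lty] requires. *)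
pose h' i : R -> R := h i \_ (@open_itv R).
have mh' i : measurable_fun setT (h' i).
  by apply/(measurable_restrictT _ mI); have [] := Lh i.
have mp := measurable_prod_tnth mh'.
apply: (@L2_ext _ _ _ _ _ (fun t => \prod_i h' i (tnth t i))).
  move=> t /cubeTE Ht /=; apply: eq_bigr => i _.
  by rewrite mxE /h' patchE mem_set// /open_itv/= in_itv/= Ht.
split; first exact: measurable_funTS.
apply: (@le_lt_trans _ _ (\int[lebesgueT R d]_t (\prod_i (h' i (tnth t i) ^+ 2))%:E)%E).
  under [leRHS]eq_integral do rewrite prodrXl.
  apply: ge0_subset_integral => //.
    by apply/measurable_EFinP; exact: measurable_funX.
  by move=> t _; rewrite lee_fin sqr_ge0.
have H := @integral_prod_tnth_lty R d (fun i y => h' i y ^+ 2).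
apply: H => [i|i x|i].
- exact: measurable_funX.
- exact: sqr_ge0.
- have [_] := Lh i; rewrite integral_mkcond; congr (_ < _)%E.
  apply: eq_integral => x _; rewrite patchE /h' patchE; case: ifP => // _.
  by rewrite expr0n.
Qed.

End WeakPartial.

(** * Weak derivatives in one variable *)

Section WeakPairs.
Variable R : realType.
Notation leb := (@lebesgue_measure R).
Implicit Types (F f h g : R -> R).

Lemma measurable_itvR (i : interval R) : measurable ([set` i] : set (measurableTypeR R)).
Proof. exact: measurable_itv. Qed.


Let ae_filter : Filter (almost_everywhere leb) := ae_filter_ringOfSetsType leb.

Lemma ae_leb_imply (P Q : R -> Prop) : (forall x, P x -> Q x) ->
  {ae leb, forall x, P x} -> {ae leb, forall x, Q x}.
Proof. by move=> PQ; apply: (@filterS _ (almost_everywhere leb) ae_filter). Qed.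

Lemma ae_leb_imply2 (P Q T : R -> Prop) : (forall x, P x -> Q x -> T x) ->
  {ae leb, forall x, P x} -> {ae leb, forall x, Q x} -> {ae leb, forall x, T x}.
Proof. by move=> PQ; apply: (@filterS2 _ (almost_everywhere leb) ae_filter). Qed.

Lemma ae_leb_neq (a : R) : {ae leb, forall x, x <> a}.
Proof.
exists [set a]; split; first exact: measurable_set1.
  exact: lebesgue_measure_set1.
by move=> x /=; rewrite not_notE.
Qed.

(** The fundamental theorem of calculus taken as a definition: it does not speak of derivatives at
    points, so piecewise formulas can be glued. *)
Definition primitive F f := forall u v, u <= v ->
  leb.-integrable `]u, v[ (EFin \o f) -> \int[leb]_(x in `]u, v[) f x = F v - F u.

Lemma integrable_C0 f u v : continuous f -> leb.-integrable `[u, v] (EFin \o f).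
Proof.
move=> cf; apply: continuous_compact_integrable; first exact: segment_compact.
exact: continuous_subspaceT.
Qed.

Lemma Rintegral_itv_oocc u v f : measurable_fun (`]u, v[%classic : set (measurableTypeR R)) f ->
  \int[leb]_(x in `]u, v[) f x = \int[leb]_(x in `[u, v]) f x.
Proof.
move=> mf; congr fine; apply/esym.
by apply: (@integral_itv_bndoo R u v (EFin \o f) true false); exact/measurable_EFinP.
Qed.

Lemma is_derive_continuous F f : (forall x : R, is_derive x 1 F (f x)) -> continuous F.
Proof.
move=> dF x; apply: differentiable_continuous; apply/derivable1_diffP.
by have [] := dF x.
Qed.

Lemma Rintegral_C1_oo F f (u v : R) : continuous F -> continuous f ->
  (forall x : R, u < x < v -> is_derive x 1 F (f x)) -> u <= v ->
  \int[leb]_(x in `[u, v]) f x = F v - F u.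
Proof.
move=> cF cf dF; rewrite le_eqVlt => /predU1P[->|uv].
  by rewrite set_itv1 Rintegral_set1 subrr.
rewrite /Rintegral (@continuous_FTC2 _ f F u v uv)//.
- exact: continuous_subspaceT.
- split.
  + by move=> x; rewrite in_itv/= => /dF[].
  + by apply: cvg_at_right_filter; exact: cF.
  + by apply: cvg_at_left_filter; exact: cF.
- move=> x; rewrite in_itv/= => /dF dFx.
  by rewrite derive1E; apply: derive_val.
Qed.

Lemma Rintegral_C1 F f (u v : R) : (forall x : R, is_derive x 1 F (f x)) -> continuous f -> u <= v ->
  \int[leb]_(x in `[u, v]) f x = F v - F u.
Proof.
move=> dF cf; apply: Rintegral_C1_oo => //; exact: is_derive_continuous dF.
Qed.

Lemma primitive_C1 F f : (forall x : R, is_derive x 1 F (f x)) -> continuous f -> primitive F f.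
Proof.
move=> dF cf u v uv _; rewrite Rintegral_itv_oocc; last first.
  by apply: measurable_funTS; exact: continuous_measurable_fun.
exact: Rintegral_C1.
Qed.

(** Because [F1 a = F2 a], the increments on the two sides of [a] add up, and the point [a] carries
    no mass. *)
Lemma primitive_glue F1 F2 f1 f2 a : primitive F1 f1 -> primitive F2 f2 -> F1 a = F2 a ->
  primitive (fun x => if x < a then F1 x else F2 x) (fun x => if x < a then f1 x else f2 x).
Proof.
move=> P1 P2 Fa.
set F := fun x => _; set f := fun x => _.
have Fle x : x <= a -> F x = F1 x by rewrite /F; case: ltgtP => // ->.
have Fge x : a <= x -> F x = F2 x by rewrite /F; case: ltgtP.
have left u v : u <= v -> v <= a -> leb.-integrable `]u, v[ (EFin \o f) ->
    \int[leb]_(x in `]u, v[) f x = F v - F u.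
  move=> uv va i1.
  have E : {in `]u, v[%classic, f =1 f1}.
    move=> x /set_mem /=; rewrite in_itv/= => /andP[_ xv] /=.
    by rewrite /f (lt_le_trans xv va).
  rewrite (@eq_Rintegral _ _ _ leb _ f1)// P1// ?Fle ?(le_trans uv)//.
  by apply: eq_integrable i1 => [|x xuv]; [exact: measurable_itvR|rewrite /= E].
have right u v : u <= v -> a <= u -> leb.-integrable `]u, v[ (EFin \o f) ->
    \int[leb]_(x in `]u, v[) f x = F v - F u.
  move=> uv au i1.
  have E : {in `]u, v[%classic, f =1 f2}.
    move=> x /set_mem /=; rewrite in_itv/= => /andP[ux _] /=.
    by rewrite /f ltNge (ltW (le_lt_trans au ux)).
  rewrite (@eq_Rintegral _ _ _ leb _ f2)// P2// ?Fge ?(le_trans au)//.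
  by apply: eq_integrable i1 => [|x xuv]; [exact: measurable_itvR|rewrite /= E].
move=> u v uv i1.
have [va|av] := leP v a; first exact: left.
have [au|ua] := leP a u; first exact: right.
have i2 : leb.-integrable `]u, a[ (EFin \o f).
  apply: integrableS i1; [exact: measurable_itvR|exact: measurable_itvR|].
  by apply: subset_itvl; rewrite bnd_simp ltW.
have i2' : leb.-integrable `]u, a] (EFin \o f).
  apply: integrableS i1; [exact: measurable_itvR|exact: measurable_itvR|].
  by apply: subset_itvl; rewrite bnd_simp.
have i3 : leb.-integrable `]a, v[ (EFin \o f).
  apply: integrableS i1; [exact: measurable_itvR|exact: measurable_itvR|].
  by apply: subset_itvr; rewrite bnd_simp ltW.
have /= := @Rintegral_itvB R f (BRight u) (BLeft v) a i1.
rewrite !bnd_simp => /(_ (ltW ua) av); rewrite -Rintegral_itv_bndo_bndc// => /eqP.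
rewrite subr_eq => /eqP ->.
by rewrite (left u a) ?(ltW ua)// (right a v) ?(ltW av)// addrA subrK.
Qed.

Lemma primitive_ext F F' f f' : F =1 F' -> f =1 f' -> primitive F f -> primitive F' f'.
Proof. by move=> /funext <- /funext <-. Qed.

(** [P.[clamp a b x]] prolongs [P] from [[a, b]] by constants. All continuous piecewise polynomials
    below are built from such functions. *)
Definition clamp (a b x : R) := Num.max a (Num.min b x).

Lemma clampE a b x : a <= b ->
  clamp a b x = if x < a then a else if x < b then x else b.
Proof.
rewrite /clamp => ab; case: (ltP x a) => xa.
  by rewrite min_r ?max_l// ?ltW// (lt_le_trans xa ab).
by case: (ltP x b) => xb; rewrite max_r.
Qed.

Lemma clamp_continuous a b : continuous (clamp a b).
Proof.
move=> x; apply: continuous_max; first exact: cvg_cst.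
by apply: continuous_min; [exact: cvg_cst|exact: cvg_id].
Qed.

(** Half-open on the right, so that the cells of a grid tile [[0, 1[] without overlap and the
    function is right-continuous, like the representative chosen in [Pi1]. *)
Definition cutoff (a b : R) (p : {poly R}) (x : R) : R := \1_(`[a, b[%classic) x * p.[x].

Lemma cutoffE a b p x : cutoff a b p x = if (a <= x < b) then p.[x] else 0.
Proof.
rewrite /cutoff indicE; have -> : (x \in `[a, b[%classic) = (a <= x < b).
  by apply/idP/idP => [/set_mem|H]; [rewrite /= in_itv|apply/mem_set; rewrite /= in_itv].
by case: ifP => _; rewrite ?mul1r ?mul0r.
Qed.

Lemma horner_continuous (p : {poly R}) : continuous (fun x => p.[x]).
Proof. by move=> x; exact: continuous_horner. Qed.

Lemma is_derive_horner (p : {poly R}) (x : R) : is_derive x 1 (fun x => p.[x]) p^`().[x].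
Proof. exact: is_derive_poly. Qed.

(** Product rule for a polynomial prolonged by constants, its derivative being cut off to the
    interval: the three C^1 pieces agree at [a] and at [b] and are glued there. *)
Lemma primitive_clamp (P : {poly R}) (a b : R) (phi dphi : R -> R) : a <= b ->
  (forall x : R, is_derive x 1 phi (dphi x)) -> continuous dphi ->
  primitive (fun x => P.[clamp a b x] * phi x)
            (fun x => P.[clamp a b x] * dphi x + cutoff a b P^`() x * phi x).
Proof.
move=> ab dp cd; have cp := is_derive_continuous dp.
have Pc c : primitive (fun x => c * phi x) (fun x => c * dphi x).
  apply: primitive_C1; last by move=> x; apply: cvgM; [exact: cvg_cst|exact: cd].
have PP : primitive (fun x => P.[x] * phi x) (fun x => P.[x] * dphi x + P^`().[x] * phi x).
  apply: primitive_C1.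
    move=> x; have := dp x => dpx; have := is_derive_horner P x => dPx.
    apply: is_derive_eq.
    by congr (_ + _); exact: mulrC.
  move=> x; apply: cvgD; apply: cvgM; [exact: horner_continuous|exact: cd|
    exact: horner_continuous|exact: cp].
have G := primitive_glue (a := a) (Pc P.[a]) (primitive_glue (a := b) PP (Pc P.[b]) erefl).
apply: primitive_ext (G _).
- by move=> x; rewrite clampE//; case: ifP => //; case: ifP.
- move=> x; rewrite clampE// cutoffE leNgt; case: ifP => /= xa.
    by rewrite mul0r addr0.
  by case: ifP => xb; rewrite ?mul0r ?addr0.
- by case: ltP => //; case: ltgtP ab => // <-.
Qed.

Lemma measurable_cutoff a b p : measurable_fun setT (cutoff a b p).
Proof.
apply: measurable_funM; first by apply: measurable_indic; exact: measurable_itvR.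
by apply: continuous_measurable_fun; exact: horner_continuous.
Qed.

Lemma L2_cutoff a b p : L2 leb (@open_itv R) (cutoff a b p).
Proof.
have cp : {within `[0, 1], continuous (fun x : R => p.[x])}.
  exact/continuous_subspaceT/horner_continuous.
have /compact_bounded[M [_ HM]] : compact ((fun x : R => p.[x]) @` `[0, 1]%classic).
  by apply: continuous_compact (@segment_compact R 0 1).
apply: (@L2_bounded _ _ _ _ _ _ _ _ (M + 1)).
- exact: measurable_open_itv.
- exact: open_itv_lty.
- by apply: measurable_funTS; exact: measurable_cutoff.
- move=> x Hx; apply: (@le_trans _ _ `|p.[x]|).
    by rewrite cutoffE; case: ifP => // _; rewrite normr0.
  apply: HM; first by rewrite ltrDl.
  by exists x => //; exact: subset_itv_oo_cc Hx.
Qed.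

Lemma L2_horner_clamp a b (P : {poly R}) : L2 leb (@open_itv R) (fun x => P.[clamp a b x]).
Proof.
apply/L2_open_itv_continuous/continuous_subspaceT => x.
by apply: continuous_comp; [exact: clamp_continuous|exact: horner_continuous].
Qed.

(** This is [primitive_clamp] over the unit interval; the boundary terms vanish with [phi]. *)
Lemma wpair_clamp (P : {poly R}) a b : a <= b ->
  wpair (fun x => P.[clamp a b x]) (cutoff a b P^`()).
Proof.
move=> ab; split; [exact: L2_horner_clamp|exact: L2_cutoff|].
move=> phi dphi cp cd dp p0 p1.
have -> := primitive_clamp (P := P) ab dp cd ler01.
  by rewrite p0 p1 !mulr0 subrr.
have mI := @measurable_open_itv R.
apply: (integrableD mI (f := EFin \o _) (g := EFin \o _)).
  apply: L2M_integrable (L2_horner_clamp _ _ _) _ => //.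
  exact/L2_open_itv_continuous/continuous_subspaceT.
apply: L2M_integrable (L2_cutoff _ _ _) _ => //.
exact/L2_open_itv_continuous/continuous_subspaceT.
Qed.

Lemma Rintegral_cutoff (P : {poly R}) (a b u v : R) : a <= b -> u <= v ->
  leb.-integrable `]u, v[ (EFin \o cutoff a b P^`()) ->
  \int[leb]_(x in `]u, v[) cutoff a b P^`() x = P.[clamp a b v] - P.[clamp a b u].
Proof.
move=> ab uv iuv.
have c0 : continuous (cst 0 : R -> R) by move=> ?; exact: cvg_cst.
(* The constant test function [1] turns the product rule into the plain fundamental theorem. *)
have := primitive_clamp (P := P) (phi := cst 1) (dphi := cst 0) ab (fun x => is_derive_cst _ _ _) c0.
have E : (fun x => P.[clamp a b x] * cst 0 x + cutoff a b P^`() x * cst 1 x) = cutoff a b P^`().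
  by apply/funext => x /=; rewrite mulr0 add0r mulr1.
by rewrite E => /(_ u v uv iuv) ->; rewrite /= !mulr1.
Qed.

Lemma wpair_sum (T : finType) (c : T -> R) (h g : T -> R -> R) :
  (forall a, wpair (h a) (g a)) ->
  wpair (fun x => \sum_a c a * h a x) (fun x => \sum_a c a * g a x).
Proof.
move=> H; have mI := @measurable_open_itv R.
split; [by apply: L2_sum => // [|a _]; [exact: open_itv_lty|apply: L2Z => //; have [] := H a]..|].
move=> phi dphi cp cd dp p0 p1.
transitivity (\int[leb]_(x in @open_itv R) (\sum_a c a * (h a x * dphi x + g a x * phi x))).
  apply: eq_Rintegral => x _; rewrite 2!mulr_suml -big_split/=; apply: eq_bigr => a _.
  by rewrite mulrDr !mulrA.
rewrite Rintegral_sum//.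
  rewrite big1// => a _; rewrite RintegralZl//; last exact: wpair_integrable.
  by have [_ _ ->//] := H a; rewrite mulr0.
move=> a _; have := integrableZl mI (c a) (wpair_integrable (H a) cp cd).
by apply: eq_integrable.
Qed.

Lemma wpair_cst (c : R) : wpair (fun=> c) (fun=> 0).
Proof.
have := @wpair_clamp c%:P 0 1 ler01.
congr wpair; apply/funext => x; first by rewrite hornerC.
by rewrite /cutoff derivC horner0 mulr0.
Qed.

(** The derivative may change on a null set, as wavelets are known only almost everywhere; their
    primitive is known at every point. *)
Lemma wpair_ae h g h' g' : (forall x, open_itv x -> h x = h' x) ->
  L2 leb (@open_itv R) g' -> {ae leb, forall x, open_itv x -> g x = g' x} ->
  wpair h g -> wpair h' g'.
Proof.
move=> hh' Lg' gg' [Lh Lg H]; have mI := @measurable_open_itv R.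
split => //; first by apply: L2_ext Lh.
move=> phi dphi cp cd dp p0 p1; rewrite -(H phi dphi)//.
have mphi : measurable_fun (@open_itv R) phi by apply: measurable_funTS; exact: continuous_measurable_fun.
have mdphi : measurable_fun (@open_itv R) dphi by apply: measurable_funTS; exact: continuous_measurable_fun.
have [mh _] := Lh; have [mg _] := Lg; have [mg' _] := Lg'.
have [mh' _] : L2 leb (@open_itv R) h' by apply: L2_ext Lh.
apply: ae_eq_Rintegral => //.
- by apply: measurable_funD; apply: measurable_funM.
- by apply: measurable_funD; apply: measurable_funM.
- by apply: ae_leb_imply gg' => x E xI; rewrite hh'// E.
Qed.

Lemma wpair_ext h g h' g' : (forall x, open_itv x -> h x = h' x) ->
  (forall x, open_itv x -> g x = g' x) -> wpair h g -> wpair h' g'.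
Proof.
move=> hh' gg' H; have [_ Lg _] := H; apply: wpair_ae H => //.
  by apply: L2_ext Lg.
exact/aeW.
Qed.

End WeakPairs.

(** * Dyadic grids *)

Section Grid.
Variable R : realType.
Notation grid := (@grid R).

Lemma pow2_gt0 m : 0 < (2 ^+ m : R). Proof. by rewrite exprn_gt0. Qed.

Lemma grid_double m i : grid m.+1 i.*2 = grid m i.
Proof.
rewrite /Defs.grid -muln2 natrM exprSr invfM mulrA.
by rewrite -[LHS]mulrA [_^-1 * _]mulrC mulrA mulfK ?pnatr_eq0// mulrC.
Qed.

Lemma grid0 m : grid m 0 = 0. Proof. by rewrite /Defs.grid mul0r. Qed.

Lemma grid1 m : grid m (2 ^ m) = 1.
Proof. by rewrite /Defs.grid natrX divff// gt_eqF// pow2_gt0. Qed.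

Lemma ler_grid m i j : (grid m i <= grid m j) = (i <= j)%N.
Proof. by rewrite /Defs.grid ler_pdivlMr ?pow2_gt0// divfK ?gt_eqF ?pow2_gt0// ler_nat. Qed.

Lemma ltr_grid m i j : (grid m i < grid m j) = (i < j)%N.
Proof. by rewrite ltNge ler_grid -ltnNge. Qed.

Lemma grid_ge0 m i : 0 <= grid m i.
Proof. by rewrite -(grid0 m) ler_grid. Qed.

Lemma grid_le1 m i : (i <= 2 ^ m)%N -> grid m i <= 1.
Proof. by rewrite -(grid1 m) ler_grid. Qed.

Lemma cellE m i (x : R) : cell m i x <-> grid m i <= x <= grid m i.+1.
Proof. by rewrite /cell /= in_itv. Qed.

Lemma open_itvE (x : R) : open_itv x <-> 0 < x < 1.
Proof. by rewrite /open_itv /= in_itv. Qed.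

Lemma subset_grid_itv m i : (i < 2 ^ m)%N -> `]grid m i, grid m i.+1[ `<=` @open_itv R.
Proof.
move=> im x /=; rewrite in_itv/= => /andP[ax xb]; apply/open_itvE.
by rewrite (le_lt_trans (grid_ge0 m i) ax) (lt_le_trans xb (grid_le1 _)).
Qed.

End Grid.

(** * The one-dimensional spaces *)

Section WaveletSpaces.
Variable R : realType.
Notation leb := (@lebesgue_measure R).
Implicit Types (f g h : R -> R) (k m i : nat).

Lemma ae_poly_on_sum (T : finType) (c : T -> R) (g : T -> R -> R) k (K : set R) :
  (forall a, ae_poly_on k K (g a)) -> ae_poly_on k K (fun x => \sum_a c a * g a x).
Proof.
move=> H.
have Hq a : exists q : {poly R}, (size q <= k.+1)%N /\ {ae leb, forall x, K x -> g a x = q.[x]}.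
  by have [q sq Eq] := H a; exists q.
have [p Hp] := choice Hq.
exists (\sum_a c a *: p a).
  apply: (leq_trans (size_sum _ _ _)); apply/bigmax_leqP => a _.
  by apply: (leq_trans (size_scale_leq _ _)); have [] := Hp a.
have : {ae leb, forall x, forall a, K x -> g a x = (p a).[x]}.
  have : forall s : seq T, {ae leb, forall x, forall a, a \in s -> K x -> g a x = (p a).[x]}.
    elim=> [|a s IH]; first exact/aeW.
    apply: ae_leb_imply2 (Hp a).2 IH => x Ha IH b; rewrite inE => /predU1P[->//|]; exact: IH.
  by move=> /(_ (enum T)); apply: ae_leb_imply => x H' a; apply: H'; rewrite mem_enum.
apply: ae_leb_imply => x H' Kx; rewrite horner_sum; apply: eq_bigr => a _.
by rewrite hornerZ H'.
Qed.

Lemma Qspace_sum (T : finType) (c : T -> R) (g : T -> R -> R) k m :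
  (forall a, Qspace k m (g a)) -> Qspace k m (fun x => \sum_a c a * g a x).
Proof.
move=> H; split.
  apply: L2_sum; [exact: measurable_open_itv|exact: open_itv_lty|].
  by move=> a _; apply: L2Z; [exact: measurable_open_itv|have [] := H a].
by move=> i im; apply: ae_poly_on_sum => a; have [_] := H a; exact.
Qed.

Lemma Zspace_Qspace k m g : Zspace k m g -> Qspace k m g.
Proof. by case: m => // m []. Qed.

Lemma Zspace_sum (T : finType) (c : T -> R) (g : T -> R -> R) k m :
  (forall a, Zspace k m (g a)) -> Zspace k m (fun x => \sum_a c a * g a x).
Proof.
move=> H; have HQ := Qspace_sum c (fun a => Zspace_Qspace (H a)).
case: m H HQ => [//|m] H HQ; split => // w Qw.
have mI := @measurable_open_itv R.
transitivity (\int[leb]_(x in @open_itv R) (\sum_a c a * (g a x * w x))).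
  by apply: eq_Rintegral => x _; rewrite mulr_suml; apply: eq_bigr => a _; rewrite mulrA.
have iw a : leb.-integrable (@open_itv R) (EFin \o (fun x => g a x * w x)).
  by apply: (L2M_integrable mI); [have [[]] := H a|have [] := Qw].
rewrite Rintegral_sum//.
  by rewrite big1// => a _; rewrite RintegralZl//; have [_ ->//] := H a; rewrite mulr0.
by move=> a _; apply: eq_integrable (integrableZl mI (c a) (iw a)).
Qed.

(** The antiderivative with zero constant term: at [i = 0] the coefficient is a division by zero,
    whose value is [0]. *)
Definition primp (p : {poly R}) : {poly R} := \poly_(i < (size p).+1) (p`_i.-1 / i%:R).

Lemma deriv_primp p : (primp p)^`() = p.
Proof.
apply/polyP => i; rewrite coef_deriv coef_poly ltnS /=.
case: ltnP => [_|/leq_sizeP ->//]; last by rewrite mul0rn.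
by rewrite -[LHS]mulr_natr divfK ?pnatr_eq0.
Qed.

(** * Wavelets on a single cell [[a, b]] with midpoint [c] *)

Section Cell.
Variables (k m i : nat) (f : R -> R).
Hypotheses (im : (i < 2 ^ m)%N) (Zf : Zcell k m i f).

Let a : R := grid R m i.
Let b : R := grid R m i.+1.
Let c : R := grid R m.+1 i.*2.+1.

Let bE : grid R m.+1 i.*2.+2 = b. Proof. by rewrite -doubleS grid_double. Qed.
Let a0 : 0 <= a. Proof. exact: grid_ge0. Qed.
Let ac : a < c. Proof. by rewrite /a -grid_double ltr_grid. Qed.
Let cb : c < b. Proof. by rewrite -bE ltr_grid. Qed.
Let b1 : b <= 1. Proof. exact: grid_le1. Qed.
Let L2f : L2 leb (@open_itv R) f. Proof. by case: Zf. Qed.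

(** The cutoffs are half-open while the cells are closed; the points [c] and [b], where this
    matters, are discarded as null sets. *)
Lemma Zcell_cutoff : exists p q : {poly R},
  {ae leb, forall x, open_itv x -> f x = cutoff a c p x + cutoff c b q x}.
Proof.
case: Zf => _ E0 [[p _ Ep] [q _ Eq]] _; exists p, q.
have Epq := ae_leb_imply2 (fun x a b => conj a b) Ep Eq.
have Ecb := ae_leb_imply2 (fun x a b => conj a b) (ae_leb_neq c) (ae_leb_neq b).
have E0cb := ae_leb_imply2 (fun x a b => conj a b) E0 Ecb.
apply: ae_leb_imply2 Epq E0cb => x [{}Ep {}Eq] [{}E0 [xc xb]] xI.
rewrite !cutoffE; have [xa|ax] := ltP x a.
  rewrite add0r leNgt (lt_trans xa ac) E0//.
  by move=> /cellE /andP[]; rewrite leNgt xa.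
have [xc'|cx] := ltP x c.
  by rewrite addr0 Ep//; apply/cellE; rewrite grid_double ax ltW.
rewrite add0r; have [xb'|bx] := ltP x b.
  by rewrite Eq//; apply/cellE; rewrite bE cx ltW.
rewrite E0// => /cellE /andP[_ xb']; apply: xb; apply/eqP.
by rewrite eq_le bx xb'.
Qed.

(** Clamped antiderivatives are constant outside their intervals, so one formula covers all
    positions of [u] and [v] relative to the cell. *)
Lemma Rintegral_Zcell u v : 0 <= u -> v <= 1 -> u <= v -> forall p q : {poly R},
  {ae leb, forall x, open_itv x -> f x = cutoff a c p x + cutoff c b q x} ->
  \int[leb]_(x in `[u, v]) f x =
  ((primp p).[clamp a c v] + (primp q).[clamp c b v]) -
  ((primp p).[clamp a c u] + (primp q).[clamp c b u]).
Proof.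
move=> u0 v1 uv p q E.
have sub : `]u, v[ `<=` @open_itv R.
  move=> x /=; rewrite in_itv/= => /andP[ux xv]; apply/open_itvE.
  by rewrite (le_lt_trans u0 ux) (lt_le_trans xv v1).
have muv : measurable (`]u, v[%classic : set (measurableTypeR R)) by exact: measurable_itvR.
have mI := @measurable_open_itv R.
have ic a' b' P : leb.-integrable `]u, v[ (EFin \o cutoff a' b' P).
  by apply: (integrableS mI muv sub); apply: L2_integrable (L2_cutoff _ _ _) => //; exact: open_itv_lty.
have [mf _] := L2f.
have mfuv : measurable_fun (`]u, v[%classic : set (measurableTypeR R)) f.
  exact: measurable_funS mf.
rewrite -Rintegral_itv_oocc//.
rewrite (@ae_eq_Rintegral _ _ _ leb _ _ f (fun x => cutoff a c p x + cutoff c b q x))//.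
- rewrite RintegralD//.
  have := @Rintegral_cutoff R (primp p) a c u v (ltW ac) uv.
  have := @Rintegral_cutoff R (primp q) c b u v (ltW cb) uv.
  rewrite !deriv_primp => -> // -> //.
  by rewrite opprD addrACA.
- by apply: measurable_funD; apply: measurable_funTS; exact: measurable_cutoff.
- by apply: ae_leb_imply E => x Ex xuv; apply: Ex; exact: sub.
Qed.

(** Orthogonality to constants gives [f] mean zero, so its running integral returns to [0] at [b]
    and the extension by zero creates no jump. Hence [theta] is a sum of two clamped antiderivatives
    and a constant. *)
Lemma wpair_theta : wpair (theta m i f) f.
Proof.
have [p [q E]] := Zcell_cutoff.
have W1 := @wpair_clamp R (primp p) a c (ltW ac).
have W2 := @wpair_clamp R (primp q) c b (ltW cb).
(* The constant makes the sum vanish at [a], where the two clamps take the values [a] and [c]. *)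
have W3 := wpair_cst (- ((primp p).[a] + (primp q).[c])).
rewrite !deriv_primp in W1 W2.
pose h3 (j : 'I_3) : R -> R := if j == 0 :> nat then (fun x => (primp p).[clamp a c x]) else
  if j == 1 :> nat then (fun x => (primp q).[clamp c b x]) else fun=> - ((primp p).[a] + (primp q).[c]).
pose g3 (j : 'I_3) : R -> R := if j == 0 :> nat then cutoff a c p else
  if j == 1 :> nat then cutoff c b q else fun=> 0.
have := @wpair_sum R 'I_3 (fun=> 1) h3 g3.
have W (j : 'I_3) : wpair (h3 j) (g3 j) by rewrite /h3 /g3; case: j => -[|[|[|]]].
move=> /(_ W); apply: wpair_ae => //; last first.
  apply: ae_leb_imply E => x E xI; rewrite !big_ord_recl big_ord0 /= !mul1r /g3 /=.
  by rewrite !addr0 E.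
move=> x /open_itvE /andP[x0 x1]; rewrite !big_ord_recl big_ord0 /= !mul1r /h3 /= addr0.
have caa : clamp a c a = a by rewrite clampE ?ltW// ltxx ac.
have cca : clamp c b a = c by rewrite clampE ?ltW// ac.
rewrite /theta; case: ifPn => [/set_mem /cellE /andP[ax xb]|].
  rewrite (Rintegral_Zcell _ _ ax E)//; last exact: ltW.
  by rewrite -/a caa cca addrA.
(* Mean zero, from orthogonality to the polynomial [1]; it settles the region to the right of
   [b]. *)
have I0 : \int[leb]_(x in `[a, b]) f x = 0.
  have [_ _ _ /(_ 1%:P)] := Zf; rewrite size_polyC oner_neq0 => /(_ isT) <-.
  by apply: eq_Rintegral => y _; rewrite hornerC mulr1.
rewrite (Rintegral_Zcell _ _ _ E)// ?(ltW (lt_trans ac cb))// in I0.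
rewrite caa cca in I0.
move=> /negP H; have [xa|ax] := ltP x a.
  rewrite [clamp a c x]clampE ?(ltW ac)// xa [clamp c b x]clampE ?(ltW cb)//.
  by rewrite (lt_trans xa ac) addrA subrr.
have bx : b < x.
  by rewrite ltNge; apply/negP => xb; apply: H; apply/mem_set/cellE; rewrite ax.
have bc v : b <= v -> clamp a c v = c.
  by move=> bv; rewrite clampE ?(ltW ac)// !ltNge (le_trans (ltW (lt_trans ac cb)) bv) (le_trans (ltW cb) bv).
have bb v : b <= v -> clamp c b v = b.
  by move=> bv; rewrite clampE ?(ltW cb)// !ltNge (le_trans (ltW cb) bv) bv.
by rewrite !bc ?bb ?(ltW bx)// in I0 *; rewrite addrA.
Qed.

(** A cell of level [m + 1] other than the two halves meets cell [i] in at most an endpoint, so [f]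
    vanishes there almost everywhere. A function of level [m] is a single polynomial on cell [i], so
    orthogonality on that cell suffices. *)
Lemma Zcell_Zspace : Zspace k m.+1 f.
Proof.
have [_ E0 [Ep Eq] orth] := Zf.
split.
  split => // j jm.
  have [->//|j1] := eqVneq j i.*2; have [->//|j2] := eqVneq j i.*2.+1.
  exists 0; first by rewrite size_poly0.
  have Eab := ae_leb_imply2 (fun x a b => conj a b) (ae_leb_neq a) (ae_leb_neq b).
  have E01 := ae_leb_imply2 (fun x a b => conj a b) (ae_leb_neq (0 : R)) (ae_leb_neq (1 : R)).
  have Eab0 := ae_leb_imply2 (fun x a b => conj a b) Eab E0.
  apply: ae_leb_imply2 E01 Eab0 => x [/eqP x0 /eqP x1] [[/eqP xa /eqP xb] {}E0] /cellE /andP[jx xj].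
  rewrite horner0 E0//.
    apply/open_itvE; rewrite !lt_neqAle eq_sym x0 x1 (le_trans (grid_ge0 R m.+1 j) jx)/=.
    exact: le_trans xj (grid_le1 R _).
  move=> /cellE /andP[ax xb'].
  have := jx; rewrite leNgt => /negP; apply.
  have [ji|ij] := ltnP j i.*2.
    have xa' : x <= a by apply: (le_trans xj); rewrite /a -(grid_double R m i) ler_grid.
    by move: xa; rewrite eq_le xa' ax.
  have ij2 : (i.*2.+2 <= j)%N by rewrite ltn_neqAle eq_sym j2 ltn_neqAle eq_sym j1.
  apply: (@lt_le_trans _ _ b); first by rewrite lt_neqAle xb.
  by rewrite -bE ler_grid.
move=> w [Lw Pw]; have [p sp Ew] := Pw i im.
have [mf _] := L2f; have [mw _] := Lw.
have mab : measurable (`]a, b[%classic : set (measurableTypeR R)) by exact: measurable_itvR.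
have sub : `]a, b[ `<=` @open_itv R by exact: subset_grid_itv.
have mI := @measurable_open_itv R.
have mp : measurable_fun setT (fun x : R => p.[x]).
  by apply: continuous_measurable_fun; exact: horner_continuous.
have mfp : measurable_fun (@open_itv R) (fun x => f x * p.[x]).
  by apply: measurable_funM => //; exact: measurable_funTS.
rewrite -[RHS](orth p)// -Rintegral_itv_oocc; last exact: measurable_funS mfp.
have -> : `]grid R m i, grid R m i.+1[%classic = @open_itv R `&` `]a, b[%classic.
  by apply/esym/setIidr.
rewrite Rintegral_mkcondr; apply: ae_eq_Rintegral => //.
- exact: measurable_funM.
- apply/(measurable_restrict _ mab mI).
  by apply: measurable_funS mfp => //; exact: subIsetl.
have Hab := ae_leb_imply2 (fun x a b => conj a b) (ae_leb_neq a) (ae_leb_neq b).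
have := ae_leb_imply2 (fun x a b => conj a b) E0 Ew.
apply: ae_leb_imply2 Hab => x [xa xb] [{}E0 {}Ew] xI; rewrite patchE.
case: ifPn => [/set_mem /=|/negP].
  by rewrite in_itv/= => /andP[/ltW ax /ltW xb']; rewrite Ew//; apply/cellE; rewrite ax.
move=> H; rewrite E0 ?mul0r//.
move=> /cellE /andP[ax xb']; apply: H; apply/mem_set; rewrite /= in_itv/= !lt_neqAle ax xb' !andbT.
by apply/andP; split; [rewrite eq_sym|]; exact/eqP.
Qed.

End Cell.

(** Differentiation maps [Y_m] into [Z_m]: at level [0] it lowers the degree of a single polynomial
    from [k + 1] to [k], and at higher levels it takes each [theta] back to its wavelet. *)
Lemma wpair_Yspace k m (psi : nat -> nat -> 'I_k.+1 -> R -> R) h :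
  (forall m i, (i < 2 ^ m)%N -> orthonormal_basis m i (psi m.+1 i)) ->
  Yspace psi m h -> exists2 g, Zspace k m g & wpair h g.
Proof.
move=> hpsi; case: m => [[ch /(_ 0 isT)[p sp hp]]|m [N [c [g [Bg ->]]]]].
  exists (cutoff 0 1 p^`()).
    split; first exact: L2_cutoff.
    move=> [|//] _; exists p^`(); first by rewrite (leq_trans (size_poly _ _))//; case: (size p) sp.
    apply: ae_leb_imply (ae_leb_neq (1 : R)) => x /eqP x1 /cellE.
    rewrite grid0 -[X in grid _ _ X]/(2 ^ 0)%N grid1 cutoffE => /andP[-> x1'].
    by rewrite lt_neqAle x1 x1'.
  apply: wpair_ext (wpair_clamp p ler01) => // x /open_itvE /andP[x0 x1].
  rewrite clampE// ltNge (ltW x0) x1 hp//; apply/cellE.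
  by rewrite grid0 -[X in grid _ _ X]/(2 ^ 0)%N grid1 (ltW x0) (ltW x1).
have [i Hi] := choice Bg.
have [r Hr] := choice Hi.
exists (fun x => \sum_a c a * psi m.+1 (i a) (r a) x).
  apply: Zspace_sum => a; have [im _] := Hr a.
  by apply: (@Zcell_Zspace _ _ (i a)) => //; have [] := hpsi _ _ im.
apply: wpair_sum => a; have [im ->] := Hr a.
by apply: (@wpair_theta k) => //; have [] := hpsi _ _ im.
Qed.

End WaveletSpaces.

(** * The sparse spaces *)

Section LinearCombinations.
Variables (R : realType) (T : Type).
Implicit Types B : set (T -> R).

Lemma lincomb0 B : Defs.span B (fun=> 0).
Proof.
exists 0%N, (fun=> 0), (fun _ _ => 0); split; first by case.
by apply/funext => x; rewrite big_ord0.
Qed.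

Lemma lincombD B (f g : T -> R) : Defs.span B f -> Defs.span B g -> Defs.span B (fun x => f x + g x).
Proof.
move=> [N1 [c1 [g1 [B1 ->]]]] [N2 [c2 [g2 [B2 ->]]]].
exists (N1 + N2)%N, (fun i => match fintype.split i with inl i => c1 i | inr i => c2 i end),
  (fun i => match fintype.split i with inl i => g1 i | inr i => g2 i end); split.
  by move=> i; case: (fintype.split i).
apply/funext => x; rewrite big_split_ord /=; congr (_ + _); apply: eq_bigr => i _.
  by rewrite (unsplitK (inl i)).
by rewrite (unsplitK (inr i)).
Qed.

Lemma lincombZ B (c : R) (f : T -> R) : Defs.span B f -> Defs.span B (fun x => f x * c).
Proof.
move=> [N [c1 [g1 [B1 ->]]]]; exists N, (fun i => c1 i * c), g1; split => //.
by apply/funext => x; rewrite mulr_suml; apply: eq_bigr => i _; rewrite mulrAC.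
Qed.

Lemma lincomb_sum B U (s : seq U) (P : pred U) (f : U -> T -> R) :
  (forall a, P a -> Defs.span B (f a)) -> Defs.span B (fun x => \sum_(a <- s | P a) f a x).
Proof.
move=> H; elim: s => [|a s IH].
  by rewrite (_ : (fun x => _) = fun=> 0); [exact: lincomb0|apply/funext => x; rewrite big_nil].
have [Pa|nPa] := boolP (P a).
  rewrite (_ : (fun x => _) = fun x => f a x + \sum_(a <- s | P a) f a x).
    by apply: lincombD => //; exact: H.
  by apply/funext => x; rewrite big_cons Pa.
rewrite (_ : (fun x => _) = fun x => \sum_(a <- s | P a) f a x)//.
by apply/funext => x; rewrite big_cons (negbTE nPa).
Qed.

End LinearCombinations.

(** * Weak derivatives on the cube and the subcomplex property *)

Section WeakDerivative.
Variables (R : realType) (d : nat).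
Notation leb := (@lebesgue_measure R).
Implicit Types (x : 'rV[R]_d) (u g w : 'rV[R]_d -> R) (I J : {set 'I_d}).

Definition weak_derivative j u g := [/\ L2cube u, L2cube g & weak_partial j u g].

Lemma weak_derivative_slices j u g : L2cube u -> L2cube g ->
  (forall x, open_cube x ->
    wpair (fun s => u (update x j s)) (fun s => g (update x j s))) ->
  weak_derivative j u g.
Proof. by move=> Lu Lg H; split => //; exact: weak_partial_slices. Qed.

Lemma L2cube_sum T (s : seq T) (P : pred T) (u : T -> 'rV[R]_d -> R) :
  (forall a, P a -> L2cube (u a)) -> L2cube (fun x => \sum_(a <- s | P a) u a x).
Proof.
move=> Lu; have := @L2_sum _ _ _ _ _ (@measurable_cubeT R d) (lebesgueT_cubeT_lty R d) T s P
  (fun a => u a \o @to_rV R d) Lu.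
by apply: L2_ext.
Qed.

Lemma L2cubeZ c u : L2cube u -> L2cube (fun x => c * u x).
Proof. exact: (L2Z (@measurable_cubeT R d)). Qed.

Lemma L2cubeZr c u : L2cube u -> L2cube (fun x => u x * c).
Proof. by move=> /(L2cubeZ c); apply: L2_ext => t _ /=; rewrite mulrC. Qed.

Lemma L2cube_ext u u' : (forall x, open_cube x -> u x = u' x) -> L2cube u -> L2cube u'.
Proof. by move=> uu'; apply: L2_ext => t Ht; exact: uu'. Qed.

Lemma test_function_L2 (phi : 'rV[R]_d -> R) : test_function phi -> L2cube phi.
Proof. by move=> [/(_ [::])[cphi _] _]; exact: L2cube_continuous. Qed.

Lemma test_function_partial_L2 j (phi : 'rV[R]_d -> R) : test_function phi -> L2cube (partial j phi).
Proof. by move=> [/(_ [:: j])[cphi _] _]; exact: L2cube_continuous. Qed.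

Lemma weak_derivative_sum T (s : seq T) (P : pred T) j (u g : T -> 'rV[R]_d -> R) :
  (forall a, P a -> weak_derivative j (u a) (g a)) ->
  weak_derivative j (fun x => \sum_(a <- s | P a) u a x) (fun x => \sum_(a <- s | P a) g a x).
Proof.
move=> H; have mC := @measurable_cubeT R d; split.
- by apply: L2cube_sum => a /H[].
- by apply: L2cube_sum => a /H[].
move=> phi tphi; have Lp := test_function_L2 tphi; have Lq := test_function_partial_L2 j tphi.
transitivity (\int[lebesgueT R d]_(t in @cubeT R d)
    (\sum_(a <- s | P a) u a (to_rV t) * partial j phi (to_rV t))).
  by apply: eq_Rintegral => t _; rewrite mulr_suml.
rewrite Rintegral_sum//; last by move=> a /H[La _ _]; exact: (L2M_integrable mC La Lq).
transitivity (- \int[lebesgueT R d]_(t in @cubeT R d)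
    (\sum_(a <- s | P a) g a (to_rV t) * phi (to_rV t))); last first.
  by congr (- _); apply: eq_Rintegral => t _; rewrite mulr_suml.
rewrite Rintegral_sum//; last by move=> a /H[_ La _]; exact: (L2M_integrable mC La Lp).
by rewrite -sumrN; apply: eq_bigr => a /H[_ _ ->].
Qed.

Lemma weak_derivative_ae j u u' g : L2cube u' -> eq_ae_cube u' u ->
  weak_derivative j u g -> weak_derivative j u' g.
Proof.
move=> Lu' E [Lu Lg wp]; split => // phi tphi; rewrite -wp//.
have Lq := test_function_partial_L2 j tphi.
have [mu' _] := Lu'; have [mu _] := Lu; have [mq _] := Lq.
apply: ae_eq_Rintegral => //.
- exact: measurable_cubeT.
- exact: measurable_funM.
- exact: measurable_funM.
- by apply: filterS E => t E Ct; rewrite E.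
Qed.

Lemma prod_update (h : 'I_d -> R -> R) x j s :
  \prod_i h i (update x j s ord0 i) = (\prod_(i | i != j) h i (x ord0 i)) * h j s.
Proof.
rewrite (bigD1 j)//= mxE eqxx mulrC; congr (_ * _); apply: eq_bigr => i ij.
by rewrite mxE (negbTE ij).
Qed.

(** Along direction [j] all other factors are constants, so each slice is a linear combination of
    univariate pairs. *)
Lemma weak_derivative_tensor (N : nat) (c : 'I_N -> R) (h g : 'I_N -> 'I_d -> R -> R) j :
  (forall a i, L2 leb (@open_itv R) (h a i)) -> (forall a, wpair (h a j) (g a j)) ->
  (forall a i, i != j -> g a i = h a i) ->
  weak_derivative j (fun x => \sum_a c a * \prod_i h a i (x ord0 i))
                    (fun x => \sum_a c a * \prod_i g a i (x ord0 i)).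
Proof.
move=> Lh wp gh; apply: weak_derivative_slices.
- by apply: L2cube_sum => a _; apply: L2cubeZ; exact: L2cube_prod.
- apply: L2cube_sum => a _; apply: L2cubeZ; apply: L2cube_prod => i.
  by have [->|ij] := eqVneq i j; [have [] := wp a|rewrite gh].
move=> x _.
apply: wpair_ext (wpair_sum (fun a => c a * \prod_(i | i != j) h a i (x ord0 i)) wp) => s _.
  by apply: eq_bigr => a _; rewrite prod_update mulrA.
apply: eq_bigr => a _; rewrite prod_update mulrA; congr (_ * _ * _).
by apply: eq_bigr => i ij; rewrite gh.
Qed.

(** Only factor [j] changes, from [Y] to [Z] at the same level. The multi-index is kept, which is
    why one index set for all form degrees yields a complex. *)
Lemma Wspace_weak_derivative k (psi : nat -> nat -> 'I_k.+1 -> R -> R) I (m : 'I_d -> nat) j w :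
  (forall m i, (i < 2 ^ m)%N -> orthonormal_basis m i (psi m.+1 i)) ->
  j \notin I -> Wspace psi I m w ->
  exists2 g, Wspace psi (j |: I) m g & weak_derivative j w g.
Proof.
move=> hpsi jI [N [c [f [Bf ->]]]].
have [h Hh] := choice Bf.
have Hg a : exists g : R -> R, Zspace k (m j) g /\ wpair (h a j) g.
  by have [_ /(_ j jI)/(wpair_Yspace hpsi)[g Zg wg] _] := Hh a; exists g.
have [g {}Hg] := choice Hg.
pose h' a i := if i == j then g a else h a i.
have LZ m' (q : R -> R) : Zspace k m' q -> L2 leb (@open_itv R) q.
  by move=> /Zspace_Qspace[].
exists (fun x => \sum_a c a * \prod_i h' a i (x ord0 i)).
  exists N, c, (fun a x => \prod_i h' a i (x ord0 i)); split => // a.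
  exists (h' a); split => // i.
    rewrite in_setU1 /h'; case: eqP => [-> _|_ /= iI]; first by have [] := Hg a.
    by have [+ _ _] := Hh a; exact.
  rewrite in_setU1 negb_or /h' => /andP[/negbTE -> iI].
  by have [_ + _] := Hh a; exact.
have -> : (fun x => \sum_a c a * f a x) = (fun x => \sum_a c a * \prod_i h a i (x ord0 i)).
  by apply/funext => x; apply: eq_bigr => a _; have [_ _ ->] := Hh a.
apply: weak_derivative_tensor => [a i|a|a i ij].
- have [hZ hY _] := Hh a; have [iI|iI] := boolP (i \in I); first exact: LZ (hZ _ iI).
  by have [g' _ []] := wpair_Yspace hpsi (hY _ iI).
- by rewrite /h' eqxx; have [] := Hg a.
- by rewrite /h' (negbTE ij).
Qed.

(** Derivatives are chosen separately for each [I], [j] and multi-index, then assembled by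
    [ext_sum]. A term contributes to [dx_J] only if [J] equals [j |: I], and then it lies in the
    space required for [J]. *)
Lemma weak_derivative_Vspace k (psi : nat -> nat -> 'I_k.+1 -> R -> R) n l (omega : dform R d) :
  (forall m i, (i < 2 ^ m)%N -> orthonormal_basis m i (psi m.+1 i)) ->
  Vspace psi n l omega ->
  exists2 eta : dform R d, Vspace psi n l.+1 eta & weak_ext_der l omega eta.
Proof.
move=> hpsi Vo.
have H I j : exists G : {ffun 'I_d -> 'I_(n + d)} -> 'rV[R]_d -> R, #|I| = l -> j \notin I ->
    (forall m, sparse_index m -> Wspace psi (j |: I) (fun i => m i) (G m)) /\
    weak_derivative j (omega I) (fun x => \sum_(m | sparse_index m) G m x).
  (* The default [0] makes the family total, so that [choice] applies. *)
  have [Il|Il] := eqVneq #|I| l; last by exists (fun _ _ => 0) => E; rewrite E eqxx in Il.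
  have [jI|jI] := boolP (j \in I); first by exists (fun _ _ => 0).
  have [Lo [w [Ww Ew]]] := Vo I Il.
  have HG m : exists g, sparse_index m ->
      Wspace psi (j |: I) (fun i => m i) g /\ weak_derivative j (w m) g.
    have [sm|sm] := boolP (sparse_index m); last by exists (fun=> 0).
    by have [g ? ?] := Wspace_weak_derivative hpsi jI (Ww m sm); exists g.
  have [G {}HG] := choice HG.
  exists G => _ _; split; first by move=> m /HG[].
  apply: weak_derivative_ae Lo Ew _.
  by apply: weak_derivative_sum => m /HG[].
have HI I : exists G : 'I_d -> {ffun 'I_d -> 'I_(n + d)} -> 'rV[R]_d -> R,
    forall j, #|I| = l -> j \notin I ->
    (forall m, sparse_index m -> Wspace psi (j |: I) (fun i => m i) (G j m)) /\
    weak_derivative j (omega I) (fun x => \sum_(m | sparse_index m) G j m x).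
  by have [G HG] := choice (H I); exists G.
have [G1 HG1] := choice HI.
pose D I j x := \sum_(m | sparse_index m) G1 I j m x.
exists (ext_sum l D).
  move=> J Jl; split.
    apply: L2cube_sum => I /eqP Il; apply: L2cube_sum => j jI; apply: L2cubeZr.
    by have [_ []] := HG1 I j Il jI.
  exists (fun m x => \sum_(I : {set 'I_d} | #|I| == l) \sum_(j | j \notin I)
    G1 I j m x * wedge_coef R j I J); split.
    move=> m sm; apply: lincomb_sum => I /eqP Il; apply: lincomb_sum => j jI.
    rewrite /wedge_coef; case: eqP => [->|_].
      by apply: lincombZ; have [+ _] := HG1 I j Il jI; exact.
    by rewrite (_ : (fun x => _) = fun=> 0); [exact: lincomb0|apply/funext => x; rewrite mulr0].
  apply/aeW => t _; rewrite /ext_sum exchange_big/=; apply: eq_bigr => I _.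
  by rewrite exchange_big/=; apply: eq_bigr => j _; rewrite mulr_suml.
exists D; split => [I Il|J _]; last exact/aeW.
split; first by have [] := Vo I Il.
by move=> j jI; have [_ []] := HG1 I j Il jI.
Qed.

End WeakDerivative.

(** * Bounded functionals and Gram matrices *)

Section Functionals.
Variable R : realType.
Notation leb := (@lebesgue_measure R).
Implicit Types (f g : R -> R) (L : (R -> R) -> R) (p q w : {poly R}).

(** Bounded linear functionals on C([0,1]), acting on functions of the whole line. Linearity and the
    bound concern continuous functions, whose integrals are meaningful; locality is asked of all
    functions, so that arguments may be altered outside [[0, 1]]. *)
Record bfun L : Prop := BFun {
  bfun_local : forall f g, (forall x, 0 <= x <= 1 -> f x = g x) -> L f = L g;
  bfun_lin : forall c f g, continuous f -> continuous g ->
    L (fun x => c * f x + g x) = c * L f + L g;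
  bfun_bound : exists2 C, 0 <= C & forall f B, continuous f ->
    (forall x, 0 <= x <= 1 -> `|f x| <= B) -> `|L f| <= C * B }.

Lemma continuousD_fun f g : continuous f -> continuous g -> continuous (fun x => f x + g x).
Proof. by move=> cf cg x; apply: cvgD; [exact: cf|exact: cg]. Qed.

Lemma continuousM_fun f g : continuous f -> continuous g -> continuous (fun x => f x * g x).
Proof. by move=> cf cg x; apply: cvgM; [exact: cf|exact: cg]. Qed.

Lemma continuousZ_fun c f : continuous f -> continuous (fun x => c * f x).
Proof. by move=> cf; apply: continuousM_fun => //; move=> x; exact: cvg_cst. Qed.

Lemma continuous_sum_fun (T : Type) (s : seq T) (P : pred T) (f : T -> R -> R) :
  (forall a, P a -> continuous (f a)) -> continuous (fun x => \sum_(a <- s | P a) f a x).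
Proof.
move=> cf; elim: s => [|a s IH].
  by rewrite (_ : (fun x => _) = fun=> 0); [move=> x; exact: cvg_cst|apply/funext => x; rewrite big_nil].
have [Pa|nPa] := boolP (P a).
  rewrite (_ : (fun x => _) = fun x => f a x + \sum_(a <- s | P a) f a x).
    by apply: continuousD_fun => //; exact: cf.
  by apply/funext => x; rewrite big_cons Pa.
rewrite (_ : (fun x => _) = fun x => \sum_(a <- s | P a) f a x)//.
by apply/funext => x; rewrite big_cons (negbTE nPa).
Qed.

Lemma bfun0 L : bfun L -> L (fun=> 0) = 0.
Proof.
move=> bL; have c0 : continuous ((fun=> 0) : R -> R) by move=> x; exact: cvg_cst.
have := bfun_lin bL (-1) c0 c0; rewrite (_ : (fun x => _) = fun=> 0).
  by rewrite mulN1r addNr.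
by apply/funext => x; rewrite mulr0 addr0.
Qed.

Lemma bfun_sumE L (T : Type) (s : seq T) (P : pred T) (c : T -> R) (f : T -> R -> R) :
  bfun L -> (forall a, P a -> continuous (f a)) ->
  L (fun x => \sum_(a <- s | P a) c a * f a x) = \sum_(a <- s | P a) c a * L (f a).
Proof.
move=> bL cf; elim: s => [|a s IH].
  rewrite big_nil -[RHS](bfun0 bL); apply: (bfun_local bL) => x _.
  by rewrite big_nil.
rewrite big_cons; case: ifPn => [Pa|nPa]; last first.
  by rewrite -IH; apply: (bfun_local bL) => x _; rewrite big_cons (negbTE nPa).
rewrite -IH -(bfun_lin bL).
- by apply: (bfun_local bL) => x _; rewrite big_cons Pa.
- exact: cf.
- by apply: continuous_sum_fun => b Pb; apply: continuousZ_fun; exact: cf.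
Qed.

Lemma bfun_eval (t : R) : 0 <= t <= 1 -> bfun (fun f => f t).
Proof.
move=> t01; split => [f g|//|]; first exact.
by exists 1 => // f B _ /(_ _ t01); rewrite mul1r.
Qed.

Lemma bfun_comb (T : finType) (c : T -> R) (L : T -> (R -> R) -> R) :
  (forall a, bfun (L a)) -> bfun (fun f => \sum_a c a * L a f).
Proof.
move=> bL; split.
- by move=> f g fg; apply: eq_bigr => a _; rewrite (bfun_local (bL a) fg).
- move=> e f g cf cg; rewrite mulr_sumr -big_split/=; apply: eq_bigr => a _.
  by rewrite (bfun_lin (bL a))// mulrDr mulrCA.
have [C HC] : exists C : T -> R, forall a, 0 <= C a /\ forall f B, continuous f ->
    (forall x, 0 <= x <= 1 -> `|f x| <= B) -> `|L a f| <= C a * B.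
  have H a : exists C, 0 <= C /\ forall f B, continuous f ->
      (forall x, 0 <= x <= 1 -> `|f x| <= B) -> `|L a f| <= C * B.
    by have [C C0 HC] := bfun_bound (bL a); exists C.
  by have [C HC] := choice H; exists C.
exists (\sum_a `|c a| * C a).
  by apply: sumr_ge0 => a _; apply: mulr_ge0 => //; have [] := HC a.
move=> f B cf fB; rewrite (le_trans (ler_norm_sum _ _ _))// mulr_suml.
apply: ler_sum => a _; rewrite normrM -mulrA ler_wpM2l//.
by have [_] := HC a; apply.
Qed.

Lemma bfunD L1 L2 : bfun L1 -> bfun L2 -> bfun (fun f => L1 f + L2 f).
Proof.
move=> b1 b2; have := @bfun_comb bool (fun=> 1) (fun b : bool => if b then L1 else L2).
have H b : bfun (if b then L1 else L2) by case: b.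
move=> /(_ H); congr bfun; apply/funext => f.
by rewrite big_bool /= !mul1r.
Qed.

Lemma bfunZ c L : bfun L -> bfun (fun f => c * L f).
Proof.
move=> b1; have := @bfun_comb unit (fun=> c) (fun=> L) (fun=> b1).
congr bfun; apply/funext => f.
by rewrite (big_pred1 tt)// => -[].
Qed.

Lemma Rintegral_sumC0 (T : Type) (s : seq T) (P : pred T) (u v : R) (f : T -> R -> R) (c : T -> R) :
  (forall a, P a -> continuous (f a)) ->
  \int[leb]_(x in `[u, v]) (\sum_(a <- s | P a) c a * f a x) =
  \sum_(a <- s | P a) c a * \int[leb]_(x in `[u, v]) f a x.
Proof.
move=> cf; have mI : measurable (`[u, v]%classic : set (measurableTypeR R)) := measurable_itvR _.
rewrite Rintegral_sum//.
  by apply: eq_bigr => a Pa; rewrite RintegralZl//; apply: integrable_C0; exact: cf.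
by move=> a Pa; apply: integrable_C0; apply: continuousZ_fun; exact: cf.
Qed.

Lemma bfun_int (u v : R) g : 0 <= u -> v <= 1 -> continuous g ->
  bfun (fun f => \int[leb]_(x in `[u, v]) (f x * g x)).
Proof.
move=> u0 v1 cg.
have mI : measurable (`[u, v]%classic : set (measurableTypeR R)) := measurable_itvR _.
have sub x : x \in `[u, v]%classic -> 0 <= x <= 1.
  by move=> /set_mem /=; rewrite in_itv/= => /andP[ux xv]; rewrite (le_trans u0 ux) (le_trans xv v1).
split.
- by move=> f f' ff'; apply: eq_Rintegral => x /sub x01; rewrite ff'.
- move=> c f f' cf cf'.
  rewrite -RintegralZl//; last by apply: integrable_C0; exact: continuousM_fun.
  rewrite -RintegralD//.
  + by apply: eq_Rintegral => x _; rewrite mulrDl mulrA.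
  + by apply: (@integrable_C0 _ (fun x => c * (f x * g x))); apply: continuousZ_fun; exact: continuousM_fun.
  + by apply: integrable_C0; exact: continuousM_fun.
exists (\int[leb]_(x in `[u, v]) `|g x|); first exact: Rintegral_ge0.
have cng : continuous (fun x => `|g x|).
  by move=> x; apply: cvg_norm; exact: cg.
move=> f B cf fB; rewrite (le_trans (le_normr_Rintegral _ _))//.
  by apply: integrable_C0; exact: continuousM_fun.
rewrite -RintegralZr//; last exact: integrable_C0.
apply: le_Rintegral => //.
- apply: (@integrable_C0 _ (fun x => `|f x * g x|)) => x; apply: cvg_norm.
  by apply: cvgM; [exact: cf|exact: cg].
- apply: (@integrable_C0 _ (fun x => `|g x| * B)) => x; apply: cvgM; [exact: cng|exact: cvg_cst].
- by move=> x /mem_set /sub x01; rewrite normrM mulrC ler_wpM2l// fB.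
Qed.

(** [size p] equally spaced points of the interval would all be roots, one more than the degree
    allows. *)
Lemma poly_itv0 p (a b : R) : a < b -> (forall x, a <= x < b -> p.[x] = 0) -> p = 0.
Proof.
move=> ab p0; apply/eqP; apply: contraT => pn0.
pose n := size p; pose s := [seq a + (b - a) * (i%:R / n%:R) | i <- iota 0 n].
have n0 : (0 < n)%N by rewrite lt0n size_poly_eq0.
have nR : (0 : R) < n%:R by rewrite ltr0n.
have us : uniq s.
  rewrite map_inj_uniq ?iota_uniq// => i j /addrI /mulfI.
  rewrite subr_eq0 gt_eqF// => /(_ isT) /divIf; rewrite gt_eqF// => /(_ isT) /eqP.
  by rewrite eqr_nat => /eqP.
have rs : all (root p) s.
  apply/allP => x /mapP[i]; rewrite mem_iota add0n => /andP[_ im] ->.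
  apply/rootP/p0; rewrite lerDl mulr_ge0 ?subr_ge0 ?(ltW ab) ?divr_ge0//=.
  rewrite -ltrBrDl -[ltRHS]mulr1 ltr_pM2l ?subr_gt0// ltr_pdivrMr// mul1r ltr_nat.
  exact: im.
have := max_poly_roots pn0 rs us.
by rewrite size_map size_iota ltnn.
Qed.

Lemma continuous_hornerM f p : continuous f -> continuous (fun x => f x * p.[x]).
Proof. by move=> cf; apply: continuousM_fun => //; exact: horner_continuous. Qed.

Lemma Rintegral_deriv p (a b : R) : a <= b ->
  \int[leb]_(x in `[a, b]) p^`().[x] = p.[b] - p.[a].
Proof.
move=> ab; apply: (@Rintegral_C1 _ (fun x => p.[x])) => //.
  by move=> x; exact: is_derive_horner.
exact: horner_continuous.
Qed.

(** The antiderivative of [p * p] is nondecreasing with equal end values, hence constant on the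
    interval and so constant as a polynomial; differentiating it gives [p * p = 0]. *)
Lemma Rintegral_poly_sqr_eq0 p (a b : R) : a < b ->
  \int[leb]_(x in `[a, b]) (p.[x] * p.[x]) = 0 -> p = 0.
Proof.
move=> ab I0; pose P := primp (p * p).
have IE (u v : R) : u <= v -> P.[v] - P.[u] = \int[leb]_(x in `[u, v]) (p.[x] * p.[x]).
  move=> uv; rewrite -Rintegral_deriv// deriv_primp.
  by apply: eq_Rintegral => x _; rewrite hornerM.
have I_ge0 (u v : R) : u <= v -> P.[u] <= P.[v].
  by move=> uv; rewrite -subr_ge0 IE//; apply: Rintegral_ge0 => x _; rewrite -expr2 sqr_ge0.
rewrite -IE ?ltW// in I0; move/eqP: I0; rewrite subr_eq0 => /eqP Pab.
have Pc : P - P.[a]%:P = 0.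
  apply: (poly_itv0 ab) => x /andP[ax xb]; rewrite !hornerE.
  apply/eqP; rewrite subr_eq0 eq_le; apply/andP; split; last exact: I_ge0.
  by rewrite -Pab; apply: I_ge0; exact: ltW.
have : (P - P.[a]%:P)^`() = 0 by rewrite Pc deriv0.
rewrite derivB derivC subr0 deriv_primp => /eqP; rewrite mulf_eq0 orbb.
by move/eqP.
Qed.

(** * Gram matrices of the monomials on an interval *)

Section Gram.
Variable k : nat.

Definition gram (a b : R) : 'M[R]_k.+1 :=
  \matrix_(s, r) \int[leb]_(x in `[a, b]) (x ^+ s * x ^+ r).

Lemma continuous_expr n : continuous (fun x : R => x ^+ n).
Proof. exact: exprn_continuous. Qed.

Lemma horner_rVpolyE (c : 'rV[R]_k.+1) x : (rVpoly c).[x] = \sum_s c ord0 s * x ^+ s.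
Proof.
rewrite horner_poly; apply: eq_bigr => s _; congr (_ * _).
by rewrite insubT //= => lt; congr (c _ _); exact/val_inj.
Qed.

Lemma Rintegral_rVpoly (c : 'rV[R]_k.+1) (a b : R) (r : 'I_k.+1) :
  \int[leb]_(x in `[a, b]) ((rVpoly c).[x] * x ^+ r) = (c *m gram a b) ord0 r.
Proof.
rewrite mxE; under eq_bigr do rewrite mxE.
rewrite -Rintegral_sumC0.
  apply: eq_Rintegral => x _; rewrite horner_rVpolyE mulr_suml.
  by apply: eq_bigr => s _; rewrite mulrA.
by move=> s _; apply: continuousM_fun; exact: continuous_expr.
Qed.

Lemma Rintegral_hornerM f w (a b : R) : continuous f -> (size w <= k.+1)%N ->
  \int[leb]_(x in `[a, b]) (f x * w.[x]) =
  \sum_(r < k.+1) w`_r * \int[leb]_(x in `[a, b]) (f x * x ^+ r).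
Proof.
move=> cf sw; rewrite -Rintegral_sumC0.
  apply: eq_Rintegral => x _; rewrite (horner_coef_wide x sw) mulr_sumr.
  by apply: eq_bigr => r _; rewrite mulrCA.
by move=> r _; apply: continuousM_fun => //; exact: continuous_expr.
Qed.

(** A row in the kernel holds the coefficients of a polynomial orthogonal to all monomials of degree
    at most [k], thus to itself. *)
Lemma gram_unit (a b : R) : a < b -> gram a b \in unitmx.
Proof.
move=> ab; rewrite -row_free_unit; apply: inj_row_free => c c0.
apply: (can_inj rVpolyK); rewrite linear0.
apply: (Rintegral_poly_sqr_eq0 ab).
rewrite Rintegral_hornerM; [|exact: horner_continuous|exact: size_poly].
by apply: big1 => r _; rewrite Rintegral_rVpoly c0 mxE mulr0.
Qed.

End Gram.

End Functionals.

(** * The one-dimensional interpolants *)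

Section Interpolants.
Variables (R : realType) (k : nat).
Notation leb := (@lebesgue_measure R).
Implicit Types (f g : R -> R) (m i : nat) (w : {poly R}).
Notation a_ m i := (grid R m i).

Definition moment m i f (r : nat) := \int[leb]_(x in @cell R m i) (f x * x ^+ r).

(* the moments of f' over the cell, integrated by parts *)
Definition deriv_moment m i f (r : nat) :=
  f (a_ m i.+1) * a_ m i.+1 ^+ r - f (a_ m i) * a_ m i ^+ r
  - r%:R * \int[leb]_(x in @cell R m i) (f x * x ^+ r.-1).

(** Coefficients of the polynomial of degree at most [k] whose moments of order [0] to [k] on the
    cell are prescribed by [D]. *)
Definition cell_coef m i (D : nat -> R) : 'rV[R]_k.+1 :=
  (\row_r D r) *m invmx (gram k (a_ m i) (a_ m i.+1)).

Definition coef_functional m (D : nat -> nat -> (R -> R) -> nat -> R) (p : 'I_(2 ^ m) * 'I_k.+1) f :=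
  cell_coef m p.1 (D m p.1 f) ord0 p.2.

Definition cell_mono m (p : 'I_(2 ^ m) * 'I_k.+1) : R -> R :=
  cutoff (a_ m p.1) (a_ m p.1.+1) 'X^(p.2).

(** The primitive of [cell_mono p] that is [0] to the left of the cell; it is constant to the
    right. *)
Definition cell_ramp m (p : 'I_(2 ^ m) * 'I_k.+1) : R -> R := fun x =>
  (primp 'X^(p.2)).[clamp (a_ m p.1) (a_ m p.1.+1) x] - (primp 'X^(p.2)).[a_ m p.1].

Definition Pi1_formula m f : R -> R := fun x =>
  \sum_(p : 'I_(2 ^ m) * 'I_k.+1) coef_functional moment p f * cell_mono p x.

(** [f 0] plus the running integral of the L^2 projection of [f'], with the moments of [f'] replaced
    by [deriv_moment], so that it makes sense when [f] is merely continuous. *)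
Definition Pi0_formula m f : R -> R := fun x =>
  f 0 + \sum_(p : 'I_(2 ^ m) * 'I_k.+1) coef_functional deriv_moment p f * cell_ramp p x.

Lemma ltr_gridS m i : a_ m i < a_ m i.+1. Proof. by rewrite ltr_grid. Qed.

Lemma cell_coef_moment m i (D : nat -> R) (r : 'I_k.+1) :
  \int[leb]_(x in @cell R m i) ((rVpoly (cell_coef m i D)).[x] * x ^+ r) = D r.
Proof.
rewrite /cell Rintegral_rVpoly mulmxKV ?mxE//.
exact/gram_unit/ltr_gridS.
Qed.

Lemma grid_in01 m i : (i <= 2 ^ m)%N -> 0 <= a_ m i <= 1.
Proof. by move=> im; rewrite grid_ge0 grid_le1. Qed.

Lemma bfun_moment m i r : (i < 2 ^ m)%N -> bfun (fun f => moment m i f r).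
Proof.
move=> im; apply: bfun_int; [exact: grid_ge0|exact: grid_le1|exact: continuous_expr].
Qed.

(** Only point values and moments of [f] remain, which are bounded in the sup norm although
    differentiation is not. For [r = 0] the factor [r%:R] removes the term with the truncated
    exponent [r.-1]. *)
Lemma bfun_deriv_moment m i r : (i < 2 ^ m)%N -> bfun (fun f => deriv_moment m i f r).
Proof.
move=> im; have -> : (fun f => deriv_moment m i f r) = (fun f =>
   (a_ m i.+1 ^+ r * f (a_ m i.+1) + (- a_ m i ^+ r) * f (a_ m i))
   + (- r%:R) * \int[leb]_(x in @cell R m i) (f x * x ^+ r.-1)).
  by apply/funext => f; rewrite /deriv_moment; congr (_ + _); [congr (_ + _)|];
     rewrite ?mulNr// mulrC.
apply: bfunD; first apply: bfunD.
- by apply: bfunZ; apply: bfun_eval; exact: grid_in01.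
- by apply: bfunZ; apply: bfun_eval; apply: grid_in01; exact: ltnW.
- by apply: bfunZ; exact: bfun_moment.
Qed.

Lemma bfun_coef m D (p : 'I_(2 ^ m) * 'I_k.+1) :
  (forall i r, (i < 2 ^ m)%N -> bfun (fun f => D m i f r)) -> bfun (coef_functional D p).
Proof.
move=> bD; have := @bfun_comb R 'I_k.+1
  (fun r => invmx (gram k (a_ m p.1) (a_ m p.1.+1)) r p.2) (fun r f => D m p.1 f r)
  (fun r => bD p.1 r (ltn_ord _)).
congr bfun; apply/funext => f; rewrite /coef_functional /cell_coef mxE.
by apply: eq_bigr => r _; rewrite mxE mulrC.
Qed.

Lemma grid_cover m (x : R) : 0 <= x < 1 -> exists2 i, (i < 2 ^ m)%N & a_ m i <= x < a_ m i.+1.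
Proof.
move=> /andP[x0 x1]; have p0 := pow2_gt0 R m.
have y0 : 0 <= x * 2 ^+ m by rewrite mulr_ge0// ltW.
have /andP[t1 t2] := truncn_itv y0.
exists (Num.trunc (x * 2 ^+ m)).
  rewrite -(ltr_nat R) natrX (le_lt_trans t1)//.
  by rewrite -[ltRHS]mul1r ltr_pM2r.
by rewrite /Defs.grid ler_pdivrMr// t1 ltr_pdivlMr.
Qed.

Lemma grid_cover_cell m (x : R) : 0 <= x <= 1 -> exists2 i, (i < 2 ^ m)%N & cell m i x.
Proof.
move=> /andP[x0]; rewrite le_eqVlt => /predU1P[->|x1]; last first.
  have [|i im /andP[ax xb]] := @grid_cover m x; first by rewrite x0 x1.
  by exists i => //; apply/cellE; rewrite ax ltW.
exists (2 ^ m).-1; first by rewrite prednK// expn_gt0.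
apply/cellE; rewrite prednK ?expn_gt0// grid1 lexx andbT -(grid1 R m) ler_grid.
exact: leq_pred.
Qed.

Lemma cell_mono_sum m (c : 'I_(2 ^ m) -> 'rV[R]_k.+1) (i : 'I_(2 ^ m)) x :
  a_ m i <= x < a_ m i.+1 ->
  \sum_p c p.1 ord0 p.2 * cell_mono p x = (rVpoly (c i)).[x].
Proof.
move=> xi; rewrite horner_rVpolyE.
transitivity (\sum_j \sum_s c j ord0 s * cell_mono (j, s) x).
  by rewrite pair_bigA; apply: eq_bigr => -[].
rewrite (bigD1 i)//=.
rewrite [X in _ + X]big1 ?addr0; last first.
  move=> j ji; apply: big1 => s _; rewrite /cell_mono cutoffE/=.
  case: ifP => [xj|]; last by rewrite mulr0.
  have /andP[ai ib] := xi; have /andP[aj jb] := xj.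
  have := le_lt_trans ai jb; have := le_lt_trans aj ib.
  rewrite !ltr_grid !ltnS => ji' ij'; case/eqP: ji; apply/val_inj/eqP.
  by rewrite /= eqn_leq ji' ij'.
by apply: eq_bigr => s _; rewrite /cell_mono cutoffE/= xi hornerXn.
Qed.

Lemma Pi1_formula_cell m f (i : nat) x : (i < 2 ^ m)%N -> a_ m i <= x < a_ m i.+1 ->
  Pi1_formula m f x = (rVpoly (cell_coef m i (moment m i f))).[x].
Proof.
move=> im xi; pose i' := Ordinal im.
exact: (@cell_mono_sum m (fun i : 'I_(2 ^ m) => cell_coef m i (moment m i f)) i' x).
Qed.

Lemma cell_ramp_sum m (c : 'I_(2 ^ m) -> 'rV[R]_k.+1) x :
  \sum_p c p.1 ord0 p.2 * cell_ramp p x =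
  \sum_i ((primp (rVpoly (c i))).[clamp (a_ m i) (a_ m i.+1) x] - (primp (rVpoly (c i))).[a_ m i]).
Proof.
transitivity (\sum_j \sum_s c j ord0 s * cell_ramp (j, s) x).
  by rewrite pair_bigA; apply: eq_bigr => -[].
apply: eq_bigr => i _; set b := clamp _ _ _.
have E y : y >= a_ m i -> (primp (rVpoly (c i))).[y] - (primp (rVpoly (c i))).[a_ m i] =
    \sum_s c i ord0 s * ((primp 'X^s).[y] - (primp 'X^s).[a_ m i]).
  move=> ay; rewrite -Rintegral_deriv// deriv_primp.
  under eq_Rintegral do rewrite horner_rVpolyE.
  rewrite Rintegral_sumC0; last by move=> s _; exact: continuous_expr.
  apply: eq_bigr => s _; congr (_ * _); rewrite -Rintegral_deriv// deriv_primp.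
  by apply: eq_Rintegral => z _; rewrite hornerXn.
by rewrite E// /b /clamp le_max lexx.
Qed.

(** Cells to the left of cell [i] contribute their full increments. These are the increments of [f]
    between nodes, as the moments of order [0] show, and they telescope to [f (a_ m i) - f 0]. Cells
    to the right contribute nothing. *)
Lemma Pi0_formula_cell m f (i : nat) x : (i < 2 ^ m)%N -> cell m i x ->
  Pi0_formula m f x = f (a_ m i) +
    ((primp (rVpoly (cell_coef m i (deriv_moment m i f)))).[x] -
     (primp (rVpoly (cell_coef m i (deriv_moment m i f)))).[a_ m i]).
Proof.
move=> im /cellE /andP[ax xb]; rewrite /Pi0_formula.
rewrite (@cell_ramp_sum m (fun i : 'I_(2 ^ m) => cell_coef m i (deriv_moment m i f))).
pose P j := primp (rVpoly (cell_coef m j (deriv_moment m j f))).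
have Pjump j : (P j).[a_ m j.+1] - (P j).[a_ m j] = f (a_ m j.+1) - f (a_ m j).
  rewrite -Rintegral_deriv; last exact/ltW/ltr_gridS.
  rewrite deriv_primp; have := @cell_coef_moment m j (deriv_moment m j f) ord0.
  rewrite /deriv_moment !expr0 !mulr1 mul0r subr0 => <-.
  by apply: eq_Rintegral => z _; rewrite expr0 mulr1.
rewrite -(big_mkord xpredT (fun j => (P j).[clamp (a_ m j) (a_ m j.+1) x] - (P j).[a_ m j])).
rewrite (big_cat_nat (n := i)) ?(ltnW im)//= addrA; congr (_ + _).
  rewrite (eq_big_nat _ _ (F2 := fun j => f (a_ m j.+1) - f (a_ m j))).
    by rewrite telescope_sumr// grid0 addrC subrK.
  move=> j /andP[_ ji]; rewrite -Pjump clampE ?(ltW (ltr_gridS _ _))//.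
  have jx : a_ m j.+1 <= x by rewrite (le_trans _ ax)// ler_grid.
  by rewrite !ltNge jx (le_trans _ jx)// ltW// ltr_gridS.
rewrite big_ltn//= big_nat_cond [X in _ + X]big1 ?addr0.
  rewrite -/(P i); congr (_ - _); congr (_.[_]).
  by rewrite /clamp min_r// max_r.
move=> j /andP[/andP[ij _] _]; rewrite [clamp _ _ _]max_l ?subrr//.
by rewrite ge_min (le_trans xb) ?orbT// ler_grid.
Qed.

Lemma L2_cell_mono m p : L2 leb (@open_itv R) (@cell_mono m p).
Proof. exact: L2_cutoff. Qed.

Lemma wpair_cell m p : wpair (@cell_ramp m p) (@cell_mono m p).
Proof.
have ab := ltW (ltr_gridS m p.1).
have W1 := @wpair_clamp R (primp 'X^(p.2)) _ _ ab.
have W2 := wpair_cst (primp 'X^(p.2)).[a_ m p.1].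
have := @wpair_sum R bool (fun b => if b then 1 else -1)
  (fun b : bool => if b then _ else _) (fun b : bool => if b then _ else _)
  (fun b => if b return wpair (if b then _ else _) (if b then _ else _) then W1 else W2).
apply: wpair_ext => x _.
  by rewrite big_bool /= mul1r mulN1r.
by rewrite big_bool /= mul1r mulN1r subr0 deriv_primp.
Qed.

Lemma cell_ramp_continuous m p : continuous (@cell_ramp m p).
Proof.
apply: continuousD_fun; last by move=> x; exact: cvg_cst.
move=> x; apply: continuous_comp; [exact: clamp_continuous|exact: horner_continuous].
Qed.

Lemma Qspace_Pi1_formula m f : Qspace k m (Pi1_formula m f).
Proof.
split.
  apply: L2_sum => [||p _]; [exact: measurable_open_itv|exact: open_itv_lty|].
  by apply: L2Z; [exact: measurable_open_itv|exact: L2_cell_mono].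
move=> i im; exists (rVpoly (cell_coef m i (moment m i f))); first exact: size_poly.
apply: ae_leb_imply (ae_leb_neq (a_ m i.+1)) => x /eqP xb /cellE /andP[ax xb'].
by rewrite (Pi1_formula_cell _ im)// ax lt_neqAle xb.
Qed.

Lemma Rintegral_grid m (n : nat) f : (n <= 2 ^ m)%N ->
  leb.-integrable (@open_itv R) (EFin \o f) ->
  \int[leb]_(x in `]0, a_ m n[) f x = \sum_(i < n) \int[leb]_(x in `]a_ m i, a_ m i.+1[) f x.
Proof.
move=> nm iF; have mI := @measurable_open_itv R.
have sub (u v : R) : 0 <= u -> v <= 1 -> `]u, v[ `<=` @open_itv R.
  move=> u0 v1 x /=; rewrite in_itv/= => /andP[ux xv]; apply/open_itvE.
  by rewrite (le_lt_trans u0 ux) (lt_le_trans xv v1).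
elim: n nm => [_|n IH nm].
  by rewrite big_ord0 grid0 set_itv_ge ?bnd_simp// Rintegral_set0.
have [n0|n0] := posnP n.
  by rewrite n0 big_ord_recl big_ord0 addr0 grid0.
have i1 : leb.-integrable `]0, a_ m n.+1[ (EFin \o f).
  apply: integrableS iF; [exact: measurable_open_itv|exact: measurable_itvR|].
  by apply: sub => //; exact: grid_le1.
have i2 : leb.-integrable `]0, a_ m n[ (EFin \o f).
  apply: integrableS iF; [exact: measurable_open_itv|exact: measurable_itvR|].
  by apply: sub => //; apply: grid_le1; exact: ltnW.
have := @Rintegral_itvB R f (BRight 0) (BLeft (a_ m n.+1)) (a_ m n) i1.
rewrite !bnd_simp grid_ge0 ltr_gridS => /(_ isT isT) /eqP.
rewrite subr_eq -Rintegral_itv_bndo_bndc// => /eqP ->.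
by rewrite IH ?(ltnW nm)// big_ord_recr addrC.
Qed.

Lemma Rintegral_open_itv_grid m f : leb.-integrable (@open_itv R) (EFin \o f) ->
  \int[leb]_(x in @open_itv R) f x =
  \sum_(i < 2 ^ m) \int[leb]_(x in `]a_ m i, a_ m i.+1[) f x.
Proof. by move=> iF; rewrite -Rintegral_grid// grid1. Qed.

Lemma L2_open_itv_cont f : continuous f -> L2 leb (@open_itv R) f.
Proof. by move=> cf; apply: L2_open_itv_continuous; exact: continuous_subspaceT. Qed.

Lemma L2M_open_itv f g : L2 leb (@open_itv R) f -> L2 leb (@open_itv R) g ->
  leb.-integrable (@open_itv R) (EFin \o (fun x => f x * g x)).
Proof. exact: (L2M_integrable (@measurable_open_itv R)). Qed.

Lemma L2B_open_itv f g : L2 leb (@open_itv R) f -> L2 leb (@open_itv R) g ->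
  L2 leb (@open_itv R) (fun x => f x - g x).
Proof. exact: (L2B (@measurable_open_itv R)). Qed.

(** On each cell the test function is a polynomial of degree at most [k], and inverting the Gram
    matrix has made the moments of the formula equal to those of [f]. *)
Lemma Pi1_formula_orthogonal m f g : continuous f -> Qspace k m g ->
  \int[leb]_(x in @open_itv R) ((Pi1_formula m f x - f x) * g x) = 0.
Proof.
move=> cf [Lg Pg]; have [Lp _] := Qspace_Pi1_formula m f.
have Lf := L2_open_itv_cont cf.
have Lpf := L2B_open_itv Lp Lf.
rewrite (Rintegral_open_itv_grid m); last exact: L2M_open_itv.
apply: big1 => i _; have [w sw Ew] := Pg i (ltn_ord i).
pose q := rVpoly (cell_coef m i (moment m i f)).
have mi : measurable (`]a_ m i, a_ m i.+1[%classic : set (measurableTypeR R)) by exact: measurable_itvR.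
have sub := @subset_grid_itv R m i (ltn_ord i).
have mqw : measurable_fun setT (fun x : R => (q.[x] - f x) * w.[x]).
  apply: continuous_measurable_fun; apply: continuous_hornerM => x; apply: cvgB.
    exact: horner_continuous.
  exact: cf.
rewrite (@ae_eq_Rintegral _ _ _ leb _ _ _ (fun x : R => (q.[x] - f x) * w.[x])); first last.
- apply: ae_leb_imply Ew => x Ex; rewrite /= in_itv/= => /andP[ax xb].
  by rewrite Ex ?(@Pi1_formula_cell _ _ i)// ?(ltW ax)//; apply/cellE; rewrite !ltW.
- exact: measurable_funTS.
- have [m1 _] := Lpf; have [m2 _] := Lg.
  have mI := @measurable_open_itv R.
  by apply: measurable_funM; [exact: measurable_funS mI sub m1|exact: measurable_funS mI sub m2].
- exact: mi.
rewrite Rintegral_itv_oocc; last exact: measurable_funTS.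
rewrite (@Rintegral_hornerM _ k (fun x => q.[x] - f x))//; last first.
  by move=> x; apply: cvgB; [exact: horner_continuous|exact: cf].
apply: big1 => r _.
have -> : \int[leb]_(x in `[a_ m i, a_ m i.+1]) ((q.[x] - f x) * x ^+ r) =
  \int[leb]_(x in `[a_ m i, a_ m i.+1]) (q.[x] * x ^+ r) - moment m i f r.
  rewrite /moment /cell -RintegralB.
  - by apply: eq_Rintegral => x _; rewrite mulrBl.
  - exact: measurable_itvR.
  - by apply: integrable_C0; apply: continuousM_fun; [exact: horner_continuous|exact: continuous_expr].
  - by apply: integrable_C0; apply: continuousM_fun; [exact: cf|exact: continuous_expr].
by rewrite (@cell_coef_moment m i (moment m i f)) subrr mulr0.
Qed.

Lemma cutoff_right_continuous (a b : R) (p : {poly R}) (x : R) :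
  cutoff a b p t @[t --> x^'+] --> cutoff a b p x.
Proof.
have cp : p.[t] @[t --> x^'+] --> p.[x].
  by apply: cvg_at_right_filter; exact: horner_continuous.
have [xa|ax] := ltP x a.
  rewrite [X in _ --> X]cutoffE leNgt xa/=; apply: cvg_near_cst.
  have : \forall t \near x^'+, t < a by exact: nbhs_right_lt.
  by apply: filterS => t ta; rewrite cutoffE leNgt ta.
have [xb|bx] := ltP x b; last first.
  rewrite [X in _ --> X]cutoffE [x < b]ltNge bx andbF; apply: cvg_near_cst.
  have : \forall t \near x^'+, x < t by exact: nbhs_right_gt.
  by apply: filterS => t xt; rewrite cutoffE [t < b]ltNge (le_trans bx (ltW xt)) andbF.
rewrite [X in _ --> X]cutoffE ax xb/=; apply: cvg_trans cp.
apply: near_eq_cvg.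
have H1 : \forall t \near x^'+, x < t by exact: nbhs_right_gt.
have H2 : \forall t \near x^'+, t < b by exact: nbhs_right_lt.
by apply: filterS2 H1 H2 => t xt tb; rewrite cutoffE (le_trans ax (ltW xt)) tb.
Qed.

Lemma Pi1_formula_right_continuous m f (x : R) :
  Pi1_formula m f t @[t --> x^'+] --> Pi1_formula m f x.
Proof.
rewrite /Pi1_formula; elim: (index_enum _) => [|p s IH].
  by rewrite big_nil; under eq_fun do rewrite big_nil; exact: cvg_cst.
rewrite big_cons; under eq_fun do rewrite big_cons.
apply: cvgD IH; apply: cvgM; [exact: cvg_cst|exact: cutoff_right_continuous].
Qed.

Lemma ae_exists_itv (P : R -> Prop) (u v : R) : u < v -> {ae leb, forall x, P x} ->
  exists2 x, u < x < v & P x.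
Proof.
move=> uv [A [mA A0 sub]]; apply: contrapT => H.
have muv : measurable (`]u, v[%classic : set (measurableTypeR R)) := measurable_itvR _.
have : (leb `]u, v[ <= leb A)%E.
  apply: le_measure; rewrite ?inE//.
  move=> x /=; rewrite in_itv/= => xuv; apply: sub => Px; apply: H; exists x => //.
have := lebesgue_measure_itv (`]u, v[ : interval R) => /= ->; rewrite A0 lte_fin uv.
by rewrite -EFinB lee_fin leNgt subr_gt0 uv.
Qed.

(** The difference of two admissible projections lies in [Qspace] and is orthogonal to itself, hence
    vanishes almost everywhere. Were it nonzero at [x], right-continuity would keep it nonzero on an
    interval of positive length. *)
Lemma Pi1E m f (x : R) : continuous f -> 0 <= x < 1 -> Pi1 k m f x = Pi1_formula m f x.
Proof.
move=> cf x01; pose Spec := [set p : R -> R | [/\ Qspace k m p,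
    forall v : R -> R, Qspace k m v -> \int[leb]_(x in @open_itv R) ((p x - f x) * v x) = 0 &
    forall x, 0 <= x < 1 -> p t @[t --> x^'+] --> p x]].
have Sp : Spec (Pi1_formula m f).
  split; [exact: Qspace_Pi1_formula|by move=> w; exact: Pi1_formula_orthogonal|].
  by move=> y _; exact: Pi1_formula_right_continuous.
have : Spec (Pi1 k m f) by apply: xgetPex; exists (Pi1_formula m f).
case: Sp; set p := Pi1_formula m f; set p' := Pi1 k m f.
move=> Qp op rp [Qp' op' rp'].
have Lf := L2_open_itv_cont cf.
have [Lp _] := Qp; have [Lp' _] := Qp'.
have Qe : Qspace k m (fun x => p x - p' x).
  have := @Qspace_sum R bool (fun b => if b then 1 else -1) (fun b : bool => if b then p else p') k m
    (fun b => if b return Qspace k m (if b then p else p') then Qp else Qp').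
  by congr (Qspace k m _); apply/funext => y; rewrite big_bool /= mul1r mulN1r.
have [Le _] := Qe; have [me _] := Le.
have I0 : \int[leb]_(x in @open_itv R) ((p x - p' x) * (p x - p' x)) = 0.
  transitivity (\int[leb]_(x in @open_itv R) ((p x - f x) * (p x - p' x) - (p' x - f x) * (p x - p' x))).
    by apply: eq_Rintegral => y _; ring.
  rewrite RintegralB; last 3 first.
  - exact: measurable_open_itv.
  - by apply: L2M_open_itv Le; exact: L2B_open_itv.
  - by apply: L2M_open_itv Le; exact: L2B_open_itv.
  by rewrite op// op'// subrr.
have ae0 : {ae leb, forall y, open_itv y -> p y = p' y}.
  have iee := L2M_open_itv Le Le.
  have : (\int[leb]_(x in @open_itv R) `|((p x - p' x) * (p x - p' x))%:E|)%E = 0%E.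
    rewrite -[RHS]/(0%:E) -I0 /Rintegral fineK; last exact: (integrable_fin_num (@measurable_open_itv R) iee).
    by apply: eq_integral => y _; rewrite gee0_abs// lee_fin -expr2 sqr_ge0.
  have mee := measurable_int _ iee.
  move=> /(ae_eq_integral_abs leb (@measurable_open_itv R) mee).
  apply: ae_leb_imply => y H yI; have /= := H yI.
  by move=> [] /eqP; rewrite mulf_eq0 orbb subr_eq0 => /eqP.
apply/eqP; rewrite eq_sym -subr_eq0; apply: contraT => ne0.
have cvge : (p t - p' t) @[t --> x^'+] --> p x - p' x by apply: cvgB; [exact: rp|exact: rp'].
have : \forall t \near x^'+, p t - p' t != 0 by exact: (cvgr_neq0 _ cvge ne0).
rewrite near_withinE => /nbhs_ballP[e /= e0 He].
have /andP[x0 x1] := x01.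
(* The cap at [1] keeps the chosen point in the open unit interval, where the almost everywhere
   equality holds. *)
have [|y /andP[xy yxe] Hy] := @ae_exists_itv _ x (Num.min (x + e) 1) _ ae0.
  by rewrite lt_min ltrDl e0.
move: yxe; rewrite lt_min => /andP[ye y1].
have := He y; rewrite /ball/= => /(_ _ xy); rewrite distrC gtr0_norm ?subr_gt0//.
rewrite ltrBlDl ye => /(_ isT); rewrite Hy ?subrr ?eqxx//.
by apply/open_itvE; rewrite y1 (le_lt_trans x0 xy).
Qed.

(** Uniqueness of [Pi_m^0] on one cell. As [e] vanishes at both ends, the integral of the square of
    [e'] is minus that of [e * e''], and [e''] has degree at most [k - 1]. So [e] is constant, hence
    zero. *)
Lemma deriv2_moment0 (e : {poly R}) (a b : R) : a < b -> (size e <= k.+2)%N ->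
  e.[a] = 0 -> e.[b] = 0 ->
  (forall w, (size w <= k)%N -> \int[leb]_(x in `[a, b]) (e.[x] * w.[x]) = 0) -> e = 0.
Proof.
move=> ab se ea eb orth.
have sd : (size e^`()^`() <= k)%N.
  apply: (leq_trans (size_poly _ _)); rewrite -subn1 leq_subLR add1n.
  apply: (leq_trans (size_poly _ _)); case: (size e) se => //=.
have e'0 : e^`() = 0.
  apply: (Rintegral_poly_sqr_eq0 ab).
  transitivity (\int[leb]_(x in `[a, b]) ((e * e^`())^`().[x] - e.[x] * e^`()^`().[x])).
    by apply: eq_Rintegral => x _; rewrite derivM !hornerE addrK.
  rewrite RintegralB; last 3 first.
  - exact: measurable_itvR.
  - by apply: integrable_C0; exact: horner_continuous.
  - by apply: integrable_C0; apply: continuous_hornerM; exact: horner_continuous.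
  by rewrite Rintegral_deriv ?ltW// orth// !hornerM ea eb !mul0r !subrr.
have : e - e.[a]%:P = 0.
  apply: (poly_itv0 ab) => x /andP[ax xb]; rewrite !hornerE -Rintegral_deriv//.
  rewrite e'0; under eq_Rintegral do rewrite horner0.
  by rewrite Rintegral_cst ?mul0r//; exact: measurable_itvR.
by rewrite ea polyC0 subr0.
Qed.

Lemma Pi0_formula_continuous m f : continuous (Pi0_formula m f).
Proof.
apply: continuousD_fun; first by move=> x; exact: cvg_cst.
by apply: continuous_sum_fun => p _; apply: continuousZ_fun; exact: cell_ramp_continuous.
Qed.

(** On each cell the formula is a polynomial [P i] with derivative [q i], whose moments are
    [deriv_moment]. Order [0] yields the value at the right end; order [r + 1], integrated by parts
    backwards, yields the moment condition of order [r]. *)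
Lemma Pi0_formula_spec m f : continuous f -> [set s | Sspace k m s /\
    forall i, (i < 2 ^ m)%N ->
      [/\ s (a_ m i) = f (a_ m i), s (a_ m i.+1) = f (a_ m i.+1) &
          forall w, (size w <= k)%N ->
            \int[leb]_(x in cell m i) ((s x - f x) * w.[x]) = 0]] (Pi0_formula m f).
Proof.
move=> cf; pose q i := rVpoly (cell_coef m i (deriv_moment m i f)).
pose P i := (f (a_ m i) - (primp (q i)).[a_ m i])%:P + primp (q i).
have PE i x : (i < 2 ^ m)%N -> cell m i x -> Pi0_formula m f x = (P i).[x].
  by move=> im xi; rewrite (Pi0_formula_cell f im xi) hornerD hornerC addrA addrAC.
have P' i : (P i)^`() = q i by rewrite derivD derivC add0r deriv_primp.
have Pa i : (P i).[a_ m i] = f (a_ m i) by rewrite !hornerE subrK.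
have qr i (r : nat) : (r < k.+1)%N ->
    \int[leb]_(x in `[a_ m i, a_ m i.+1]) ((q i).[x] * x ^+ r) = deriv_moment m i f r.
  by move=> rk; exact: (@cell_coef_moment m i _ (Ordinal rk)).
have Pb i : (P i).[a_ m i.+1] = f (a_ m i.+1).
  have := Rintegral_deriv (P i) (ltW (ltr_gridS m i)); rewrite P' Pa.
  have := qr i 0 isT; rewrite /deriv_moment !expr0 !mulr1 mul0r subr0.
  under eq_Rintegral do rewrite expr0 mulr1.
  by move=> -> /addIr.
split.
  split; first by apply: continuous_subspaceT; exact: Pi0_formula_continuous.
  move=> i im; exists (P i); last by move=> x; exact: PE.
  rewrite (leq_trans (size_polyD _ _))// geq_max (leq_trans (size_polyC_leq1 _))//=.
  apply: (leq_trans (size_poly _ _)); rewrite ltnS; exact: size_poly.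
move=> i im; have ab := ltr_gridS m i.
have ca : cell m i (a_ m i) by apply/cellE; rewrite lexx ltW.
have cb : cell m i (a_ m i.+1) by apply/cellE; rewrite lexx ltW.
split; [by rewrite (PE i)|by rewrite (PE i)|move=> w sw].
(* For [k = 0] the only test polynomial is zero; afterwards [k.-1] is a true predecessor. *)
have [k0|k0] := posnP k.
  rewrite k0 leqn0 size_poly_eq0 in sw; rewrite (eqP sw).
  under eq_Rintegral do rewrite horner0 mulr0.
  by rewrite Rintegral_cst ?mul0r//; exact: measurable_itvR.
have cPf : continuous (fun x => (P i).[x] - f x).
  by move=> x; apply: cvgB; [exact: horner_continuous|exact: cf].
transitivity (\int[leb]_(x in `[a_ m i, a_ m i.+1]) (((P i).[x] - f x) * w.[x])).
  by apply: eq_Rintegral => x /set_mem xi; rewrite (PE i).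
rewrite (@Rintegral_hornerM _ k.-1 (fun x => (P i).[x] - f x)) ?prednK//.
apply: big1 => r _; apply/eqP; rewrite mulf_eq0; apply/orP; right.
have rk : (r.+1 < k.+1)%N by rewrite ltnS ltn_ord.
have iX (p : {poly R}) n : leb.-integrable `[a_ m i, a_ m i.+1] (EFin \o (fun x => p.[x] * x ^+ n)).
  by apply: integrable_C0; apply: continuousM_fun; [exact: horner_continuous|exact: continuous_expr].
have mi : measurable (`[a_ m i, a_ m i.+1]%classic : set (measurableTypeR R)) by exact: measurable_itvR.
(* The boundary terms of [P i] and [f] agree, which leaves [r + 1] times the equality of the moments
   of order [r]. *)
have := Rintegral_deriv (P i * 'X^(r.+1)) (ltW ab).
rewrite !hornerM !hornerXn Pa Pb.
have -> : \int[leb]_(x in `[a_ m i, a_ m i.+1]) (P i * 'X^(r.+1))^`().[x] =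
  \int[leb]_(x in `[a_ m i, a_ m i.+1]) ((q i).[x] * x ^+ r.+1) +
  r.+1%:R * \int[leb]_(x in `[a_ m i, a_ m i.+1]) ((P i).[x] * x ^+ r).
  rewrite -RintegralZl// -RintegralD//.
    apply: eq_Rintegral => x _; rewrite derivM P' derivXn /= hornerD !hornerM hornerMn !hornerXn.
    by rewrite -[x ^+ r *+ _]mulr_natl mulrCA.
  by apply: eq_integrable (integrableZl mi r.+1%:R (iX (P i) r)).
rewrite qr// /deriv_moment /= => E.
rewrite (_ : \int[leb]_(x in `[a_ m i, a_ m i.+1]) (((P i).[x] - f x) * x ^+ r) =
  \int[leb]_(x in `[a_ m i, a_ m i.+1]) ((P i).[x] * x ^+ r) -
  \int[leb]_(x in `[a_ m i, a_ m i.+1]) (f x * x ^+ r)).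
  rewrite subr_eq0; apply/eqP; apply: (@mulfI _ r.+1%:R); first by rewrite pnatr_eq0.
  by move/eqP: E; rewrite -subr_eq0 addrAC [X in X + _](_ : _ = - (r.+1%:R * \int[leb]_(x in `[a_ m i, a_ m i.+1]) (f x * x ^+ r))) 1?addrC ?subr_eq0 => [/eqP//|]; rewrite /cell; ring.
rewrite -RintegralB//.
  by apply: eq_Rintegral => x _; rewrite mulrBl.
by apply: integrable_C0; apply: continuousM_fun; [exact: cf|exact: continuous_expr].
Qed.

Lemma Pi0E m f (x : R) : continuous f -> 0 <= x <= 1 -> Pi0 k m f x = Pi0_formula m f x.
Proof.
move=> cf /(grid_cover_cell m)[i im xi].
pose Spec := [set s | Sspace k m s /\
    forall i, (i < 2 ^ m)%N ->
      [/\ s (a_ m i) = f (a_ m i), s (a_ m i.+1) = f (a_ m i.+1) &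
          forall w, (size w <= k)%N ->
            \int[leb]_(x in cell m i) ((s x - f x) * w.[x]) = 0]].
have : Spec (Pi0 k m f) by apply: xgetPex; exists (Pi0_formula m f); exact: Pi0_formula_spec.
have : Spec (Pi0_formula m f) by exact: Pi0_formula_spec.
move=> [[_ /(_ i im)[p sp pE]] /(_ i im)[pa pb po]] [[_ /(_ i im)[q sq qE]] /(_ i im)[qa qb qo]].
have ab := ltr_gridS m i.
have ca : cell m i (a_ m i) by apply/cellE; rewrite lexx ltW.
have cb : cell m i (a_ m i.+1) by apply/cellE; rewrite lexx ltW.
suff : q - p = 0 by move/eqP; rewrite subr_eq0 => /eqP qp; rewrite pE// qE// qp.
apply: (deriv2_moment0 ab).
- by rewrite (leq_trans (size_polyD _ _))// geq_max size_polyN sp sq.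
- by rewrite !hornerE -pE// -qE// pa qa subrr.
- by rewrite !hornerE -pE// -qE// pb qb subrr.
move=> w sw.
transitivity (\int[leb]_(x in cell m i) ((Pi0 k m f x - f x) * w.[x] - (Pi0_formula m f x - f x) * w.[x])).
  apply: eq_Rintegral => y /set_mem yi; rewrite hornerD hornerN qE// pE//; ring.
rewrite RintegralB ?qo ?po ?subrr//.
- exact: measurable_itvR.
- have iq : leb.-integrable (cell m i) (EFin \o (fun x => (q.[x] - f x) * w.[x])).
    by apply: integrable_C0; apply: continuous_hornerM => y; apply: cvgB; [exact: horner_continuous|exact: cf].
  by apply: eq_integrable iq => [|y /set_mem yi]; [exact: measurable_itvR|rewrite /= qE].
- have ip : leb.-integrable (cell m i) (EFin \o (fun x => (p.[x] - f x) * w.[x])).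
    by apply: integrable_C0; apply: continuous_hornerM => y; apply: cvgB; [exact: horner_continuous|exact: cf].
  by apply: eq_integrable ip => [|y /set_mem yi]; [exact: measurable_itvR|rewrite /= pE].
Qed.

(** Integration by parts on the cell. At the ends [0] and [1] only continuity is available, so the
    fundamental theorem is used in the form that differentiates in the interior. *)
Lemma deriv_momentE m i f g r : (i < 2 ^ m)%N -> continuous f -> continuous g ->
  (forall x : R, 0 < x < 1 -> is_derive x 1 f (g x)) -> deriv_moment m i f r = moment m i g r.
Proof.
move=> im cf cg df; have ab := ltr_gridS m i.
have mi : measurable (`[a_ m i, a_ m i.+1]%classic : set (measurableTypeR R)) by exact: measurable_itvR.
pose p : {poly R} := 'X^r.
have c1 : continuous (fun x => g x * p.[x]) by exact: continuous_hornerM.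
have c2 : continuous (fun x => f x * p^`().[x]) by exact: continuous_hornerM.
have := @Rintegral_C1_oo R (fun x => f x * p.[x]) (fun x => g x * p.[x] + f x * p^`().[x])
  (a_ m i) (a_ m i.+1) (continuous_hornerM cf) (continuousD_fun c1 c2).
have dfp (x : R) : a_ m i < x < a_ m i.+1 ->
    is_derive x 1 (fun x => f x * p.[x]) (g x * p.[x] + f x * p^`().[x]).
  move=> xab; have /df dfx : 0 < x < 1.
    by apply/open_itvE/(subset_grid_itv im); rewrite /= in_itv.
  have dpx := is_derive_horner p x.
  apply: is_derive_eq.
  by rewrite addrC; congr (_ + _); exact: mulrC.
move=> /(_ dfp (ltW ab)); rewrite RintegralD//; [|exact: integrable_C0|exact: integrable_C0].
rewrite /deriv_moment !hornerXn => <-; apply/eqP; rewrite subr_eq; apply/eqP; congr (_ + _).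
  by rewrite /moment /cell; apply: eq_Rintegral => x _; rewrite hornerXn.
rewrite -RintegralZl//.
  by apply: eq_Rintegral => x _; rewrite derivXn hornerMn hornerXn mulrCA mulr_natl.
by apply: integrable_C0; apply: continuousM_fun => //; exact: continuous_expr.
Qed.

End Interpolants.

(** * The univariate operators as operators of finite rank *)

Section Operators.
Variable R : realType.
Notation leb := (@lebesgue_measure R).
Implicit Types (f g : R -> R) (m : nat) (A B : (R -> R) -> R -> R).

(** Slices of the given coefficients are continuous only within [[0, 1]]; locality lets a clamped
    extension, continuous on the line, take their place. *)
Definition op_local A := forall f g, (forall t, 0 <= t <= 1 -> f t = g t) -> A f = A g.

Definition op_rep A := exists (T : finType) (L : T -> (R -> R) -> R) (b : T -> R -> R),
  [/\ forall a, bfun (L a), forall a, L2 leb (@open_itv R) (b a) &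
    forall f, continuous f -> forall x, 0 < x < 1 -> A f x = \sum_a L a f * b a x].

(* a finite-rank form of (A f)' = B f': both sides use the same functionals of f *)
Definition op_pair_rep A B :=
  exists (T : finType) (L : T -> (R -> R) -> R) (b b' : T -> R -> R),
  [/\ forall a, bfun (L a), forall a, wpair (b a) (b' a),
    forall f, continuous f -> forall x, 0 < x < 1 -> A f x = \sum_a L a f * b a x &
    forall f g, continuous f -> continuous g ->
      (forall x : R, 0 < x < 1 -> is_derive x 1 f (g x)) ->
      forall x, 0 < x < 1 -> B g x = \sum_a L a f * b' a x].

Lemma op_pair_rep_op_rep A B : op_pair_rep A B -> op_rep A.
Proof.
move=> [T [L [b [b' [bL wb HA _]]]]]; exists T, L, b; split => // a.
by have [] := wb a.
Qed.

Lemma wpairN h g : wpair h g -> wpair (fun x : R => - h x) (fun x => - g x).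
Proof.
move=> w; have := @wpair_sum R unit (fun=> -1) (fun=> h) (fun=> g) (fun=> w).
by apply: wpair_ext => x _; rewrite (big_pred1 tt) ?mulN1r// => -[].
Qed.

Lemma op_repB A B : op_rep A -> op_rep B -> op_rep (fun f x => A f x - B f x).
Proof.
move=> [T [L [b [bL lb HA]]]] [T' [L' [b' [bL' lb' HB]]]].
exists (T + T')%type, (fun a => match a with inl a => L a | inr a => L' a end),
  (fun a => match a with inl a => b a | inr a => fun x => - b' a x end).
split; [by case|case=> a //|].
  have := L2Z (@measurable_open_itv R) (-1) (lb' a).
  by apply: L2_ext => x _; rewrite mulN1r.
move=> f cf x x01; rewrite big_sumType/= HA// HB// -sumrN; congr (_ + _).
by apply: eq_bigr => a _; rewrite mulrN.
Qed.

Lemma op_pair_repB A A' B B' : op_pair_rep A A' -> op_pair_rep B B' ->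
  op_pair_rep (fun f x => A f x - B f x) (fun f x => A' f x - B' f x).
Proof.
move=> [T [L [b [b' [bL wb HA HA']]]]] [U [M [c [c' [bM wc HB HB']]]]].
exists (T + U)%type, (fun a => match a with inl a => L a | inr a => M a end),
  (fun a => match a with inl a => b a | inr a => fun x => - c a x end),
  (fun a => match a with inl a => b' a | inr a => fun x => - c' a x end).
split; [by case|case=> a //; exact: wpairN| |].
  move=> f cf x x01; rewrite big_sumType/= HA// HB// -sumrN; congr (_ + _).
  by apply: eq_bigr => a _; rewrite mulrN.
move=> f g cf cg dfg x x01; rewrite big_sumType/= (HA' f g)// (HB' f g)// -sumrN; congr (_ + _).
by apply: eq_bigr => a _; rewrite mulrN.
Qed.

Variable k : nat.

(** [xget] depends only on the set it selects from, and that set involves [f] through its values on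
    [[0, 1]] alone. *)
Lemma Pi0_local m : op_local (Pi0 k m).
Proof.
move=> f g fg; congr (xget _ _); apply/seteqP.
have H f' g' : (forall t : R, 0 <= t <= 1 -> f' t = g' t) ->
  [set s | Sspace k m s /\
    forall i, (i < 2 ^ m)%N ->
      [/\ s (grid R m i) = f' (grid R m i), s (grid R m i.+1) = f' (grid R m i.+1) &
          forall w : {poly R}, (size w <= k)%N ->
            \int[leb]_(x in cell m i) ((s x - f' x) * w.[x]) = 0]] `<=`
  [set s | Sspace k m s /\
    forall i, (i < 2 ^ m)%N ->
      [/\ s (grid R m i) = g' (grid R m i), s (grid R m i.+1) = g' (grid R m i.+1) &
          forall w : {poly R}, (size w <= k)%N ->
            \int[leb]_(x in cell m i) ((s x - g' x) * w.[x]) = 0]].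
  move=> fg' s [Ss Hs]; split => // i im; have [h1 h2 h3] := Hs i im.
  rewrite -!fg'; [|exact: grid_in01|by apply: grid_in01; exact: ltnW].
  split => // w sw; rewrite -(h3 w sw); apply: eq_Rintegral => x /set_mem /cellE /andP[ax xb].
  by rewrite fg'// (le_trans (grid_ge0 _ _ _) ax) (le_trans xb (grid_le1 _ im)).
by split; apply: H => // t t01; rewrite fg.
Qed.

Lemma Pi1_local m : op_local (Pi1 k m).
Proof.
move=> f g fg; congr (xget _ _); apply/funext => p; apply/propext.
have E w : \int[leb]_(x in @open_itv R) ((p x - f x) * w x) =
    \int[leb]_(x in @open_itv R) ((p x - g x) * w x).
  apply: eq_Rintegral => x /set_mem /open_itvE /andP[x0 x1].
  by rewrite fg// !ltW.
split => -[h1 h2 h3]; split => // w Qw; first by rewrite -E; exact: h2.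
by rewrite E; exact: h2.
Qed.

Lemma increment_local (Pi : nat -> (R -> R) -> R -> R) m :
  (forall m, op_local (Pi m)) -> op_local (increment Pi m).
Proof.
by move=> H f g fg; case: m => [|m] /=; rewrite ?(H _ _ _ fg).
Qed.

Lemma Pi1_op_rep m : op_rep (Pi1 k m).
Proof.
exists ('I_(2 ^ m) * 'I_k.+1)%type, (coef_functional (moment (R:=R)) (m:=m)), (@cell_mono R k m).
split => [p|p|f cf x /andP[x0 x1]].
- by apply: bfun_coef => i r; exact: bfun_moment.
- exact: L2_cell_mono.
- by rewrite Pi1E// (ltW x0).
Qed.

(** The index [unit] carries the constant [f 0], with derivative [0]; every other index pairs a ramp
    with the monomial it integrates. [deriv_momentE] identifies the functionals of [f] with the
    moments of its derivative. *)
Lemma Pi_op_pair_rep m : op_pair_rep (Pi0 k m) (Pi1 k m).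
Proof.
exists (unit + 'I_(2 ^ m) * 'I_k.+1)%type,
  (fun a => match a with inl _ => fun f => f 0 | inr p => coef_functional (deriv_moment (R:=R)) p end),
  (fun a => match a with inl _ => fun=> 1 | inr p => cell_ramp p end),
  (fun a => match a with inl _ => fun=> 0 | inr p => cell_mono p end).
split.
- case=> [_|p]; first by apply: bfun_eval; rewrite lexx ler01.
  by apply: bfun_coef => i r; exact: bfun_deriv_moment.
- by case=> [_|p]; [exact: wpair_cst|exact: wpair_cell].
- move=> f cf x /andP[x0 x1]; rewrite Pi0E ?(ltW x0) ?(ltW x1)// big_sumType/=.
  by rewrite (big_pred1 tt) ?mulr1// => -[].
move=> f g cf cg dfg x /andP[x0 x1]; rewrite Pi1E ?(ltW x0)// big_sumType/=.
rewrite [X in X + _]big1 ?add0r; last by move=> a _; rewrite mulr0.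
apply: eq_bigr => p _; congr (_ * _); congr (cell_coef _ _ _ _ _ _).
by apply/funext => r; rewrite (@deriv_momentE R m p.1 f g).
Qed.

Lemma Delta0_local m : op_local (Delta0 (R:=R) k m).
Proof. exact: increment_local Pi0_local. Qed.

Lemma Delta1_local m : op_local (Delta1 (R:=R) k m).
Proof. exact: increment_local Pi1_local. Qed.

Lemma Delta_op_pair_rep m : op_pair_rep (Delta0 k m) (Delta1 k m).
Proof.
by case: m => [|m]; [exact: Pi_op_pair_rep|apply: op_pair_repB; exact: Pi_op_pair_rep].
Qed.

Lemma Delta1_op_rep m : op_rep (Delta1 k m).
Proof. by case: m => [|m]; [exact: Pi1_op_rep|apply: op_repB; exact: Pi1_op_rep]. Qed.

Lemma Delta0_op_rep m : op_rep (Delta0 k m).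
Proof. exact: op_pair_rep_op_rep (Delta_op_pair_rep m). Qed.

End Operators.

(** * Tensor products of operators *)

Section TensorOperators.
Variables (R : realType) (d : nat).
Implicit Types (x y : 'rV[R]_d) (u v : 'rV[R]_d -> R) (i j : 'I_d) (L M : (R -> R) -> R).

Definition close (e : R) x y := forall i, `|x ord0 i - y ord0 i| < e.

(* After clamping to the closed cube, coefficients become uniformly continuous on the whole space. *)
Definition uc u := forall e : R, 0 < e -> exists2 r : R, 0 < r & forall x y, close r x y -> `|u x - u y| <= e.

Lemma close_ball x y e : 0 < e -> close e x y <-> ball x e y.
Proof.
move=> e0; split=> [H|[_ H] i]; last by have := H ord0 i; rewrite /ball.
by split => // k i; rewrite ord1; exact: H.
Qed.

Definition cubeclamp x : 'rV[R]_d := \row_i clamp 0 1 (x ord0 i).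

Lemma clamp01 (t : R) : 0 <= clamp 0 1 t <= 1.
Proof. by rewrite /clamp le_max lexx/= ge_max ler01/= ge_min lexx. Qed.

Lemma clamp_id (t : R) : 0 <= t <= 1 -> clamp 0 1 t = t.
Proof. by move=> /andP[t0 t1]; rewrite /clamp min_r// max_r. Qed.

Lemma clamp_lip (a b s t : R) : a <= b -> `|clamp a b s - clamp a b t| <= `|s - t|.
Proof.
move=> ab; wlog st : s t / s < t.
  move=> H; case: (ltgtP s t) => [|ts|->]; [exact: H| |by rewrite !subrr].
  by rewrite distrC [leRHS]distrC H.
rewrite distrC [leRHS]distrC [leRHS]ger0_norm ?subr_ge0 ?(ltW st)// !clampE//.
case: (ltP t a) => ta; first by rewrite (lt_trans st ta)//subrr normr0 subr_ge0 ltW.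
case: (ltP s a) => sa; case: (ltP t b) => tb; case: (ltP s b) => sb;
by rewrite ler_norml; apply/andP; split; lra.
Qed.

Lemma cubeclamp_closed x : closed_cube (cubeclamp x).
Proof. by move=> i; rewrite mxE clamp01. Qed.

Lemma cubeclamp_id x : closed_cube x -> cubeclamp x = x.
Proof. by move=> H; apply/rowP => i; rewrite mxE clamp_id. Qed.

Lemma cubeclamp_update x i t : 0 <= t <= 1 -> cubeclamp (update x i t) = update (cubeclamp x) i t.
Proof. by move=> t01; apply/rowP => j; rewrite !mxE; case: ifP => // _; rewrite clamp_id. Qed.

(** Compactness of the closed cube, in its near-covering form, makes the radius uniform; clamping is
    1-Lipschitz and carries the estimate to the whole space. *)
Lemma uc_clamp u : {within @closed_cube R d, continuous u} -> uc (u \o cubeclamp).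
Proof.
move=> /subspace_continuousP cu e e0.
have e2 : 0 < e / 2 by rewrite divr_gt0.
have := @closed_cube_compact R d; rewrite compact_near_coveringP -near_covering_withinP.
pose P (r : R) x := forall y, closed_cube y -> close r x y -> `|u x - u y| <= e.
move=> /(_ R (0 : R)^'+ P _).
have H x : closed_cube x -> \forall x' \near x & r \near 0^'+, closed_cube x' -> P r x'.
  move=> Kx.
  have := cu x Kx => /cvgrPdist_lt /(_ _ e2); rewrite near_withinE.
  move=> /nbhs_ballP[r /= r0 Hr].
  have r2 : 0 < r / 2 by rewrite divr_gt0.
  (* With [x'] within [r / 2] of [x] and [y] within [r / 2] of [x'], both lie within [r] of [x]. *)
  exists (ball x (r / 2), [set r' | r' < r / 2]) => /=.
    split; first exact: nbhsx_ballx.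
    by apply: nbhs_right_lt.
  move=> [x' r'] /= [xx' r'r] Kx' y Ky x'y.
  have H1 : `|u x - u x'| < e / 2.
    apply: Hr => //; apply: le_ball xx'; lra.
  have H2 : `|u x - u y| < e / 2.
    apply: Hr => //; apply/close_ball => // i.
    have := proj2 (close_ball x x' r2) xx' i; have := x'y i => h1 h2.
    rewrite (le_lt_trans (ler_distD (x' ord0 i) _ _))//; lra.
  rewrite (le_trans (ler_distD (u x) _ _))// (distrC (u x')); lra.
move=> /(_ H)/=; rewrite near_withinE => /nbhs_ballP[r /= r0 Hr].
have r2 : 0 < r / 2 by rewrite divr_gt0.
exists (r / 2) => // x y xy.
have := Hr (r / 2); rewrite /ball/= sub0r normrN gtr0_norm// => /(_ _ r2).
have -> : r / 2 < r by lra.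
move=> /(_ isT) /(_ _ (cubeclamp_closed x)); apply; first exact: cubeclamp_closed.
move=> i; rewrite !mxE; exact: le_lt_trans (clamp_lip _ _ ler01) (xy i).
Qed.

Lemma update_update x i s t : update (update x i s) i t = update x i t.
Proof. by apply/rowP => j; rewrite !mxE; case: eqP. Qed.

Lemma updateC x i j s t : i != j -> update (update x i s) j t = update (update x j t) i s.
Proof.
move=> ij; apply/rowP => k; rewrite !mxE; case: eqP => [->|_] //; case: eqP => // ji.
by rewrite ji eqxx in ij.
Qed.

Lemma update_id x i : update x i (x ord0 i) = x.
Proof. by apply/rowP => j; rewrite !mxE; case: eqP => [->|]. Qed.

Lemma close_update_l r x y i t : 0 < r -> close r x y -> close r (update x i t) (update y i t).
Proof. by move=> r0 xy j; rewrite !mxE; case: eqP => // _; rewrite subrr normr0. Qed.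

Lemma close_update_r r x i s t : `|s - t| < r -> close r (update x i s) (update x i t).
Proof.
move=> st j; rewrite !mxE; case: eqP => // _; rewrite subrr normr0.
exact: le_lt_trans st.
Qed.

Lemma uc_slice_continuous u x i : uc u -> continuous (fun t => u (update x i t)).
Proof.
move=> ucu t; apply/cvgrPdist_le => e e0; have [r r0 Hr] := ucu e e0.
apply/nbhs_ballP; exists r => // s; rewrite /ball/= => ts.
exact/Hr/close_update_r.
Qed.

Lemma uc_lin c u v : uc u -> uc v -> uc (fun x => c * u x + v x).
Proof.
move=> ucu ucv e e0; have e1 : 0 < e / 2 by rewrite divr_gt0.
have e2 : 0 < e / 2 / (`|c| + 1) by rewrite divr_gt0// ltr_pwDr.
have [r r0 Hr] := ucu _ e2; have [s s0 Hs] := ucv _ e1.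
exists (Num.min r s); first by rewrite lt_min r0.
move=> x y xy; rewrite opprD addrACA -mulrBr (le_trans (ler_normD _ _))// normrM.
have Hx : `|u x - u y| <= e / 2 / (`|c| + 1).
  by apply: Hr => i; have := xy i; rewrite lt_min => /andP[].
have Hy : `|v x - v y| <= e / 2.
  by apply: Hs => i; have := xy i; rewrite lt_min => /andP[].
have : `|c| * `|u x - u y| <= e / 2.
  have c1 : 0 < `|c| + 1 by rewrite ltr_pwDr.
  move: Hx; rewrite ler_pdivlMr// => Hx; rewrite (le_trans _ Hx)// mulrC ler_wpM2l//.
  by rewrite lerDl.
lra.
Qed.

Lemma uc0 : uc (fun=> 0).
Proof. by move=> e e0; exists 1 => // x y _; rewrite subrr normr0 ltW. Qed.

Lemma uc_sum (T : Type) (s : seq T) (P : pred T) (c : T -> R) (u : T -> 'rV[R]_d -> R) :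
  (forall a, P a -> uc (u a)) -> uc (fun x => \sum_(a <- s | P a) c a * u a x).
Proof.
move=> ucu; elim: s => [|a s IH].
  by rewrite (_ : (fun x => _) = fun=> 0); [exact: uc0|apply/funext => x; rewrite big_nil].
have [Pa|nPa] := boolP (P a).
  rewrite (_ : (fun x => _) = fun x => c a * u a x + \sum_(a <- s | P a) c a * u a x).
    by apply: uc_lin => //; exact: ucu.
  by apply/funext => x; rewrite big_cons Pa.
rewrite (_ : (fun x => _) = fun x => \sum_(a <- s | P a) c a * u a x)//.
by apply/funext => x; rewrite big_cons (negbTE nPa).
Qed.

(** Unlike [act_on], it consumes the variable: the result is constant in [x_i]. *)
Definition actL i L u : 'rV[R]_d -> R := fun y => L (fun t => u (update y i t)).

Lemma bfunB L (f g : R -> R) : bfun L -> continuous f -> continuous g ->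
  L f - L g = L (fun t => f t - g t).
Proof.
move=> bL cf cg; rewrite addrC -mulN1r -(bfun_lin bL)//.
by apply: (bfun_local bL) => t _; rewrite mulN1r addrC.
Qed.

Lemma uc_actL i L u : bfun L -> uc u -> uc (actL i L u).
Proof.
move=> bL ucu e e0; have [C C0 HC] := bfun_bound bL.
have C1 : 0 < C + 1 by rewrite ltr_pwDr.
(* [C + 1] rather than [C], since the bound [C] may be zero. *)
have [r r0 Hr] := ucu (e / (C + 1)) (divr_gt0 e0 C1).
exists r => // x y xy; rewrite /actL bfunB//; try exact: uc_slice_continuous.
apply: (@le_trans _ _ (C * (e / (C + 1)))).
  apply: HC; first by move=> t; apply: cvgB; exact: uc_slice_continuous.
  by move=> t _; exact/Hr/close_update_l.
by rewrite mulrCA ler_piMr ?(ltW e0)// ler_pdivrMr// mul1r lerDl.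
Qed.

Lemma actL_sum (T : Type) (s : seq T) (P : pred T) (c : T -> R) (u : T -> 'rV[R]_d -> R) i L y :
  bfun L -> (forall a, P a -> uc (u a)) ->
  actL i L (fun x => \sum_(a <- s | P a) c a * u a x) y = \sum_(a <- s | P a) c a * actL i L (u a) y.
Proof.
move=> bL ucu; rewrite /actL (@bfun_sumE _ L _ s P c (fun a t => u a (update y i t)))//.
by move=> a Pa; apply: uc_slice_continuous; exact: ucu.
Qed.

(* exact on tensors, and piecewise linear interpolation in s approximates w uniformly by tensors *)
Lemma bfun_comm L M (w : R -> R -> R) : bfun L -> bfun M ->
  (forall s, continuous (w s)) -> (forall t, continuous (w^~ t)) ->
  continuous (fun s => M (w s)) -> continuous (fun t => L (w^~ t)) ->
  (forall e : R, 0 < e -> exists2 r : R, 0 < r & forall s s' t : R, `|s - s'| < r -> `|w s t - w s' t| <= e) ->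
  L (fun s => M (w s)) = M (fun t => L (w^~ t)).
Proof.
move=> bL bM c1 c2 cM cL unif.
have [C C0 HC] := bfun_bound bL; have [D D0 HD] := bfun_bound bM.
apply/eqP; rewrite -subr_eq0 -normr_le0; apply/ler_addgt0Pr => e e0.
(* Replacing [w] by its interpolant [v] changes values by at most [2 * (e / K)]; this happens on
   both sides, each time amplified by [C * D]. The [+ 1] keeps [K] positive. *)
pose K := 4 * C * D + 1.
have K0 : 0 < K by rewrite ltr_pwDr// !mulr_ge0.
have [r r0 Hr] := unif (e / K) (divr_gt0 e0 K0).
have [m Hm] : exists m, (2 ^+ m : R)^-1 < r.
  have [m Hm] : exists m : nat, r^-1 < m%:R.
    exists (Num.trunc r^-1).+1; exact: truncnS_gt.
  exists m; rewrite invf_plt ?posrE ?pow2_gt0//.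
  by rewrite (lt_le_trans Hm)// -natrX ler_nat ltnW// ltn_expl.
pose g (i : nat) : R := grid R m i.
have gS (i : nat) : g i.+1 - g i = (2 ^+ m)^-1.
  by rewrite /g /grid -mulrBl -natrB// subSnn mul1r.
have gS0 (i : nat) : 0 < g i.+1 - g i by rewrite gS invr_gt0 pow2_gt0.
(* In place of hat functions, [v] is [w 0] plus the increments of [w] over the cells, each switched
   on by a ramp from [0] to [1]. *)
pose rho (a : unit + 'I_(2 ^ m)) (s : R) := match a with
  | inl _ => 1 | inr i => (clamp (g i) (g i.+1) s - g i) / (g i.+1 - g i) end.
pose W (a : unit + 'I_(2 ^ m)) (t : R) := match a with
  | inl _ => w 0 t | inr i => -1 * w (g i) t + w (g i.+1) t end.
pose v s t := \sum_a rho a s * W a t.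
have crho (a : unit + 'I_(2 ^ m)) : continuous (rho a).
  move=> s; case: a => [[]|i]; first exact: cvg_cst.
  by apply: cvgM; [apply: cvgB; [exact: clamp_continuous|exact: cvg_cst]|exact: cvg_cst].
have cW (a : unit + 'I_(2 ^ m)) : continuous (W a).
  by case: a => [[]|i] /=; [exact: c1|apply: continuousD_fun; [apply: continuousZ_fun|]; exact: c1].
have cv1 s : continuous (v s) by apply: continuous_sum_fun => a _; exact: continuousZ_fun.
have cv2 t : continuous (v^~ t).
  by apply: continuous_sum_fun => a _; apply: continuousM_fun => // s; exact: cvg_cst.
have Mv s : M (v s) = \sum_a rho a s * M (W a) by rewrite /v bfun_sumE.
have Lv t : L (v^~ t) = \sum_a W a t * L (rho a).
  rewrite -bfun_sumE//; congr L; apply/funext => s; rewrite /v.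
  by apply: eq_bigr => a _; rewrite mulrC.
have Mvf : (fun s => M (v s)) = (fun s => \sum_a M (W a) * rho a s).
  by apply/funext => s; rewrite Mv; apply: eq_bigr => a _; rewrite mulrC.
have Lvf : (fun t => L (v^~ t)) = (fun t => \sum_a L (rho a) * W a t).
  by apply/funext => t; rewrite Lv; apply: eq_bigr => a _; rewrite mulrC.
have comm_v : L (fun s => M (v s)) = M (fun t => L (v^~ t)).
  rewrite Mvf Lvf !bfun_sumE//.
  by apply: eq_bigr => a _; rewrite mulrC.
have cMv : continuous (fun s => M (v s)).
  by rewrite Mvf; apply: continuous_sum_fun => a _; exact: continuousZ_fun.
have cLv : continuous (fun t => L (v^~ t)).
  by rewrite Lvf; apply: continuous_sum_fun => a _; exact: continuousZ_fun.
(* Both [s] and the next node are closer than [r] to the node [g j], and [v] departs from the value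
   of [w] at [g j] by a fraction [th] of one increment. *)
have err s t : 0 <= s <= 1 -> `|w s t - v s t| <= 2 * (e / K).
  move=> /(grid_cover_cell m)[j jm /cellE /andP[js sj]].
  pose th := (s - g j) / (g j.+1 - g j).
  have th01 : 0 <= th <= 1.
    apply/andP; split; first by apply: divr_ge0; [rewrite subr_ge0|exact: (ltW (gS0 j))].
    by rewrite ler_pdivrMr// mul1r lerD2r.
  have vE : v s t = w (g j) t + th * (w (g j.+1) t - w (g j) t).
    rewrite /v big_sumType/= (big_pred1 tt) ?mul1r; last by case.
    rewrite -(big_mkord xpredT (fun i : nat => (clamp (g i) (g i.+1) s - g i) / (g i.+1 - g i)
       * (-1 * w (g i) t + w (g i.+1) t))).
    rewrite (big_cat_nat (n := j)) ?(ltnW jm)//= addrA; congr (_ + _).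
      rewrite (eq_big_nat _ _ (F2 := fun i : nat => w (g i.+1) t - w (g i) t)).
        by rewrite telescope_sumr// /g grid0 addrC subrK.
      move=> i /andP[_ ij]; have is' : g i.+1 <= s by rewrite (le_trans _ js)// ler_grid.
      have ii : g i <= g i.+1 by rewrite ltW// -subr_gt0.
      rewrite clampE// !ltNge is' (le_trans ii is')/= divff ?gt_eqF// mul1r.
      by rewrite mulN1r addrC.
    rewrite big_ltn//= big_nat_cond [X in _ + X]big1 ?addr0.
      by rewrite /clamp min_r// max_r// mulN1r [- _ + _]addrC.
    move=> i /andP[/andP[ji _] _]; rewrite [clamp _ _ _]max_l ?subrr ?mul0r//.
    by rewrite ge_min (le_trans sj) ?orbT// ler_grid.
  have gr : g j.+1 - g j < r by rewrite gS.
  have h1 : `|w s t - w (g j) t| <= e / K.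
    by apply: Hr; rewrite ger0_norm ?subr_ge0// (le_lt_trans _ gr)// lerD2r.
  have h2 : `|w (g j.+1) t - w (g j) t| <= e / K.
    by apply: Hr; rewrite gtr0_norm.
  rewrite vE opprD addrA (le_trans (ler_normB _ _))// normrM.
  have /andP[th0 th1] := th01; rewrite (ger0_norm th0).
  have := ler_piMl (normr_ge0 (w (g j.+1) t - w (g j) t)) th1.
  lra.
have H1 : `|L (fun s => M (w s)) - L (fun s => M (v s))| <= C * (D * (2 * (e / K))).
  rewrite bfunB//; apply: HC; first by move=> s; apply: cvgB; [exact: cM|exact: cMv].
  move=> s s01; rewrite bfunB//; apply: HD; first by move=> t; apply: cvgB; [exact: c1|exact: cv1].
  by move=> t _; exact: err.
have H2 : `|M (fun t => L (w^~ t)) - M (fun t => L (v^~ t))| <= D * (C * (2 * (e / K))).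
  rewrite bfunB//; apply: HD; first by move=> s; apply: cvgB; [exact: cL|exact: cLv].
  move=> t _; rewrite bfunB//; apply: HC; first by move=> s; apply: cvgB; [exact: c2|exact: cv2].
  by move=> s s01; exact: err.
rewrite add0r.
have -> : L (fun s => M (w s)) - M (fun t => L (w^~ t)) =
  (L (fun s => M (w s)) - L (fun s => M (v s))) - (M (fun t => L (w^~ t)) - M (fun t => L (v^~ t))).
  by rewrite comm_v; ring.
rewrite (le_trans (ler_normB _ _))// (le_trans (lerD H1 H2))//.
have -> : C * (D * (2 * (e / K))) + D * (C * (2 * (e / K))) = e * ((4 * C * D) / K) by ring.
by rewrite ler_piMr ?(ltW e0)// ler_pdivrMr// mul1r lerDl.
Qed.

Lemma actL_comm i j L M u : i != j -> bfun L -> bfun M -> uc u ->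
  actL i L (actL j M u) = actL j M (actL i L u).
Proof.
move=> ij bL bM ucu; apply/funext => y.
rewrite /actL (@bfun_comm L M (fun s t => u (update (update y i s) j t)))//.
- congr M; apply/funext => t; congr L; apply/funext => s; by rewrite updateC.
- by move=> s; exact: uc_slice_continuous.
- move=> t; under eq_fun do rewrite updateC//; exact: uc_slice_continuous.
- have H := uc_slice_continuous (u := actL j M u) (x := y) (i := i) (uc_actL j bM ucu).
  exact H.
- have := uc_slice_continuous (u := actL i L u) (x := y) (i := j) (uc_actL i bL ucu).
  rewrite [X in continuous X -> _](_ : _ = fun t => L (fun s => u (update (update y i s) j t)))//.
  by apply/funext => t; rewrite /actL; congr L; apply/funext => s; rewrite [in RHS]updateC.
move=> e e0; have [r r0 Hr] := ucu e e0; exists r => // s s' t ss'.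
apply: Hr; apply: close_update_l => //; exact: close_update_r.
Qed.

End TensorOperators.

(** * Univariate operators applied successively in several variables *)

Section TensorFold.
Variables (R : realType) (d : nat).
Notation leb := (@lebesgue_measure R).
Implicit Types (x y : 'rV[R]_d) (u v w : 'rV[R]_d -> R) (i j : 'I_d) (L M : (R -> R) -> R).
Implicit Types (s : seq 'I_d) (A : 'I_d -> (R -> R) -> R -> R).

Definition fold A s u : 'rV[R]_d -> R := foldr (fun i => act_on i (A i)) u s.

(** Only the coordinates in [s] are confined to []0, 1[], where the finite-rank formulas hold; the
    others stay free, so that functionals in them can act on whole slices. *)
Definition free_cube s x := forall i, i \in s -> 0 < x ord0 i < 1.

Lemma free_cube_cons i s x : free_cube (i :: s) x <-> 0 < x ord0 i < 1 /\ free_cube s x.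
Proof.
split=> [H|[Hi Hs] j]; last by rewrite inE => /predU1P[->|]; [exact: Hi|exact: Hs].
by split=> [|j js]; apply: H; rewrite inE ?eqxx// js orbT.
Qed.

Lemma free_cube_update s x i t : i \notin s -> free_cube s x -> free_cube s (update x i t).
Proof.
move=> si H j js; rewrite mxE; case: eqP => [ji|_]; last exact: H.
by rewrite -ji js in si.
Qed.

(** The properties shared by the composites of [actL] over the variables in [s], with the other
    variables as parameters. *)
Record functional_on s (F : ('rV[R]_d -> R) -> 'rV[R]_d -> R) : Prop := FunctionalOn {
  functional_on_uc : forall u, uc u -> uc (F u);
  functional_on_sum : forall (T : finType) (c : T -> R) (u : T -> 'rV[R]_d -> R), (forall a, uc (u a)) ->
    F (fun x => \sum_a c a * u a x) = fun x => \sum_a c a * F (u a) x;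
  functional_on_comm : forall j L u, bfun L -> j \notin s -> uc u -> F (actL j L u) = actL j L (F u);
  functional_on_indep : forall u i x t, uc u -> i \in s -> F u (update x i t) = F u x }.

Lemma functional_on_nil : functional_on [::] id.
Proof. by split. Qed.

Lemma functional_on_cons i s L F : i \notin s -> bfun L -> functional_on s F ->
  functional_on (i :: s) (fun u => actL i L (F u)).
Proof.
move=> is' bL HF; split.
- by move=> u ucu; apply: uc_actL => //; exact: functional_on_uc HF _ ucu.
- move=> T c u ucu; rewrite (functional_on_sum HF)//; apply/funext => x.
  by rewrite actL_sum// => a _; exact: functional_on_uc HF _ (ucu a).
- move=> j M u bM; rewrite inE negb_or => /andP[ji js] ucu.
  rewrite (functional_on_comm HF)// actL_comm 1?eq_sym//.
  exact: functional_on_uc HF _ ucu.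
move=> u j x t ucu; rewrite inE => /predU1P[->|js]; rewrite /actL; congr L; apply/funext => r.
  by rewrite update_update.
have ij : i != j by apply: contraNneq is' => ->.
by rewrite -updateC// (functional_on_indep HF).
Qed.

Definition tensor_on s (B : 'rV[R]_d -> R) := exists h : 'I_d -> R -> R,
  [/\ forall i, L2 leb (@open_itv R) (h i), forall i, i \notin s -> h i = fun=> 1 &
    B = fun x => \prod_i h i (x ord0 i)].

Lemma tensor_on_update s B x i t : tensor_on s B -> i \notin s -> B (update x i t) = B x.
Proof.
move=> [h [_ h1 ->]] is'; rewrite -[in RHS](update_id x i) !prod_update.
by rewrite h1.
Qed.

Lemma tensor_on_cons s i B (b : R -> R) : i \notin s -> L2 leb (@open_itv R) b -> tensor_on s B ->
  tensor_on (i :: s) (fun x => B x * b (x ord0 i)).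
Proof.
move=> is' Lb [h [Lh h1 ->]]; exists (fun j => if j == i then b else h j); split.
- by move=> j; case: ifP.
- by move=> j; rewrite inE negb_or => /andP[/negbTE ->] /h1.
apply/funext => x; rewrite (bigD1 i)//= h1// mul1r [RHS](bigD1 i)//= eqxx mulrC.
by congr (_ * _); apply: eq_bigr => j /negbTE ->.
Qed.

(** Separation of variables: [B a] depends only on the variables in [s], and [Phi a u] only on the
    remaining ones. *)
Definition rep_on s (F : ('rV[R]_d -> R) -> 'rV[R]_d -> R) :=
  exists (T : finType) (Phi : T -> ('rV[R]_d -> R) -> 'rV[R]_d -> R) (B : T -> 'rV[R]_d -> R),
  [/\ forall a, functional_on s (Phi a), forall a, tensor_on s (B a) &
    forall u, uc u -> forall x, free_cube s x -> F u x = \sum_a B a x * Phi a u x].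

(** As [B a] does not involve the new variable [x_i], the slice in [x_i] is a finite combination of
    continuous functions, to which the finite-rank form of [A i] and the linearity of its
    functionals apply. *)
Lemma rep_on_fold A s : uniq s -> (forall i, op_rep (A i)) -> rep_on s (fold A s).
Proof.
move=> us rA; elim: s us => [_|i s IH /= /andP[is' us]].
  exists unit, (fun=> id), (fun _ _ => 1); split => [_|_|u ucu x _].
  - exact: functional_on_nil.
  - exists (fun _ _ => 1); split => // [i|].
      by apply: L2_cst; [exact: measurable_open_itv|exact: open_itv_lty].
    by apply/funext => x; rewrite big1.
  - by rewrite (big_pred1 tt) ?mul1r// => -[].
have [T [Phi [B [HPhi HB HF]]]] := IH us.
have [U [L [b [bL Lb HA]]]] := rA i.
exists (T * U)%type, (fun a u => actL i (L a.2) (Phi a.1 u)), (fun a x => B a.1 x * b a.2 (x ord0 i)).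
split => [a|a|u ucu x /free_cube_cons[xi xs]].
- exact: functional_on_cons.
- exact: tensor_on_cons.
rewrite /= /act_on -/(fold A s u).
have -> : (fun t => fold A s u (update x i t)) =
    (fun t => \sum_a B a x * Phi a u (update x i t)).
  apply/funext => t; rewrite HF//; last exact: free_cube_update.
  by apply: eq_bigr => a _; rewrite (tensor_on_update _ _ (HB a)).
have cPhi a : continuous (fun t => Phi a u (update x i t)).
  by apply: uc_slice_continuous; exact: functional_on_uc (HPhi a) _ ucu.
rewrite HA//; last by apply: continuous_sum_fun => a _; apply: continuousZ_fun.
transitivity (\sum_c \sum_a B a x * b c (x ord0 i) * actL i (L c) (Phi a u) x).
  apply: eq_bigr => c _; rewrite bfun_sumE// mulr_suml; apply: eq_bigr => a _.
  by rewrite mulrAC.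
by rewrite exchange_big pair_bigA; apply: eq_bigr => -[].
Qed.

Section Rep.
Variables (A : 'I_d -> (R -> R) -> R -> R) (s : seq 'I_d).
Hypotheses (us : uniq s) (rA : forall i, op_rep (A i)).

(** Linearity is read off the separated form, because the univariate operators are known to be
    linear only on continuous functions. *)
Lemma fold_sum (T : finType) (c : T -> R) (u : T -> 'rV[R]_d -> R) x :
  (forall a, uc (u a)) -> free_cube s x ->
  fold A s (fun x => \sum_a c a * u a x) x = \sum_a c a * fold A s (u a) x.
Proof.
move=> ucu xs; have [U [Phi [B [HPhi HB HF]]]] := rep_on_fold us rA.
rewrite HF//; last exact: uc_sum.
transitivity (\sum_b \sum_a c a * (B b x * Phi b (u a) x)).
  apply: eq_bigr => b _; rewrite (functional_on_sum (HPhi b))// mulr_sumr.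
  by apply: eq_bigr => a _; rewrite mulrCA.
rewrite exchange_big; apply: eq_bigr => a _ /=.
by rewrite HF// mulr_sumr.
Qed.

Lemma fold_slice_continuous u x i : uc u -> i \notin s -> free_cube s x ->
  continuous (fun t => fold A s u (update x i t)).
Proof.
move=> ucu is' xs; have [U [Phi [B [HPhi HB HF]]]] := rep_on_fold us rA.
have -> : (fun t => fold A s u (update x i t)) =
    (fun t => \sum_a B a x * Phi a u (update x i t)).
  apply/funext => t; rewrite HF//; last exact: free_cube_update.
  by apply: eq_bigr => a _; rewrite (tensor_on_update _ _ (HB a)).
apply: continuous_sum_fun => a _; apply: continuousZ_fun; apply: uc_slice_continuous.
exact: functional_on_uc (HPhi a) _ ucu.
Qed.

Lemma fold_actL u x j L : bfun L -> uc u -> j \notin s -> free_cube s x ->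
  actL j L (fold A s u) x = fold A s (actL j L u) x.
Proof.
move=> bL ucu js xs; have [U [Phi [B [HPhi HB HF]]]] := rep_on_fold us rA.
rewrite HF//; last exact: uc_actL.
rewrite [LHS]/actL (_ : (fun t => fold A s u (update x j t)) =
    (fun t => \sum_a B a x * Phi a u (update x j t))); last first.
  apply/funext => t; rewrite HF//; last exact: free_cube_update.
  by apply: eq_bigr => a _; rewrite (tensor_on_update _ _ (HB a)).
rewrite bfun_sumE//.
  by apply: eq_bigr => a _; rewrite (functional_on_comm (HPhi a)).
by move=> a _; apply: uc_slice_continuous; exact: functional_on_uc (HPhi a) _ ucu.
Qed.

(** With every variable in [s], each [Phi a u] is a number and the result is a finite combination of
    tensor products. *)
Lemma fold_L2cube u : uc u -> (forall i, i \in s) -> L2cube (fold A s u).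
Proof.
move=> ucu sT; have [U [Phi [B [HPhi HB HF]]]] := rep_on_fold us rA.
apply: (@L2cube_ext _ _ (fun x => \sum_a B a x * Phi a u 0)); last first.
  apply: L2cube_sum => a _; apply: L2cubeZr; have [h [Lh _ ->]] := HB a.
  exact: L2cube_prod.
move=> x Ox; rewrite HF//.
apply: eq_bigr => a _; congr (_ * _).
(* The coordinates of the origin are exchanged for those of [x] one at a time, none of which
   [Phi a u] notices. *)
have indep (r : seq 'I_d) : Phi a u 0 = Phi a u (\row_i if i \in r then x ord0 i else 0).
  elim: r => [|i r ->]; first by congr (Phi a u _); apply/rowP => i; rewrite !mxE.
  rewrite -[LHS](functional_on_indep (HPhi a) (i := i) _ (x ord0 i))//.
  congr (Phi a u _); apply/rowP => j; rewrite !mxE inE.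
  by case: eqP => [->|].
rewrite (indep (enum 'I_d)); congr (Phi a u _); apply/rowP => i.
by rewrite !mxE mem_enum.
Qed.

End Rep.

Lemma fold_update A s u j : j \notin s -> (forall x t, u (update x j t) = u x) ->
  forall x t, fold A s u (update x j t) = fold A s u x.
Proof.
move=> + uj; elim: s => [//|i s IH]; rewrite inE negb_or => /andP[ji js] x t /=.
rewrite /act_on -/(fold A s u) mxE eq_sym (negbTE ji).
congr (A i _ _); apply/funext => r; rewrite -updateC 1?eq_sym//.
exact: IH.
Qed.

Lemma fold_ext A s u v : (forall i, op_local (A i)) ->
  (forall x, closed_cube x -> u x = v x) -> forall x, closed_cube x -> fold A s u x = fold A s v x.
Proof.
move=> lA uv; elim: s => [|i s IH] x Kx; first by rewrite /fold/= uv.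
rewrite /fold/= -/(fold A s u) -/(fold A s v) /act_on (lA i _ (fun t => fold A s v (update x i t)))// => t t01.
apply: IH => j; rewrite mxE; case: eqP => // _; exact: Kx.
Qed.

Lemma fold_eq A A' s u : (forall i, i \in s -> A i = A' i) -> fold A s u = fold A' s u.
Proof.
elim: s => [//|i s IH] AA'; rewrite /= /act_on AA' ?mem_head//.
by rewrite -/(fold A s u) IH// => j js; apply: AA'; rewrite inE js orbT.
Qed.

(** Once [A j] is expanded, its functionals pass through the operators of [s2] by [fold_actL], and
    the operators of [s1] act on the resulting finite sum by linearity. *)
Lemma fold_move A s1 s2 j u x (T : finType) (L : T -> (R -> R) -> R) (b : T -> R -> R) :
  uniq (s1 ++ j :: s2) -> (forall i, op_rep (A i)) -> uc u -> free_cube (s1 ++ j :: s2) x ->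
  (forall a, bfun (L a)) ->
  (forall f, continuous f -> forall t, 0 < t < 1 -> A j f t = \sum_a L a f * b a t) ->
  fold A (s1 ++ j :: s2) u x = \sum_a b a (x ord0 j) * fold A (s1 ++ s2) (actL j (L a) u) x.
Proof.
move=> us rA ucu xs bL HA; elim: s1 us x xs => [|i s1 IH] /= us x xs.
  move: us => /andP[js us]; move/free_cube_cons: xs => [xj xs].
  rewrite /act_on -/(fold A s2 u) HA//; last exact: fold_slice_continuous.
  apply: eq_bigr => a _; rewrite mulrC; congr (_ * _).
  by rewrite -fold_actL.
move: us => /andP[is' us]; move/free_cube_cons: xs => [xi xs].
have [is1 ij is2] : [/\ i \notin s1, i != j & i \notin s2].
  by move: is'; rewrite mem_cat inE !negb_or => /and3P[].
have us' : uniq (s1 ++ s2).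
  by move: us; rewrite !cat_uniq /= negb_or -!andbA => /and5P[-> _ -> _ ->].
have is12 : i \notin s1 ++ s2 by rewrite mem_cat negb_or is1.
have xs' : free_cube (s1 ++ s2) x.
  by move=> l; rewrite mem_cat => /orP[] ls; apply: xs; rewrite mem_cat ?inE ls ?orbT.
rewrite /act_on -/(fold A (s1 ++ j :: s2) u).
have -> : (fun t => fold A (s1 ++ j :: s2) u (update x i t)) = (fun t =>
    \sum_a b a (x ord0 j) * fold A (s1 ++ s2) (actL j (L a) u) (update x i t)).
  apply/funext => t; rewrite IH//; last exact: free_cube_update.
  by apply: eq_bigr => a _; rewrite mxE [j == i]eq_sym (negbTE ij).
have cf a : continuous (fun t => fold A (s1 ++ s2) (actL j (L a) u) (update x i t)).
  by apply: fold_slice_continuous => //; exact: uc_actL.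
have [U [M [c [bM _ HAi]]]] := rA i.
rewrite HAi//; last by apply: continuous_sum_fun => a _; exact: continuousZ_fun.
transitivity (\sum_e \sum_a b a (x ord0 j) *
    (M e (fun t => fold A (s1 ++ s2) (actL j (L a) u) (update x i t)) * c e (x ord0 i))).
  apply: eq_bigr => e _; rewrite bfun_sumE// mulr_suml; apply: eq_bigr => a _.
  by rewrite mulrA.
rewrite exchange_big; apply: eq_bigr => a _ /=.
by rewrite -mulr_sumr -/(fold A (s1 ++ s2) (actL j (L a) u)) -HAi.
Qed.

End TensorFold.

(** * The sparse interpolant *)

Section SparseInterpolant.
Variables (R : realType) (d k : nat).
Implicit Types (x y : 'rV[R]_d) (u g : 'rV[R]_d -> R) (i j : 'I_d) (I J : {set 'I_d}).
Implicit Types (m : 'I_d -> nat).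

(** One family for both kinds of variables: [Hop] becomes a single [fold], and the families for [I]
    and [j |: I] differ only at [j]. *)
Definition cell_op m I i : (R -> R) -> R -> R :=
  if i \in I then Delta1 k (m i) else Delta0 k (m i).

Lemma cell_op_rep m I i : op_rep (cell_op m I i).
Proof. by rewrite /cell_op; case: ifP => _; [exact: Delta1_op_rep|exact: Delta0_op_rep]. Qed.

Lemma cell_op_local m I i : op_local (cell_op m I i).
Proof. by rewrite /cell_op; case: ifP => _; [exact: Delta1_local|exact: Delta0_local]. Qed.

Lemma HopE m I u : Hop k m I u = fold (cell_op m I) (enum I ++ enum (~: I)) u.
Proof.
rewrite /fold foldr_cat -/(fold _ _ u) -/(fold _ (enum I) _).
rewrite (@fold_eq _ _ _ (fun j => Delta0 k (m j)) (enum (~: I))); last first.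
  by move=> i; rewrite mem_enum inE /cell_op => /negbTE ->.
by rewrite (@fold_eq _ _ _ (fun j => Delta1 k (m j)))// => i; rewrite mem_enum /cell_op => ->.
Qed.

Lemma uniq_enum_cat I : uniq (enum I ++ enum (~: I)).
Proof.
rewrite cat_uniq !enum_uniq andbT /=; apply/hasPn => i; rewrite !mem_enum inE.
exact: id.
Qed.

Lemma mem_enum_cat I i : i \in enum I ++ enum (~: I).
Proof. by rewrite mem_cat !mem_enum inE orbN. Qed.

Lemma Hop_clamp m I u x : open_cube x ->
  Hop k m I u x = fold (cell_op m I) (enum I ++ enum (~: I)) (u \o @cubeclamp R d) x.
Proof.
move=> /open_cubeW Kx; rewrite HopE; apply: fold_ext Kx; first exact: cell_op_local.
by move=> y Ky /=; rewrite cubeclamp_id.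
Qed.

Lemma Hop_L2cube m I u : {within @closed_cube R d, continuous u} -> L2cube (Hop k m I u).
Proof.
move=> cu; apply: (@L2cube_ext _ _ (fold (cell_op m I) (enum I ++ enum (~: I)) (u \o @cubeclamp R d))).
  by move=> x /Hop_clamp ->.
apply: fold_L2cube; [exact: uniq_enum_cat|exact: cell_op_rep|exact: uc_clamp|exact: mem_enum_cat].
Qed.

(** [Hop] runs through its variables in the order of [enum]; deleting [j] keeps the order of the
    others, so [I] and [j |: I] leave the same list. *)
Lemma enum_setD1_split (K : {set 'I_d}) j : j \in K ->
  exists s1 s2, enum K = s1 ++ j :: s2 /\ enum (K :\ j) = s1 ++ s2.
Proof.
move=> jK; have EK : enum (K :\ j) = rem j (enum K).
  rewrite rem_filter ?enum_uniq// {1}/enum_mem [enum K]/enum_mem -filter_predI.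
  by apply: eq_filter => i; rewrite !inE.
have : j \in enum K by rewrite mem_enum.
have := enum_uniq K; rewrite EK => uK /path.splitPr E; case: E uK => s1 s2 uK.
exists s1, s2; split => //; rewrite rem_filter// filter_cat /= eqxx.
move: uK; rewrite cat_uniq /= negb_or -!andbA => /and5P[_ js1 _ js2 _].
have F s : j \notin s -> [seq x <- s | predC1 j x] = s.
  by move=> js; apply/all_filterP/allP => i is_; apply: contraNneq js => <-.
by rewrite !F.
Qed.

Lemma uc_eq_closed_cube u g : uc u -> uc g -> (forall x, open_cube x -> u x = g x) ->
  forall x, closed_cube x -> u x = g x.
Proof.
move=> ucu ucg E x Kx; apply/eqP; rewrite -subr_eq0 -normr_le0; apply/ler_addgt0Pr => e e0.
have e2 : 0 < e / 2 by rewrite divr_gt0.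
have [r r0 Hr] := ucu _ e2; have [s s0 Hs] := ucg _ e2.
pose h := Num.min (Num.min r s) 1.
have h0 : 0 < h by rewrite !lt_min r0 s0 ltr01.
have [hr hs h1] : [/\ h <= r, h <= s & h <= 1] by rewrite !ge_min !lexx !orbT.
(* [x] is moved towards the centre of the cube by the fraction [h], small enough for both moduli of
   continuity. *)
pose x' : 'rV[R]_d := \row_i (x ord0 i + h * (2^-1 - x ord0 i)).
have xE i : x' ord0 i = x ord0 i + h * (2^-1 - x ord0 i) by rewrite mxE.
have Ox' : open_cube x'.
  move=> i; rewrite xE; have /andP[xi0 xi1] := Kx i; have : (0 : R) < 2^-1 by rewrite invr_gt0.
  have : (2^-1 + 2^-1 = 1 :> R) by lra.
  set q : R := 2^-1; set z := x ord0 i in xi0 xi1 * => q1 q0.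
  have -> : z + h * (q - z) = z * (1 - h) + h * q by ring.
  have zh0 : 0 <= z * (1 - h) by rewrite mulr_ge0// subr_ge0.
  have zh1 : z * (1 - h) <= 1 - h by rewrite ler_piMl// subr_ge0.
  have hq0 : 0 < h * q by rewrite mulr_gt0.
  have hq1 : h * q < h by rewrite gtr_pMr//; lra.
  by apply/andP; split; lra.
have xx' : close h x x'.
  move=> i; rewrite xE opprD addrA subrr add0r normrN normrM (gtr0_norm h0).
  rewrite -[ltRHS]mulr1 ltr_pM2l//; have /andP[xi0 xi1] := Kx i.
  by rewrite ltr_norml; apply/andP; split; lra.
have H1 : `|u x - u x'| <= e / 2 by apply: Hr => i; exact: lt_le_trans (xx' i) hr.
have H2 : `|g x - g x'| <= e / 2 by apply: Hs => i; exact: lt_le_trans (xx' i) hs.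
have -> : u x - g x = (u x - u x') - (g x - g x') by rewrite (E _ Ox'); ring.
by rewrite add0r (le_trans (ler_normB _ _))//; lra.
Qed.

Lemma actL_cubeclamp j (L : (R -> R) -> R) u y : bfun L ->
  actL j L (u \o @cubeclamp R d) y = actL j L (u \o @cubeclamp R d) (cubeclamp y).
Proof.
move=> bL; apply: (bfun_local bL) => t t01 /=; congr u.
by rewrite !cubeclamp_update// [in RHS]cubeclamp_id//; exact: cubeclamp_closed.
Qed.

(** At interior points clamping is locally the identity, so the slice keeps its derivative. *)
Lemma is_derive_clamped_slice j u g y (t : R) : open_cube y -> 0 < t < 1 ->
  (forall x, open_cube x -> is_derive x (delta_mx ord0 j) u (g x)) ->
  is_derive t 1 (fun s => u (cubeclamp (update y j s))) (g (cubeclamp (update y j t))).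
Proof.
move=> Oy t01 du.
have Ot s : 0 < s < 1 -> open_cube (update y j s).
  by move=> s01 i; rewrite mxE; case: eqP => // _; exact: Oy.
have dut := du _ (Ot _ t01).
rewrite cubeclamp_id; last exact/open_cubeW/Ot.
have := is_derive_slice (@ex_derive _ _ _ _ _ _ _ dut).
rewrite /partial (@derive_val _ _ _ _ _ _ _ dut).
apply: near_eq_is_derive.
have : \forall s \near t, s \in `]0, 1[ by apply: near_in_itvoo; rewrite in_itv.
apply: filterS => s; rewrite in_itv/= => s01.
by rewrite cubeclamp_id//; exact/open_cubeW/Ot.
Qed.

(** Both images are expanded with the operator in [x_j] innermost and the same list [rest] outside.
    As functions of [x_j] they combine the [b a] and the [b' a] with the same coefficients, which do
    not depend on [x_j], so every slice is a weakly differentiable pair. *)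
Lemma Hop_weak_derivative m I j u g : j \notin I ->
  {within @closed_cube R d, continuous u} -> {within @closed_cube R d, continuous g} ->
  (forall x, open_cube x -> is_derive x (delta_mx ord0 j) u (g x)) ->
  weak_derivative j (Hop k m I u) (Hop k m (j |: I) g).
Proof.
move=> jI cu cg du.
pose ub := u \o @cubeclamp R d; pose gb := g \o @cubeclamp R d.
have ucu : uc ub := uc_clamp cu; have ucg : uc gb := uc_clamp cg.
pose A := cell_op m I; pose A' := cell_op m (j |: I).
pose rest := enum I ++ enum (~: (j |: I)).
have jrest : j \notin rest by rewrite mem_cat !mem_enum !inE eqxx (negbTE jI).
have urest : uniq rest.
  rewrite cat_uniq !enum_uniq andbT /=; apply/hasPn => i; rewrite !mem_enum !inE negb_or.
  by case/andP.
have rA i : op_rep (A i) := cell_op_rep m I i.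
have [T [L [b [b' [bL wb HA HA']]]]] := @Delta_op_pair_rep R k (m j).
(* [L] and [b'] represent [Delta1] on derivatives only. Moving it past other operators requires a
   representation on all continuous functions, which [M] and [c] supply. *)
have [U [M [c [bM _ HB]]]] := @Delta1_op_rep R k (m j).
have Aj : A j = Delta0 k (m j) by rewrite /A /cell_op (negbTE jI).
have A'j : A' j = Delta1 k (m j) by rewrite /A' /cell_op setU11.
have Fu x : open_cube x -> Hop k m I u x = \sum_a b a (x ord0 j) * fold A rest (actL j (L a) ub) x.
  move=> Ox; rewrite Hop_clamp// -/A -/ub.
  have [|s1 [s2 [E1 E2]]] := @enum_setD1_split (~: I) j; first by rewrite inE.
  have E : ~: (j |: I) = (~: I) :\ j by apply/setP => i; rewrite !inE negb_or.
  have us := uniq_enum_cat I; rewrite E1 catA in us *.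
  rewrite (@fold_move _ _ _ _ _ _ _ _ _ L b)//; last by rewrite Aj.
  by rewrite /rest E E2 catA.
have Fg x : open_cube x ->
    Hop k m (j |: I) g x = \sum_a c a (x ord0 j) * fold A rest (actL j (M a) gb) x.
  move=> Ox; rewrite Hop_clamp// -/A' -/gb.
  have [|s1 [s2 [E1 E2]]] := @enum_setD1_split (j |: I) j; first exact: setU11.
  have us := uniq_enum_cat (j |: I); rewrite E1 -catA /= in us *.
  rewrite setU1K// in E2.
  rewrite (@fold_move _ _ _ _ _ _ _ _ _ M c)//; last 2 first.
  - exact: cell_op_rep.
  - by rewrite A'j.
  apply: eq_bigr => a _; rewrite catA -E2 -/rest; congr (_ * _).
  rewrite (@fold_eq _ _ A' A)// => i irest; rewrite /A' /A /cell_op !inE.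
  by case: eqP => // ij; rewrite -ij irest in jrest.
(* For [y] in the open cube both sides are [Delta1] of the slice of [g]. Continuity and clamping
   extend the identity to every [y], because the functionals of the other variables also read
   boundary values. *)
have key y t : 0 < t < 1 ->
    \sum_a c a t * actL j (M a) gb y = \sum_a b' a t * actL j (L a) ub y.
  move=> t01; transitivity (\sum_a c a t * actL j (M a) gb (cubeclamp y)).
    by apply: eq_bigr => a _; rewrite /gb actL_cubeclamp.
  transitivity (\sum_a b' a t * actL j (L a) ub (cubeclamp y)); last first.
    by apply: eq_bigr => a _; rewrite /ub [in RHS]actL_cubeclamp.
  apply: (@uc_eq_closed_cube (fun y => \sum_a c a t * actL j (M a) gb y)
    (fun y => \sum_a b' a t * actL j (L a) ub y)); last exact: cubeclamp_closed.
  - by apply: uc_sum => a _; exact: uc_actL.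
  - by apply: uc_sum => a _; exact: uc_actL.
  move=> z Oz; transitivity (Delta1 k (m j) (fun s => gb (update z j s)) t).
    rewrite HB//; last exact: uc_slice_continuous.
    by apply: eq_bigr => a _; rewrite mulrC.
  have dz (s : R) : 0 < s < 1 -> is_derive s 1 (fun s => ub (update z j s)) (gb (update z j s)).
    by move=> s01; exact: is_derive_clamped_slice.
  have [cub cgb] : continuous (fun s => ub (update z j s)) /\ continuous (fun s => gb (update z j s)).
    by split; exact: uc_slice_continuous.
  rewrite (HA' _ _ cub cgb dz)//.
  by apply: eq_bigr => a _; rewrite mulrC.
have Fg' x : open_cube x ->
    Hop k m (j |: I) g x = \sum_a b' a (x ord0 j) * fold A rest (actL j (L a) ub) x.
  move=> Ox; rewrite Fg//.
  have xr : free_cube rest x by move=> i _; exact: Ox.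
  (* At fixed [x] the values of [c a] and [b' a] are mere coefficients, so both sums move inside
     [fold], where [key] compares the arguments. *)
  rewrite -(fold_sum urest rA (fun a => c a (x ord0 j)) (fun a => uc_actL j (bM a) ucg) xr).
  rewrite -(fold_sum urest rA (fun a => b' a (x ord0 j)) (fun a => uc_actL j (bL a) ucu) xr).
  by congr (fold A rest _ x); apply/funext => y; apply: key; exact: Ox.
apply: weak_derivative_slices; [exact: Hop_L2cube|exact: Hop_L2cube|].
move=> x Ox.
have Os s : open_itv s -> open_cube (update x j s).
  by move=> /open_itvE s01 i; rewrite mxE; case: eqP => // _; exact: Ox.
have V a s : fold A rest (actL j (L a) ub) (update x j s) = fold A rest (actL j (L a) ub) x.
  apply: fold_update => // y t; rewrite /actL; congr (L a _); apply/funext => r.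
  by rewrite update_update.
apply: wpair_ext (wpair_sum (fun a => fold A rest (actL j (L a) ub) x) wb) => s s01.
  by rewrite Fu; [apply: eq_bigr => a _; rewrite V mxE eqxx mulrC|exact: Os].
by rewrite Fg'; [apply: eq_bigr => a _; rewrite V mxE eqxx mulrC|exact: Os].
Qed.

(** Linearity of the tensor product operator; a nonzero [wedge_coef] forces [J = j |: I], which
    turns [Hop] for [J] into [Hop] for [j |: I]. *)
Lemma Hop_ext_sum m l (D : {set 'I_d} -> 'I_d -> 'rV[R]_d -> R) J x :
  (forall I j, #|I| = l -> j \notin I -> {within @closed_cube R d, continuous (D I j)}) ->
  open_cube x ->
  Hop k m J (ext_sum l D J) x = \sum_(I : {set 'I_d} | #|I| == l) \sum_(j | j \notin I)
    Hop k m (j |: I) (D I j) x * wedge_coef R j I J.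
Proof.
move=> cD Ox.
(* The nested sum becomes a sum over all pairs, padded with zero where [D] is not known to be
   continuous. *)
pose P (a : {set 'I_d} * 'I_d) := (#|a.1| == l) && (a.2 \notin a.1).
pose c a := if P a then wedge_coef R a.2 a.1 J else 0.
pose w a := if P a then D a.1 a.2 \o @cubeclamp R d else fun=> 0.
have sumE (F : {set 'I_d} -> 'I_d -> R) :
    \sum_(I : {set 'I_d} | #|I| == l) \sum_(j | j \notin I) F I j * wedge_coef R j I J =
    \sum_a c a * F a.1 a.2.
  rewrite pair_big_dep /= big_mkcond; apply: eq_bigr => -[I j] _ /=.
  by rewrite /c /P /=; case: ifP => _; rewrite ?mul0r// mulrC.
have ucw a : uc (w a).
  rewrite /w /P; case: ifP => [/andP[/eqP al ja]|_]; last exact: uc0.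
  exact/uc_clamp/cD.
rewrite Hop_clamp// sumE.
have -> : ext_sum l D J \o @cubeclamp R d = fun y => \sum_a c a * w a y.
  apply/funext => y; rewrite /= /ext_sum sumE; apply: eq_bigr => a _.
  by rewrite /c /w; case: ifP; rewrite ?mul0r.
rewrite fold_sum//; last 2 first.
- exact: uniq_enum_cat.
- exact: cell_op_rep.
apply: eq_bigr => a _; rewrite /c /w; case: ifP => [Pa|]; last by rewrite !mul0r.
rewrite /wedge_coef; case: eqP => [->|_]; last by rewrite !mul0r.
by rewrite Hop_clamp.
Qed.

(** One set of multi-indices serves all form degrees, so the sum over it can be exchanged with the
    sums of the exterior derivative. *)
Lemma weak_ext_der_interp n l (omega : dform R d) (D : {set 'I_d} -> 'I_d -> 'rV[R]_d -> R) :
  regular_form l omega D -> weak_ext_der l (interp k n omega) (interp k n (ext_sum l D)).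
Proof.
move=> reg.
exists (fun I j x => \sum_(m : {ffun 'I_d -> 'I_(n + d)} | sparse_index m)
  Hop k (fun i => m i) (j |: I) (D I j) x); split => [I Il|J Jl].
  have [co dom] := reg I Il; split.
    by apply: L2cube_sum => m _; exact: Hop_L2cube.
  move=> j jI; have [du cD] := dom j jI.
  have [] // := @weak_derivative_sum R d _ (index_enum {ffun 'I_d -> 'I_(n + d)})
    (@sparse_index d n) j (fun m : {ffun 'I_d -> 'I_(n + d)} => Hop k (fun i => m i) I (omega I))
    (fun m : {ffun 'I_d -> 'I_(n + d)} => Hop k (fun i => m i) (j |: I) (D I j)).
  by move=> m _; exact: Hop_weak_derivative.
apply/aeW => t Ot; rewrite /interp /ext_sum.
transitivity (\sum_(m : {ffun 'I_d -> 'I_(n + d)} | sparse_index m)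
  \sum_(I : {set 'I_d} | #|I| == l) \sum_(j | j \notin I)
    Hop k (fun i => m i) (j |: I) (D I j) (to_rV t) * wedge_coef R j I J).
  apply: eq_bigr => m _; apply: Hop_ext_sum => [I j Il jI|]; last exact: Ot.
  exact: ((reg I Il).2 j jI).2.
rewrite exchange_big/=; apply: eq_bigr => I _.
by rewrite exchange_big/=; apply: eq_bigr => j _; rewrite mulr_suml.
Qed.

End SparseInterpolant.

Theorem mainTheorem5 (R : realType) (d k n l : nat)
    (hd : (1 <= d)%N) (hl : (l <= d - 1)%N)
    (psi : nat -> nat -> 'I_k.+1 -> R -> R)
    (hpsi : forall m i, (i < 2 ^ m)%N -> orthonormal_basis m i (psi m.+1 i)) :
  (forall omega : dform R d, Vspace psi n l omega ->
     exists2 eta : dform R d, Vspace psi n l.+1 eta & weak_ext_der l omega eta) /\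
  (forall (omega : dform R d) (D : {set 'I_d} -> 'I_d -> 'rV[R]_d -> R),
     regular_form l omega D ->
     weak_ext_der l (interp k n omega) (interp k n (ext_sum l D))).
Proof.
split; first by move=> omega; exact: weak_derivative_Vspace.
by move=> omega D; exact: weak_ext_der_interp.
Qed.
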